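(* Let $\mathcal C_0,\mathcal C_1,\mathcal C_2,\mathcal C$ be small categories and let $F_1\colon\mathcal C_0\to\mathcal C_1$, $F_2\colon\mathcal C_0\to\mathcal C_2$, $I_1\colon\mathcal C_1\to\mathcal C$, $I_2\colon\mathcal C_2\to\mathcal C$ be functors with $I_1F_1=I_2F_2$ forming a (strict) pushout square of categories. Put $I_0=I_1F_1=I_2F_2$. Assume that at least one of $F_1$, $F_2$ is injective on objects and that all of $I_1$, $I_2$ and $I_0$ are local coverings. Then an exact Mayer--Vietoris sequence associated with this square exists, both for derived colimits and for derived limits. That is: (a) for every functor $M\colon\mathcal C\to\mathsf{Ab}$ there are connecting homomorphisms $\partial$ making the following sequence exact: $$\cdots\to\operatorname{colim}^{\mathcal C}_{n+1}M\xrightarrow{\partial}\operatorname{colim}^{\mathcal C_0}_nI_0^*M\to\operatorname{colim}^{\mathcal C_1}_nI_1^*M\oplus\operatorname{colim}^{\mathcal C_2}_nI_2^*M\to\operatorname{colim}^{\mathcal C}_nM\xrightarrow{\partial}\operatorname{colim}^{\mathcal C_0}_{n-1}I_0^*M\to\cdots$$ (b) dually, for every functor $L\colon\mathcal C^{\mathrm{op}}\to\mathsf{Ab}$ there are connecting homomorphisms $\partial$ making the following sequence exact: $$\cdots\to\lim^{n}_{\mathcal C^{\mathrm{op}}}L\to\lim^n_{\mathcal C_1^{\mathrm{op}}}I_1^*L\oplus\lim^n_{\mathcal C_2^{\mathrm{op}}}I_2^*L\to\lim^n_{\mathcal C_0^{\mathrm{op}}}I_0^*L\xrightarrow{\partial}\lim^{n+1}_{\mathcal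 C^{\mathrm{op}}}L\to\cdots$$ In both sequences the maps other than $\partial$ are those induced by the functors $F_1,F_2,I_1,I_2$ (with the usual sign on one of the components, so that consecutive maps compose to zero).
   Context: All indexing categories are small. A left $\mathcal C$-module is a functor $\mathcal C\to\mathsf{Ab}$; a right $\mathcal C$-module is a functor $\mathcal C^{\mathrm{op}}\to\mathsf{Ab}$. $\operatorname{colim}^{\mathcal C}_n=L_n\operatorname{colim}^{\mathcal C}$ denotes the $n$-th left derived functor of $\operatorname{colim}^{\mathcal C}\colon[\mathcal C,\mathsf{Ab}]\to\mathsf{Ab}$, and $\lim^n_{\mathcal C^{\mathrm{op}}}=R^n\lim_{\mathcal C^{\mathrm{op}}}$ the $n$-th right derived functor of $\lim_{\mathcal C^{\mathrm{op}}}\colon[\mathcal C^{\mathrm{op}},\mathsf{Ab}]\to\mathsf{Ab}$; both are zero for $n<0$. For a functor $F\colon\mathcal D\to\mathcal C$, $F^*$ denotes restriction (precomposition with $F$ or $F^{\mathrm{op}}$). Under categories: for $F\colon\mathcal D\to\mathcal C$ and $c\in\mathcal C$, the under category $c/F$ has objects pairs $(d,f\colon c\to Fd)$ with $d\in\mathcal D$, and morphisms $(d,f)\to(d',f')$ the morphisms $g\colon d\to d'$ in $\mathcal D$ with $F(g)f=f'$; $c/\mathcal C$ means $c/\mathrm{Id}_{\mathcal C}$. A functor $F\colon\mathcal D\to\mathcal C$ is a local covering if for each $c\in\mathcal C$ the under category $c/F$ is homotopically discrete, i.e. its nerve $N(c/F)$ is weakly homotopy equivalent to a discrete space. Model and induced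 maps: for a simplicial set $K$, $\mathbb ZK$ is its chain complex of free abelian groups on simplices. For $L$ a right and $M$ a left $\mathcal C$-module, $L\otimes_{\mathcal C}M$ is the quotient of $\bigoplus_{c\in\mathcal C}Lc\otimes Mc$ by the relations $xf\otimes y=x\otimes fy$ for morphisms $f\colon c_0\to c_1$, $x\in Lc_1$, $y\in Mc_0$. One takes $\operatorname{colim}^{\mathcal C}_nM=H_n(\mathbb ZN(-/\mathcal C)\otimes_{\mathcal C}M)$, where $\mathbb ZN(-/\mathcal C)$ is the complex of right $\mathcal C$-modules $c\mapsto\mathbb ZN(c/\mathcal C)$. For $F\colon\mathcal D\to\mathcal C$, with $F_!$ the left adjoint of $F^*$ on right modules, the canonical map $\mathbb ZN(-/\mathcal D)\to F^*\mathbb ZN(-/\mathcal C)$ has an adjunct $F_!\mathbb ZN(-/\mathcal D)\to\mathbb ZN(-/\mathcal C)$; tensoring it with $M$, using $F_!\mathbb ZN(-/\mathcal D)\otimes_{\mathcal C}M\cong\mathbb ZN(-/\mathcal D)\otimes_{\mathcal D}F^*M$, and taking homology gives the induced map $F_*\colon\operatorname{colim}^{\mathcal D}_nF^*M\to\operatorname{colim}^{\mathcal C}_nM$. Dually, $\lim^n_{\mathcal C^{\mathrm{op}}}L=H^n(\operatorname{Hom}_{\mathcal C^{\mathrm{op}}}(\mathbb ZN(-/\mathcal C),L))$, where $\operatorname{Hom}_{\mathcal C^{\mathrm{op}}}$ denotes natural transformations of right $\mathcal C$-modules, and the same adjunct induces $\lim^n_{\mathcal C^{\mathrm{op}}}L\to\lim^n_{\mathcal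 D^{\mathrm{op}}}F^*L$. *)

(* Defs.v *)
From HB Require Import structures.
From mathcomp Require Import all_boot ssralg ssrint generic_quotient ring_quotient.
From mathcomp Require Import boolp freeg.
From mathcomp Require Import zify.
From Stdlib Require Import JMeq.
From Stdlib.Relations Require Import Relation_Operators.

Set Implicit Arguments.
Unset Strict Implicit.
Unset Printing Implicit Defensive.

Import GRing.Theory.
Local Open Scope ring_scope.

(* Abelian groups are [zmodType]s; as classical axioms are available, the
   decidable equality and choice operator of a [zmodType] are no restriction. *)

Record subgroup (V : zmodType) := Subgroup {
  in_sub :> V -> Prop;
  in_sub0 : in_sub 0;
  in_subB : forall x y, in_sub x -> in_sub y -> in_sub (x - y) }.

Definition sub_pred V (S : subgroup V) : pred V := fun x => `[< S x >].

Lemma sub_predP V (S : subgroup V) : zmod_closed (sub_pred S).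
Proof.
split; first by apply/asboolP; exact: in_sub0.
by move=> x y /asboolP Sx /asboolP Sy; apply/asboolP; exact: in_subB.
Qed.

Definition sub_zmod (V : zmodType) (S : subgroup V) : zmodClosed V :=
  HB.pack (sub_pred S) (GRing.isZmodClosed.Build V (sub_pred S) (sub_predP S)).

Definition quotient (V : zmodType) (S : subgroup V) : zmodType :=
  Quotient.quot (sub_zmod S).

Definition quotient_pi (V : zmodType) (S : subgroup V) :
  {additive V -> quotient S} := \pi_(Quotient.quot (sub_zmod S))%qT.

Lemma quotient_piP (V : zmodType) (S : subgroup V) (q : quotient S) :
  exists x, quotient_pi S x = q.
Proof. by exists (repr q); exact: reprK. Qed.

Lemma quotient_eq (V : zmodType) (S : subgroup V) (x y : V) :
  quotient_pi S x = quotient_pi S y <-> S (x - y).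
Proof.
split.
  move/eqP; rewrite -[_ == _]/(\pi_(Quotient.quot (sub_zmod S))%qT x ==
    \pi_(Quotient.quot (sub_zmod S))%qT y) -Quotient.idealrBE => /asboolP.
  exact.
move=> Sxy; apply/eqP; rewrite -[_ == _]/(\pi_(Quotient.quot (sub_zmod S))%qT x ==
    \pi_(Quotient.quot (sub_zmod S))%qT y) -Quotient.idealrBE; exact/asboolP.
Qed.

Definition quotient_fun (V W : zmodType) (S : subgroup V) (f : V -> W) :
  quotient S -> W := fun q => f (repr q).

Section QuotientLift.
Variables (V W : zmodType) (S : subgroup V) (f : {additive V -> W}).
Hypothesis fS : forall x, S x -> f x = 0.

Lemma quotient_funE x : quotient_fun (S := S) f (quotient_pi S x) = f x.
Proof.
apply/eqP; rewrite -subr_eq0 -raddfB; apply/eqP/fS.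
by apply/quotient_eq; rewrite /quotient_pi /= reprK.
Qed.

Lemma quotient_fun_additive : zmod_morphism (quotient_fun (S := S) f).
Proof.
move=> p q; have [x <-] := quotient_piP p; have [y <-] := quotient_piP q.
by rewrite -raddfB !quotient_funE raddfB.
Qed.
End QuotientLift.

Definition quotient_lift (V W : zmodType) (S : subgroup V)
    (f : {additive V -> W}) (fS : forall x, S x -> f x = 0) :
    {additive quotient S -> W} :=
  HB.pack (quotient_fun f)
    (GRing.isZmodMorphism.Build _ _ _ (quotient_fun_additive fS)).

Lemma quotient_liftE (V W : zmodType) (S : subgroup V)
    (f : {additive V -> W}) (fS : forall x, S x -> f x = 0) x :
  quotient_lift fS (quotient_pi S x) = f x.
Proof. exact: (quotient_funE fS). Qed.

Section SubOf.
Variables (V : zmodType) (S : subgroup V).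

Record sub_of := SubOf { sub_val : V; _ : sub_val \in sub_zmod S }.

HB.instance Definition _ := [isSub for sub_val].
HB.instance Definition _ := [Choice of sub_of by <:].
HB.instance Definition _ := [SubChoice_isSubZmodule of sub_of by <:].

Lemma sub_of_in (z : sub_of) : S (val z).
Proof. by case: z => x /= /asboolP. Qed.

Definition to_sub (x : V) (Sx : S x) : sub_of := SubOf (asboolT Sx).
End SubOf.

Section Subquotient.
Variables (V : zmodType) (Z B : subgroup V).

Lemma sub_restr0 : B (val (0 : sub_of Z)).
Proof. by rewrite raddf0; exact: in_sub0. Qed.

Lemma sub_restrB (x y : sub_of Z) : B (val x) -> B (val y) -> B (val (x - y)).
Proof. by move=> Bx By; rewrite raddfB; exact: in_subB. Qed.

Definition sub_restr : subgroup (sub_of Z) :=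
  @Subgroup _ (fun z => B (val z)) sub_restr0 sub_restrB.

Definition subquotient : zmodType := quotient sub_restr.
End Subquotient.

Section SubquotientMap.
Variables (V W : zmodType) (Z B : subgroup V) (Z' B' : subgroup W).
Variable f : {additive V -> W}.
Hypotheses (fZ : forall x, Z x -> Z' (f x)) (fB : forall x, B x -> B' (f x)).

Definition sub_map (z : sub_of Z) : sub_of Z' := to_sub (fZ (sub_of_in z)).

Lemma sub_map_additive : zmod_morphism sub_map.
Proof.
move=> x y; apply: (@val_inj _ _ (sub_of Z')).
have E (z : sub_of Z) : \val (sub_map z) = f (val z) by [].
by rewrite E !raddfB -!E.
Qed.

HB.instance Definition _ :=
  GRing.isZmodMorphism.Build _ _ sub_map sub_map_additive.

Lemma sub_map0 (z : sub_of Z) :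
  sub_restr Z B z -> (quotient_pi (sub_restr Z' B') \o sub_map) z = 0.
Proof.
move=> Bz; rewrite /= -(raddf0 (quotient_pi (sub_restr Z' B'))).
by apply/quotient_eq; rewrite subr0; exact: fB.
Qed.

Definition subquotient_map : {additive subquotient Z B -> subquotient Z' B'} :=
  quotient_lift sub_map0.
End SubquotientMap.

Inductive span (V : zmodType) (P : V -> Prop) : V -> Prop :=
  | span0 : span P 0
  | span_gen x : P x -> span P x
  | spanB x y : span P x -> span P y -> span P (x - y).

Definition span_subgroup (V : zmodType) (P : V -> Prop) : subgroup V :=
  Subgroup (span0 P) (@spanB V P).

Lemma kernel0 (V W : zmodType) (f : {additive V -> W}) : f 0 = 0.
Proof. exact: raddf0. Qed.

Lemma kernelB (V W : zmodType) (f : {additive V -> W}) x y :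
  f x = 0 -> f y = 0 -> f (x - y) = 0.
Proof. by move=> fx fy; rewrite raddfB fx fy subr0. Qed.

Definition kernel (V W : zmodType) (f : {additive V -> W}) : subgroup V :=
  @Subgroup V (fun x => f x = 0) (kernel0 f) (@kernelB V W f).

Lemma image0 (V W : zmodType) (f : {additive V -> W}) : exists y, 0 = f y.
Proof. by exists 0; rewrite raddf0. Qed.

Lemma imageB (V W : zmodType) (f : {additive V -> W}) x y :
  (exists z, x = f z) -> (exists z, y = f z) -> exists z, x - y = f z.
Proof. by move=> [a ->] [b ->]; exists (a - b); rewrite raddfB. Qed.

Definition image (V W : zmodType) (f : {additive V -> W}) : subgroup W :=
  @Subgroup W (fun x => exists y, x = f y) (image0 f) (@imageB V W f).

Record chain_complex := ChainComplex {
  chain_ob :> nat -> zmodType;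
  chain_d : forall n, {additive chain_ob n.+1 -> chain_ob n};
  chain_dd : forall n x, chain_d n (chain_d n.+1 x) = 0 }.

(* Chain complexes vanish in negative degrees, so every 0-chain is a cycle. *)
Definition cycles (X : chain_complex) n : subgroup (X n) :=
  match n with
  | 0 => kernel (\0 : X 0 -> X 0)
  | m.+1 => kernel (chain_d X m)
  end.

Definition homology (X : chain_complex) n : zmodType :=
  subquotient (cycles X n) (image (chain_d X n)).

Record chain_map (X Y : chain_complex) := ChainMap {
  chain_map_fun :> forall n, {additive X n -> Y n};
  chain_map_d : forall n x,
    chain_map_fun n (chain_d X n x) = chain_d Y n (chain_map_fun n.+1 x) }.

Section HomologyMap.
Variables (X Y : chain_complex) (f : chain_map X Y) (n : nat).

Lemma chain_map_cycles x : cycles X n x -> cycles Y n (f n x).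
Proof.
case: n x => [|m] x //= dx0.
by rewrite -chain_map_d dx0 raddf0.
Qed.

Lemma chain_map_boundaries x :
  image (chain_d X n) x -> image (chain_d Y n) (f n x).
Proof. by move=> [y ->]; exists (f n.+1 y); exact: chain_map_d. Qed.

Definition homology_map : {additive homology X n -> homology Y n} :=
  subquotient_map chain_map_cycles chain_map_boundaries.
End HomologyMap.

Record cochain_complex := CochainComplex {
  cochain_ob :> nat -> zmodType;
  cochain_d : forall n, {additive cochain_ob n -> cochain_ob n.+1};
  cochain_dd : forall n x, cochain_d n.+1 (cochain_d n x) = 0 }.

(* Cochain complexes vanish in negative degrees, so only the zero 0-cochain is
   a coboundary. *)
Definition coboundaries (X : cochain_complex) n : subgroup (X n) :=
  match n with
  | 0 => image (\0 : X 0 -> X 0)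
  | m.+1 => image (cochain_d X m)
  end.

Definition cohomology (X : cochain_complex) n : zmodType :=
  subquotient (kernel (cochain_d X n)) (coboundaries X n).

Record cochain_map (X Y : cochain_complex) := CochainMap {
  cochain_map_fun :> forall n, {additive X n -> Y n};
  cochain_map_d : forall n x,
    cochain_map_fun n.+1 (cochain_d X n x)
    = cochain_d Y n (cochain_map_fun n x) }.

Section CohomologyMap.
Variables (X Y : cochain_complex) (f : cochain_map X Y) (n : nat).

Lemma cochain_map_cocycles x :
  kernel (cochain_d X n) x -> kernel (cochain_d Y n) (f n x).
Proof. by move=> /= dx0; rewrite -cochain_map_d dx0 raddf0. Qed.

Lemma cochain_map_coboundaries x :
  coboundaries X n x -> coboundaries Y n (f n x).
Proof.
case: n x => [|m] x [y ->] /=; first by exists 0; rewrite /= raddf0.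
by exists (f m y); exact: cochain_map_d.
Qed.

Definition cohomology_map : {additive cohomology X n -> cohomology Y n} :=
  subquotient_map cochain_map_cocycles cochain_map_coboundaries.
End CohomologyMap.

Definition exact_at (A B C : zmodType) (f : A -> B) (g : B -> C) : Prop :=
  forall y, g y = 0 <-> exists x, f x = y.

Definition free_ab (T : Type) : zmodType := {freeg {classic T} / int}.

Definition gen (T : Type) (t : T) : free_ab T := << (t : {classic T}) >>.

Definition free_fun (T : Type) (M : zmodType) (f : T -> M) : free_ab T -> M :=
  @fglift int (zmodule M) {classic T} f.

Lemma free_fun_additive (T : Type) (M : zmodType) (f : T -> M) :
  zmod_morphism (free_fun f).
Proof. exact: (@lift_is_additive int {classic T} (zmodule M) f). Qed.

HB.instance Definition _ (T : Type) (M : zmodType) (f : T -> M) :=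
  GRing.isZmodMorphism.Build _ _ (free_fun f) (free_fun_additive f).

Definition free_lift (T : Type) (M : zmodType) (f : T -> M) :
  {additive free_ab T -> M} := free_fun f.

Lemma free_liftE (T : Type) (M : zmodType) (f : T -> M) t :
  free_lift f (gen t) = f t.
Proof.
rewrite /free_lift /= /free_fun /gen (@liftU int (zmodule M) {classic T}).
exact: (@scale1r int (zmodule M)).
Qed.

Lemma free_ext (T : Type) (M : zmodType) (f g : {additive free_ab T -> M}) :
  (forall t, f (gen t) = g (gen t)) -> forall x, f x = g x.
Proof.
move=> fg x; rewrite -[x]freeg_sumE !raddf_sum; apply: eq_bigr => t _.
have -> : << coeff t x *g t >> = gen t *~ coeff t x :> free_ab T.
  by rewrite /gen freegU_mulz intz.
by rewrite !raddfMz fg.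
Qed.

Definition free_map (T U : Type) (h : T -> U) :
  {additive free_ab T -> free_ab U} := free_lift (fun t => gen (h t)).

Lemma free_mapE (T U : Type) (h : T -> U) t : free_map h (gen t) = gen (h t).
Proof. exact: free_liftE. Qed.

Record category := Category {
  ob :> Type;
  hom : ob -> ob -> Type;
  idc : forall a, hom a a;
  comp : forall a b c, hom b c -> hom a b -> hom a c;
  comp1f : forall a b (f : hom a b), comp (idc b) f = f;
  compf1 : forall a b (f : hom a b), comp f (idc a) = f;
  compA : forall a b c d (h : hom c d) (g : hom b c) (f : hom a b),
    comp h (comp g f) = comp (comp h g) f }.

Notation "g \oc f" := (comp g f) (at level 50, left associativity).

Record functor (C D : category) := Functor {
  fob :> C -> D;
  fmap : forall a b, hom a b -> hom (fob a) (fob b);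
  fmap1 : forall a, fmap (idc a) = idc (fob a);
  fmapM : forall a b c (g : hom b c) (f : hom a b),
    fmap (g \oc f) = fmap g \oc fmap f }.

Lemma functor_ext (C D : category) (F G : functor C D) :
  (forall a, F a = G a) ->
  (forall a b (f : hom a b), JMeq (fmap F f) (fmap G f)) -> F = G.
Proof.
case: F => Fo Fm F1 FM; case: G => Go Gm G1 GM /= eo em.
have {}eo : Fo = Go by apply: funext.
case: Go / eo Gm G1 GM em => Gm G1 GM em.
have {}em : Fm = Gm.
  apply: functional_extensionality_dep => a.
  apply: functional_extensionality_dep => b.
  by apply: functional_extensionality_dep => f; exact/JMeq_eq.
case: Gm / em G1 GM => G1 GM.
by congr Functor; exact: Prop_irrelevance.
Qed.

Definition fid (C : category) : functor C C :=
  @Functor C C (fun a => a) (fun a b f => f)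
    (fun a => erefl) (fun a b c g f => erefl).

Section FunctorComposition.
Variables (C D E : category) (G : functor D E) (F : functor C D).

Lemma fcomp1 a : fmap G (fmap F (idc a)) = idc (G (F a)).
Proof. by rewrite !fmap1. Qed.

Lemma fcompM a b c (g : hom b c) (f : hom a b) :
  fmap G (fmap F (g \oc f)) = fmap G (fmap F g) \oc fmap G (fmap F f).
Proof. by rewrite !fmapM. Qed.

Definition fcomp : functor C E :=
  @Functor C E (fun a => G (F a)) (fun a b f => fmap G (fmap F f))
    fcomp1 fcompM.
End FunctorComposition.

Lemma fcompA (A B C D : category) (H : functor C D) (G : functor B C)
    (F : functor A B) :
  fcomp H (fcomp G F) = fcomp (fcomp H G) F.
Proof. exact: functor_ext. Qed.

Definition opcat (C : category) : category :=
  @Category C (fun a b => @hom C b a) (@idc C)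
    (fun a b c (g : @hom C c b) (f : @hom C b a) => f \oc g)
    (fun a b f => compf1 f) (fun a b f => comp1f f)
    (fun a b c d h g f => esym (compA f g h)).

Definition fop (C D : category) (F : functor C D) :
    functor (opcat C) (opcat D) :=
  @Functor (opcat C) (opcat D) F (fun a b f => fmap F f) (fmap1 F)
    (fun a b c g f => fmapM F f g).

Definition is_pushout (C0 C1 C2 C : category)
    (F1 : functor C0 C1) (F2 : functor C0 C2)
    (I1 : functor C1 C) (I2 : functor C2 C) : Prop :=
  fcomp I1 F1 = fcomp I2 F2 /\
  forall (E : category) (G1 : functor C1 E) (G2 : functor C2 E),
    fcomp G1 F1 = fcomp G2 F2 ->
    exists! G : functor C E, fcomp G I1 = G1 /\ fcomp G I2 = G2.

Section Under.
Variables (C D : category) (F : functor D C) (c : C).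

Definition under_ob := {d : D & hom c (F d)}.

Definition under_hom (x y : under_ob) :=
  {g : hom (projT1 x) (projT1 y) | fmap F g \oc projT2 x = projT2 y}.

Lemma under_hom_ext (x y : under_ob) (g g' : under_hom x y) :
  sval g = sval g' -> g = g'.
Proof. exact: eq_sig_hprop. Qed.

Lemma under_id_subproof (x : under_ob) :
  fmap F (idc (projT1 x)) \oc projT2 x = projT2 x.
Proof. by rewrite fmap1 comp1f. Qed.

Definition under_id (x : under_ob) : under_hom x x :=
  exist _ (idc (projT1 x)) (under_id_subproof x).

Lemma under_comp_subproof (x y z : under_ob) (g : under_hom y z)
    (f : under_hom x y) :
  fmap F (sval g \oc sval f) \oc projT2 x = projT2 z.
Proof. by rewrite fmapM -compA (svalP f) (svalP g). Qed.

Definition under_comp (x y z : under_ob) (g : under_hom y z)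
    (f : under_hom x y) : under_hom x z :=
  exist _ (sval g \oc sval f) (under_comp_subproof g f).

Lemma under_comp1f (x y : under_ob) (f : under_hom x y) :
  under_comp (under_id y) f = f.
Proof. by apply: under_hom_ext; exact: comp1f. Qed.

Lemma under_compf1 (x y : under_ob) (f : under_hom x y) :
  under_comp f (under_id x) = f.
Proof. by apply: under_hom_ext; exact: compf1. Qed.

Lemma under_compA (x y z t : under_ob) (h : under_hom z t)
    (g : under_hom y z) (f : under_hom x y) :
  under_comp h (under_comp g f) = under_comp (under_comp h g) f.
Proof. by apply: under_hom_ext; exact: compA. Qed.

Definition under : category :=
  Category under_comp1f under_compf1 under_compA.
End Under.

Lemma under_hom_JMeq (C D : category) (F : functor D C) (c : C) (d d' : D)
    (f1 f2 : hom c (F d)) (f1' f2' : hom c (F d'))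
    (h1 : under_hom (existT _ d f1) (existT _ d' f1'))
    (h2 : under_hom (existT _ d f2) (existT _ d' f2')) :
  f1 = f2 -> f1' = f2' -> sval h1 = sval h2 -> JMeq h1 h2.
Proof.
move=> e e'; case: f2 / e h2 => h2; case: f2' / e' h2 => h2 e.
by rewrite (under_hom_ext e).
Qed.

(* A morphism f : c0 -> c1 induces c1/F -> c0/F, (d, h) |-> (d, h f). *)
Section UnderPrecomposition.
Variables (C D : category) (F : functor D C) (c0 c1 : C) (f : hom c0 c1).

Definition under_pre_ob (x : under F c1) : under F c0 :=
  existT _ (projT1 x) (projT2 x \oc f).

Lemma under_pre_subproof (x y : under F c1) (g : hom x y) :
  fmap F (sval g) \oc (projT2 x \oc f) = projT2 y \oc f.
Proof. by rewrite compA (svalP g). Qed.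

Definition under_pre_hom (x y : under F c1) (g : hom x y) :
    hom (under_pre_ob x) (under_pre_ob y) :=
  exist _ (sval g) (under_pre_subproof g).

Lemma under_pre1 x : under_pre_hom (idc x) = idc (under_pre_ob x).
Proof. exact: under_hom_ext. Qed.

Lemma under_preM (x y z : under F c1) (g : hom y z) (h : hom x y) :
  under_pre_hom (g \oc h) = under_pre_hom g \oc under_pre_hom h.
Proof. exact: under_hom_ext. Qed.

Definition under_pre : functor (under F c1) (under F c0) :=
  Functor under_pre1 under_preM.
End UnderPrecomposition.

Lemma under_pre_id (C D : category) (F : functor D C) (c : C) :
  under_pre F (idc c) = fid (under F c).
Proof.
apply: functor_ext => [[d h]|[d h] [d' h'] g] /=.
  by rewrite /under_pre_ob /= compf1.
by apply: under_hom_JMeq => //; exact: compf1.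
Qed.

Lemma under_pre_comp (C D : category) (F : functor D C) (a b c : C)
    (g : hom b c) (f : hom a b) :
  under_pre F (g \oc f) = fcomp (under_pre F f) (under_pre F g).
Proof.
apply: functor_ext => [[d h]|[d h] [d' h'] k] /=.
  by rewrite /under_pre_ob /= compA.
by apply: under_hom_JMeq => //; exact: compA.
Qed.

(* F : D -> C induces d/D -> Fd/C, (d', h) |-> (Fd', Fh). *)
Section UnderImage.
Variables (C D : category) (F : functor D C) (d : D).

Definition under_image_ob (x : under (fid D) d) : under (fid C) (F d) :=
  existT (fun c => hom (F d) c) (F (projT1 x)) (fmap F (projT2 x)).

Lemma under_image_subproof (x y : under (fid D) d) (g : hom x y) :
  fmap F (sval g) \oc fmap F (projT2 x) = fmap F (projT2 y).
Proof. by rewrite -fmapM (svalP g). Qed.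

Definition under_image_hom (x y : under (fid D) d) (g : hom x y) :
    hom (under_image_ob x) (under_image_ob y) :=
  exist _ (fmap F (sval g)) (under_image_subproof g).

Lemma under_image1 x : under_image_hom (idc x) = idc (under_image_ob x).
Proof. by apply: under_hom_ext; exact: fmap1. Qed.

Lemma under_imageM (x y z : under (fid D) d) (g : hom y z) (h : hom x y) :
  under_image_hom (g \oc h) = under_image_hom g \oc under_image_hom h.
Proof. by apply: under_hom_ext; exact: fmapM. Qed.

Definition under_image : functor (under (fid D) d) (under (fid C) (F d)) :=
  Functor under_image1 under_imageM.
End UnderImage.

Lemma under_image_pre (C D : category) (F : functor D C) (a b : D)
    (f : hom a b) :
  fcomp (under_image F a) (under_pre (fid D) f) =
  fcomp (under_pre (fid C) (fmap F f)) (under_image F b).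
Proof.
apply: functor_ext => [[d h]|[d h] [d' h'] k] /=.
  by rewrite /under_pre_ob /under_image_ob /= fmapM.
by apply: under_hom_JMeq => //=; exact: fmapM.
Qed.

Record monotone (m n : nat) := Monotone {
  mfun :> 'I_m.+1 -> 'I_n.+1;
  mfun_homo : {homo mfun : i j / (i <= j)%N} }.

Lemma monotone_ext m n (a b : monotone m n) : a =1 b -> a = b.
Proof.
case: a b => [a ha] [b hb] /= ab.
have {}ab : a = b by exact: funext.
by case: b / ab hb => hb; congr Monotone; exact: Prop_irrelevance.
Qed.

Definition mono_id n : monotone n n := @Monotone n n id (fun i j ij => ij).

Definition mono_comp l m n (a : monotone m n) (b : monotone l m) :
    monotone l n :=
  @Monotone l n (fun i => a (b i))
    (fun i j ij => mfun_homo a (mfun_homo b ij)).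

Lemma coface_homo n (i : 'I_n.+2) : {homo fintype.lift i : j k / (j <= k)%N}.
Proof. by move=> j k jk; rewrite /= leq_bump2. Qed.

Definition coface n (i : 'I_n.+2) : monotone n n.+1 :=
  @Monotone n n.+1 (fintype.lift i) (coface_homo i).

Record sset := Sset {
  simplex :> nat -> Type;
  sact : forall m n, monotone m n -> simplex n -> simplex m;
  sact1 : forall n x, sact (mono_id n) x = x;
  sactM : forall l m n (a : monotone m n) (b : monotone l m) x,
    sact (mono_comp a b) x = sact b (sact a x) }.

Record smap (K L : sset) := Smap {
  sfun :> forall n, K n -> L n;
  sfun_act : forall m n (a : monotone m n) x,
    sfun (sact a x) = sact a (sfun x) }.

Definition smap_comp (K L X : sset) (g : smap L X) (f : smap K L) : smap K X :=
  @Smap K X (fun n x => g n (f n x))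
    (fun m n a x =>
       etrans (congr1 (@sfun _ _ g m) (sfun_act f a x)) (sfun_act g a (f n x))).

Definition sdiscrete (T : Type) : sset :=
  @Sset (fun=> T) (fun m n a x => x) (fun n x => erefl)
    (fun l m n a b x => erefl).

Definition simplex_std (n : nat) : sset.
refine (@Sset (fun m => monotone m n) (fun l m b a => mono_comp a b) _ _).
- by move=> m a; exact: monotone_ext.
- by move=> j l m a b x; exact: monotone_ext.
Defined.

Definition sprod (K L : sset) : sset.
refine (@Sset (fun n => K n * L n)%type
  (fun m n a x => (sact a x.1, sact a x.2)) _ _).
- by move=> n [x y]; rewrite !sact1.
- by move=> l m n a b [x y]; rewrite !sactM.
Defined.

(* A simplex a : [m] -> [n] lies in the k-th horn iff it lies in some face
   opposite to a vertex i != k. *)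
Definition in_horn n (k : 'I_n.+1) m (a : monotone m n) : Prop :=
  exists2 i, i != k & forall j, a j != i.

Definition horn (n : nat) (k : 'I_n.+1) : sset.
refine (@Sset (fun m => {a : monotone m n | in_horn k a})
  (fun l m b a => exist _ (mono_comp (sval a) b)
     (let: ex_intro2 i ik ai := svalP a in
      ex_intro2 _ _ i ik (fun j => ai (b j)))) _ _).
- by move=> m [a ha]; apply: eq_sig_hprop => //=; exact: monotone_ext.
- by move=> j l m a b [x hx]; apply: eq_sig_hprop => //=; exact: monotone_ext.
Defined.

Definition kan (X : sset) : Prop :=
  forall n (k : 'I_n.+1), (0 < n)%N -> forall u : smap (horn k) X,
  exists v : smap (simplex_std n) X,
    forall m (a : horn k m), v m (sval a) = u m a.

Lemma mono_const_homo m n (i : 'I_n.+1) :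
  {homo (fun _ : 'I_m.+1 => i) : j k / (j <= k)%N}.
Proof. by []. Qed.

Definition vertex n (i : 'I_n.+1) m : simplex_std n m :=
  Monotone (@mono_const_homo m n i).

Definition elementary_homotopy (K X : sset) (u v : smap K X) : Prop :=
  exists H : smap (sprod K (simplex_std 1)) X, forall n (x : K n),
    H n (x, vertex ord0 n) = u n x /\ H n (x, vertex ord_max n) = v n x.

(* u and v lie in the same component of the simplicial mapping space. *)
Definition homotopic (K X : sset) : smap K X -> smap K X -> Prop :=
  clos_refl_sym_trans (smap K X) (@elementary_homotopy K X).

(* f induces bijections [L, X] -> [K, X] for all Kan complexes X. *)
Definition weak_equivalence (K L : sset) (f : smap K L) : Prop :=
  forall X, kan X ->
    (forall u : smap K X, exists v : smap L X, homotopic (smap_comp v f) u) /\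
    (forall v w : smap L X,
      homotopic (smap_comp v f) (smap_comp w f) -> homotopic v w).

Definition weakly_equivalent : sset -> sset -> Prop :=
  clos_refl_sym_trans sset
    (fun K L => exists f : smap K L, weak_equivalence f).

Definition ordcat (n : nat) : category :=
  @Category 'I_n.+1 (fun i j => (i <= j)%N) (fun i => leqnn i)
    (fun i j k jk ij => leq_trans ij jk)
    (fun i j f => bool_irrelevance _ _) (fun i j f => bool_irrelevance _ _)
    (fun i j k l h g f => bool_irrelevance _ _).

Definition ordfunctor m n (a : monotone m n) :
    functor (ordcat m) (ordcat n) :=
  @Functor (ordcat m) (ordcat n) a (fun i j ij => mfun_homo a ij)
    (fun i => bool_irrelevance _ _)
    (fun i j k g f => bool_irrelevance _ _).

Definition nerve (C : category) : sset.
refine (@Sset (fun n => functor (ordcat n) C)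
  (fun m n a s => fcomp s (ordfunctor a)) _ _).
- by move=> n s; exact: functor_ext.
- by move=> l m n a b s; exact: functor_ext.
Defined.

Definition nerve_map (C D : category) (F : functor C D) :
    smap (nerve C) (nerve D) :=
  @Smap (nerve C) (nerve D) (fun n s => fcomp F s)
    (fun m n a s => fcompA F s (ordfunctor a)).

Definition homotopically_discrete (C : category) : Prop :=
  exists T : Type, weakly_equivalent (nerve C) (sdiscrete T).

Definition local_covering (C D : category) (F : functor D C) : Prop :=
  forall c : C, homotopically_discrete (under F c).

Definition face (K : sset) n (i : 'I_n.+2) (x : K n.+1) : K n :=
  sact (coface i) x.

Definition simplicial_d (K : sset) n : {additive free_ab (K n.+1) -> free_ab (K n)} :=
  free_lift (fun x => \sum_(i < n.+2) gen (face i x) *~ (-1) ^+ i).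

Lemma face_face (K : sset) n (i : 'I_n.+3) (j : 'I_n.+2)
    (i' : 'I_n.+3) (j' : 'I_n.+2) (x : K n.+2) :
  i' = bump i j :> nat -> j' = unbump j i :> nat ->
  face j (face i x) = face j' (face i' x).
Proof.
move=> ei ej; rewrite /face -!sactM; congr sact; apply: monotone_ext => k.
by apply: val_inj; rewrite /= bumpC ei ej.
Qed.

Lemma simplicial_dd (K : sset) n (x : free_ab (K n.+2)) :
  simplicial_d K n (simplicial_d K n.+1 x) = 0.
Proof.
suff H : forall t, (simplicial_d K n \o simplicial_d K n.+1) (gen t) =
    (\0 : free_ab (K n.+2) -> free_ab (K n)) (gen t) by exact: (free_ext H).
move=> t; rewrite /= free_liftE raddf_sum /=.
pose T (p : 'I_n.+3 * 'I_n.+2) : free_ab (K n) :=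
  gen (face p.2 (face p.1 t)) *~ ((-1) ^+ p.2 * (-1) ^+ p.1).
have -> : \sum_(i < n.+3)
    simplicial_d K n (gen (face i t) *~ (-1) ^+ i) = \sum_p T p.
  rewrite -(pair_bigA _ (fun i j => T (i, j))) /=; apply: eq_bigr => i _.
  rewrite raddfMz free_liftE mulrz_suml; apply: eq_bigr => j _.
  by rewrite /T mulrzA.
pose s (p : 'I_n.+3 * 'I_n.+2) : 'I_n.+3 * 'I_n.+2 :=
  (fintype.lift p.1 p.2, inord (unbump p.2 p.1)).
have ub (p : 'I_n.+3 * 'I_n.+2) : (unbump p.2 p.1 < n.+2)%N.
  case: p => i j /=; rewrite /unbump; have := ltn_ord i; have := ltn_ord j.
  by case: (ltnP j i) => /=; lia.
have s1 p : (s p).1 = bump p.1 p.2 :> nat by [].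
have s2 p : (s p).2 = unbump p.2 p.1 :> nat by rewrite /= inordK.
have sK : involutive s.
  case=> i j; have := s1 (i, j); have := s2 (i, j).
  case: (s (i, j)) => i' j' /= e2 e1; rewrite /s /=.
  have {}e1 : i' = ((i <= j)%N + j)%N :> nat by rewrite e1.
  have {}e2 : j' = (i - (j < i)%N)%N :> nat by rewrite e2.
  congr pair; apply: val_inj.
    rewrite /= /bump e1 e2; case: (leqP i j) => ij; last by case: leqP; lia.
    by case: leqP; lia.
  rewrite /= inordK /unbump e1 e2.
    by case: (leqP i j) => ij; case: ltnP; lia.
  by have := ltn_ord j; case: (leqP i j) => ij; case: ltnP; lia.
rewrite (bigID (fun p : 'I_n.+3 * 'I_n.+2 => (p.1 <= p.2)%N)) /=.
rewrite [X in _ + X](reindex_inj (inv_inj sK)); apply/eqP.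
rewrite addr_eq0 -sumrN; apply/eqP/eq_big => [p|p ij].
  rewrite s1 s2 /bump /unbump; case: (leqP p.1 p.2) => ij; case: leqP; lia.
rewrite /T (@face_face K n p.1 p.2 (s p).1 (s p).2) // -mulrNz.
congr (_ *~ _); rewrite -!exprD s1 s2 /bump /unbump ij ltnNge ij /= subn0.
by rewrite addnA addn1 exprS mulN1r opprK addnC.
Qed.

Record cmodule (C : category) := Cmodule {
  mob :> C -> zmodType;
  mact : forall a b, hom a b -> {additive mob a -> mob b};
  mact1 : forall a x, mact (idc a) x = x;
  mactM : forall a b c (g : hom b c) (f : hom a b) x,
    mact (g \oc f) x = mact g (mact f x) }.

Definition left_module (C : category) := cmodule C.
Definition right_module (C : category) := cmodule (opcat C).

Definition ract (C : category) (L : right_module C) (a b : C) (f : hom a b) :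
  {additive L b -> L a} := mact L (f : @hom (opcat C) b a).

Lemma res_act1 (C D : category) (F : functor D C) (M : cmodule C) a x :
  mact M (fmap F (idc a)) x = x.
Proof. by rewrite fmap1 mact1. Qed.

Lemma res_actM (C D : category) (F : functor D C) (M : cmodule C)
    a b c (g : hom b c) (f : hom a b) x :
  mact M (fmap F (g \oc f)) x = mact M (fmap F g) (mact M (fmap F f) x).
Proof. by rewrite fmapM mactM. Qed.

Definition res (C D : category) (F : functor D C) (M : cmodule C) : cmodule D :=
  @Cmodule D (fun d => M (F d)) (fun a b f => mact M (fmap F f))
    (@res_act1 C D F M) (@res_actM C D F M).

Definition lres (C D : category) (F : functor D C) (M : left_module C) :
  left_module D := res F M.

Definition rres (C D : category) (F : functor D C) (L : right_module C) :
  right_module D := res (fop F) L.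

Lemma lres_fcomp (C0 C1 C : category) (I0 : functor C0 C) (I : functor C1 C)
    (F : functor C0 C1) (M : left_module C) :
  I0 = fcomp I F -> lres I0 M = lres F (lres I M).
Proof. by move=> ->; congr Cmodule; exact: Prop_irrelevance. Qed.

Lemma rres_fcomp (C0 C1 C : category) (I0 : functor C0 C) (I : functor C1 C)
    (F : functor C0 C1) (L : right_module C) :
  I0 = fcomp I F -> rres I0 L = rres F (rres I L).
Proof. by move=> ->; congr Cmodule; exact: Prop_irrelevance. Qed.

Record nattrans (C : category) (L M : cmodule C) := Nattrans {
  nt :> forall c, {additive L c -> M c};
  nt_nat : forall a b (f : hom a b) x, nt b (mact L f x) = mact M f (nt a x) }.

Lemma additive_ext (V W : zmodType) (f g : {additive V -> W}) :
  f =1 g -> f = g.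
Proof.
case: f g => [f [[hf]]] [g [[hg]]] /= fg.
have {}fg : f = g by apply: funext => x; exact: fg.
by case: g / fg hg => hg; rewrite (Prop_irrelevance hf hg).
Qed.

Lemma nattrans_ext (C : category) (L M : cmodule C) (s t : nattrans L M) :
  (forall c x, s c x = t c x) -> s = t.
Proof.
case: s t => [s hs] [t ht] /= st.
have {}st : s = t.
  by apply: functional_extensionality_dep => c; apply: additive_ext => x; exact: st.
by case: t / st ht => ht; rewrite (Prop_irrelevance hs ht).
Qed.

Definition ntid (C : category) (L : cmodule C) : nattrans L L :=
  @Nattrans C L L (fun c => idfun) (fun a b f x => erefl).

Definition ntcomp (C : category) (L M N : cmodule C)
    (t : nattrans M N) (s : nattrans L M) : nattrans L N :=
  @Nattrans C L N (fun c => t c \o s c)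
    (fun a b f x => etrans (congr1 (t b) (nt_nat s f x)) (nt_nat t f (s a x))).

Definition ntres (C D : category) (F : functor D C) (L M : cmodule C)
    (s : nattrans L M) : nattrans (res F L) (res F M) :=
  @Nattrans D (res F L) (res F M) (fun d => s (F d))
    (fun a b f x => nt_nat s (fmap F f) x).

Section NattransZmodule.
Variables (C : category) (L M : cmodule C).
Implicit Types s t : nattrans L M.

HB.instance Definition _ := gen_eqMixin (nattrans L M).
HB.instance Definition _ := gen_choiceMixin (nattrans L M).

Lemma nt0_nat a b (f : hom a b) (x : L a) :
  (\0 : L b -> M b) (mact L f x) = mact M f ((\0 : L a -> M a) x).
Proof. by rewrite /= raddf0. Qed.

Definition nt0 : nattrans L M := @Nattrans C L M (fun c => \0) nt0_nat.

Lemma ntN_nat s a b (f : hom a b) (x : L a) :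
  (\- s b) (mact L f x) = mact M f ((\- s a) x).
Proof. by rewrite /= raddfN nt_nat. Qed.

Definition ntN s : nattrans L M :=
  @Nattrans C L M (fun c => \- s c) (ntN_nat s).

Lemma ntD_nat s t a b (f : hom a b) (x : L a) :
  (s b \+ t b) (mact L f x) = mact M f ((s a \+ t a) x).
Proof. by rewrite /= raddfD !nt_nat. Qed.

Definition ntD s t : nattrans L M :=
  @Nattrans C L M (fun c => s c \+ t c) (ntD_nat s t).

Lemma ntDA : associative ntD.
Proof. by move=> r s t; apply: nattrans_ext => c x; exact: addrA. Qed.

Lemma ntDC : commutative ntD.
Proof. by move=> s t; apply: nattrans_ext => c x; exact: addrC. Qed.

Lemma nt0D : left_id nt0 ntD.
Proof. by move=> s; apply: nattrans_ext => c x; exact: add0r. Qed.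

Lemma ntND : left_inverse nt0 ntN ntD.
Proof. by move=> s; apply: nattrans_ext => c x; exact: addNr. Qed.

HB.instance Definition _ :=
  GRing.isZmodule.Build (nattrans L M) ntDA ntDC nt0D ntND.
End NattransZmodule.

Lemma ntcomp_prel (C : category) (L L' M : cmodule C) (a : nattrans L' L) :
  zmod_morphism (fun s : nattrans L M => ntcomp s a).
Proof. by move=> s t; apply: nattrans_ext. Qed.

Definition nt_pre (C : category) (L L' M : cmodule C) (a : nattrans L' L) :
    {additive nattrans L M -> nattrans L' M} :=
  HB.pack (fun s : nattrans L M => ntcomp s a)
    (GRing.isZmodMorphism.Build _ _ _ (@ntcomp_prel C L L' M a)).

Lemma ntres_additive (C D : category) (F : functor D C) (L M : cmodule C) :
  zmod_morphism (@ntres C D F L M).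
Proof. by move=> s t; apply: nattrans_ext. Qed.

Definition nt_res (C D : category) (F : functor D C) (L M : cmodule C) :
    {additive nattrans L M -> nattrans (res F L) (res F M)} :=
  HB.pack (@ntres C D F L M)
    (GRing.isZmodMorphism.Build _ _ _ (@ntres_additive C D F L M)).

Section Tensor.
Variables (C : category) (L : right_module C) (M : left_module C).

Definition tensor_gen := {c : C & (L c * M c)%type}.

Definition pure (c : C) (x : L c) (y : M c) : free_ab tensor_gen :=
  gen (existT (fun c => (L c * M c)%type) c (x, y)).

Inductive tensor_rel : free_ab tensor_gen -> Prop :=
  | tensor_relDl c (x x' : L c) (y : M c) :
      tensor_rel (pure (x + x') y - (pure x y + pure x' y))
  | tensor_relDr c (x : L c) (y y' : M c) :
      tensor_rel (pure x (y + y') - (pure x y + pure x y'))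
  | tensor_rel_act (c0 c1 : C) (f : hom c0 c1) (x : L c1) (y : M c0) :
      tensor_rel (pure (ract L f x) y - pure x (mact M f y)).

(* The sum over c of the groups L c (x) M c, modulo x f (x) y = x (x) f y, by
   generators and relations; the first two relations are bilinearity. *)
Definition tensor : zmodType := quotient (span_subgroup tensor_rel).

Definition tens (c : C) (x : L c) (y : M c) : tensor :=
  quotient_pi (span_subgroup tensor_rel) (pure x y).

Lemma tensDl c (x x' : L c) (y : M c) : tens (x + x') y = tens x y + tens x' y.
Proof.
by rewrite -raddfD; apply/quotient_eq; apply: span_gen; exact: tensor_relDl.
Qed.

Lemma tensDr c (x : L c) (y y' : M c) : tens x (y + y') = tens x y + tens x y'.
Proof.
by rewrite -raddfD; apply/quotient_eq; apply: span_gen; exact: tensor_relDr.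
Qed.

Lemma tens_act (c0 c1 : C) (f : hom c0 c1) (x : L c1) (y : M c0) :
  tens (ract L f x) y = tens x (mact M f y).
Proof. by apply/quotient_eq; apply: span_gen; exact: tensor_rel_act. Qed.

Lemma tensl_additive c (y : M c) : nmod_morphism (fun x : L c => tens x y).
Proof.
split=> [|x x']; last exact: tensDl.
by apply: (addrI (tens 0 y)); rewrite -tensDl !addr0.
Qed.

Lemma tensr_additive c (x : L c) : nmod_morphism (tens x).
Proof.
split=> [|y y']; last exact: tensDr.
by apply: (addrI (tens x 0)); rewrite -tensDr !addr0.
Qed.

HB.instance Definition _ c (x : L c) :=
  GRing.isNmodMorphism.Build _ _ (tens x) (tensr_additive x).

Lemma tensor_ext (A : zmodType) (f g : {additive tensor -> A}) :
  (forall c (x : L c) (y : M c), f (tens x y) = g (tens x y)) ->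
  forall t, f t = g t.
Proof.
move=> fg t; have [w <-] := quotient_piP t.
have H := @free_ext _ _ (f \o quotient_pi (span_subgroup tensor_rel))
  (g \o quotient_pi (span_subgroup tensor_rel)).
by apply: H => -[c [x y]]; exact: fg.
Qed.

Record balanced (A : zmodType) (phi : forall c, L c -> M c -> A) : Prop :=
  Balanced {
    balDl : forall c (x x' : L c) (y : M c),
      phi c (x + x') y = phi c x y + phi c x' y;
    balDr : forall c (x : L c) (y y' : M c),
      phi c x (y + y') = phi c x y + phi c x y';
    bal_act : forall (c0 c1 : C) (f : hom c0 c1) (x : L c1) (y : M c0),
      phi c0 (ract L f x) y = phi c1 x (mact M f y) }.

Section TensorLift.
Variables (A : zmodType) (phi : forall c, L c -> M c -> A).
Hypothesis bal : balanced phi.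

Definition tensor_free_lift : {additive free_ab tensor_gen -> A} :=
  free_lift (fun t : tensor_gen => phi (projT2 t).1 (projT2 t).2).

Lemma tensor_free_liftE c (x : L c) (y : M c) :
  tensor_free_lift (pure x y) = phi x y.
Proof. exact: free_liftE. Qed.

Lemma tensor_free_lift0 w : span_subgroup tensor_rel w -> tensor_free_lift w = 0.
Proof.
elim=> [|{}w []|u v _ hu _ hv]; first exact: raddf0.
- by move=> c x x' y; rewrite raddfB raddfD !tensor_free_liftE (balDl bal) subrr.
- by move=> c x y y'; rewrite raddfB raddfD !tensor_free_liftE (balDr bal) subrr.
- by move=> c0 c1 f x y; rewrite raddfB !tensor_free_liftE (bal_act bal) subrr.
by rewrite raddfB hu hv subrr.
Qed.

Definition tensor_lift : {additive tensor -> A} :=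
  quotient_lift tensor_free_lift0.

Lemma tensor_liftE c (x : L c) (y : M c) : tensor_lift (tens x y) = phi x y.
Proof. by rewrite quotient_liftE tensor_free_liftE. Qed.
End TensorLift.
End Tensor.

Section TensorMap.
Variables (C : category) (L L' : right_module C) (M M' : left_module C).
Variables (a : nattrans L L') (b : nattrans M M').

Lemma tensor_map_balanced :
  balanced (fun c (x : L c) (y : M c) => tens (L := L') (M := M') (a c x) (b c y)).
Proof.
split=> [c x x' y|c x y y'|c0 c1 f x y].
- by rewrite raddfD tensDl.
- by rewrite raddfD tensDr.
- by rewrite nt_nat -tens_act /ract nt_nat.
Qed.

Definition tensor_map : {additive tensor L M -> tensor L' M'} :=
  tensor_lift tensor_map_balanced.

Lemma tensor_mapE c (x : L c) (y : M c) :
  tensor_map (tens x y) = tens (a c x) (b c y).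
Proof. exact: tensor_liftE. Qed.
End TensorMap.

Lemma free_map_id (T : Type) (h : T -> T) : h =1 id ->
  forall x, free_map h x = x.
Proof.
move=> hid; apply: (@free_ext _ _ (free_map h) idfun) => t.
by rewrite free_mapE hid.
Qed.

Lemma free_map_comp (T U W : Type) (g : U -> W) (f : T -> U) (h : T -> W) :
  h =1 g \o f -> forall x, free_map h x = free_map g (free_map f x).
Proof.
move=> hE; apply: (@free_ext _ _ (free_map h) (free_map g \o free_map f)) => t.
by rewrite /= !free_mapE hE.
Qed.

Lemma simplicial_d_map (K L : sset) (f : smap K L) n (x : free_ab (K n.+1)) :
  free_map (f n) (simplicial_d K n x) = simplicial_d L n (free_map (f n.+1) x).
Proof.
move: x; apply: (@free_ext _ _ (free_map (f n) \o simplicial_d K n)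
  (simplicial_d L n \o free_map (f n.+1))) => t /=.
rewrite free_mapE !free_liftE raddf_sum; apply: eq_bigr => i _.
by rewrite raddfMz free_mapE sfun_act.
Qed.

Section ZNerve.
Variable C : category.

Let NC (c : C) : sset := nerve (under (fid C) c).

Lemma ZN_act1 n c (x : free_ab (NC c n)) :
  free_map (nerve_map (under_pre (fid C) (idc c)) n) x = x.
Proof. by apply: free_map_id => s /=; rewrite under_pre_id; exact: functor_ext. Qed.

Lemma ZN_actM n c0 c1 c2 (f : hom c0 c1) (g : hom c1 c2) (x : free_ab (NC c2 n)) :
  free_map (nerve_map (under_pre (fid C) (g \oc f)) n) x =
  free_map (nerve_map (under_pre (fid C) f) n)
    (free_map (nerve_map (under_pre (fid C) g) n) x).
Proof. by apply: free_map_comp => s /=; rewrite under_pre_comp fcompA. Qed.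

(* c |-> Z N(c/C) in simplicial degree n. *)
Definition ZN (n : nat) : right_module C :=
  @Cmodule (opcat C) (fun c => free_ab (NC c n))
    (fun a b (f : @hom C b a) => free_map (nerve_map (under_pre (fid C) f) n))
    (fun c => @ZN_act1 n c)
    (fun a b c (g : @hom C c b) (f : @hom C b a) => @ZN_actM n c b a g f).

Definition ZN_d (n : nat) : nattrans (ZN n.+1) (ZN n) :=
  @Nattrans (opcat C) (ZN n.+1) (ZN n) (fun c => simplicial_d (NC c) n)
    (fun a b (f : @hom C b a) x =>
       esym (simplicial_d_map (nerve_map (under_pre (fid C) f)) x)).

Lemma ZN_dd n c (x : ZN n.+2 c) : ZN_d n c (ZN_d n.+1 c x) = 0.
Proof. exact: simplicial_dd. Qed.
End ZNerve.

Section ZNerveMap.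
Variables (C D : category) (F : functor D C) (n : nat).

Lemma ZN_map_nat (a b : D) (f : hom a b) (x : ZN D n b) :
  free_map (nerve_map (under_image F a) n) (ract (ZN D n) f x) =
  ract (rres F (ZN C n)) f (free_map (nerve_map (under_image F b) n) x).
Proof.
rewrite /ract /= -!(@free_map_comp _ _ _ _ _ _ (frefl _)).
congr (free_map _ x); apply: funext => s /=.
by rewrite !fcompA under_image_pre.
Qed.

Definition ZN_map : nattrans (ZN D n) (rres F (ZN C n)) :=
  @Nattrans (opcat D) (ZN D n) (rres F (ZN C n))
    (fun d => free_map (nerve_map (under_image F d) n))
    (fun a b (f : @hom D b a) x => ZN_map_nat f x).
End ZNerveMap.

Lemma ZN_map_d (C D : category) (F : functor D C) n (d : D) (x : ZN D n.+1 d) :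
  ZN_map F n d (ZN_d D n d x) = ZN_d C n (F d) (ZN_map F n.+1 d x).
Proof. exact: simplicial_d_map. Qed.

Section HomModule.
Variables (C D : category) (F : functor D C).

Lemma hom_module_act1 c d (x : free_ab (hom c (F d))) :
  free_map (fun h : hom c (F d) => fmap F (idc d) \oc h) x = x.
Proof. by apply: free_map_id => h; rewrite fmap1 comp1f. Qed.

Lemma hom_module_actM c d0 d1 d2 (g : hom d1 d2) (f : hom d0 d1)
    (x : free_ab (hom c (F d0))) :
  free_map (fun h => fmap F (g \oc f) \oc h) x =
  free_map (fun h => fmap F g \oc h) (free_map (fun h => fmap F f \oc h) x).
Proof. by apply: free_map_comp => h /=; rewrite fmapM compA. Qed.

Definition hom_module (c : C) : left_module D :=
  @Cmodule D (fun d => free_ab (hom c (F d)))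
    (fun a b g => free_map (fun h => fmap F g \oc h))
    (@hom_module_act1 c) (@hom_module_actM c).

Lemma hom_module_pre_nat c0 c1 (f : hom c0 c1) a b (g : hom a b)
    (x : hom_module c1 a) :
  free_map (fun h => h \oc f) (mact (hom_module c1) g x) =
  mact (hom_module c0) g (free_map (fun h => h \oc f) x).
Proof.
rewrite /= -!(@free_map_comp _ _ _ _ _ _ (frefl _)).
by congr (free_map _ x); apply: funext => h /=; rewrite compA.
Qed.

Definition hom_module_pre c0 c1 (f : hom c0 c1) :
    nattrans (hom_module c1) (hom_module c0) :=
  @Nattrans D (hom_module c1) (hom_module c0)
    (fun d => free_map (fun h => h \oc f)) (hom_module_pre_nat f).

Variable L : right_module D.

Lemma lan_act1 c (x : tensor L (hom_module c)) :
  tensor_map (ntid L) (hom_module_pre (idc c)) x = x.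
Proof.
move: x; apply: (@tensor_ext _ _ _ _ (tensor_map _ _) idfun) => d x y.
rewrite tensor_mapE /=; congr tens.
by apply: free_map_id => h; rewrite compf1.
Qed.

Lemma lan_actM c0 c1 c2 (f : hom c0 c1) (g : hom c1 c2)
    (x : tensor L (hom_module c2)) :
  tensor_map (ntid L) (hom_module_pre (g \oc f)) x =
  tensor_map (ntid L) (hom_module_pre f)
    (tensor_map (ntid L) (hom_module_pre g) x).
Proof.
move: x; apply: (@tensor_ext _ _ _ _ (tensor_map _ _)
  (tensor_map _ _ \o tensor_map _ _)) => d x y.
rewrite -[RHS]/(tensor_map (ntid L) (hom_module_pre f)
  (tensor_map (ntid L) (hom_module_pre g) (tens x y))) !tensor_mapE; congr tens.
by apply: free_map_comp => h; rewrite /= compA.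
Qed.

(* The left adjoint F_! of F^* on right modules. *)
Definition lan : right_module C :=
  @Cmodule (opcat C) (fun c => tensor L (hom_module c))
    (fun a b (f : @hom C b a) => tensor_map (ntid L) (hom_module_pre f))
    lan_act1 (fun a b c (g : @hom C c b) (f : @hom C b a) => @lan_actM c b a g f).

Lemma lan_unit_additive (d : D) :
  nmod_morphism (fun x : L d => tens (M := hom_module (F d)) x (gen (idc (F d)))).
Proof. exact: tensl_additive. Qed.

Definition lan_unit_fun (d : D) : {additive L d -> lan (F d)} :=
  HB.pack (fun x : L d => tens (M := hom_module (F d)) x (gen (idc (F d))))
    (GRing.isNmodMorphism.Build _ _ _ (lan_unit_additive d)).

Lemma lan_unit_nat (a b : D) (f : hom a b) (x : L b) :
  lan_unit_fun a (ract L f x) = ract (rres F lan) f (lan_unit_fun b x).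
Proof.
transitivity (tens (L := L) (M := hom_module (F a)) x
    (mact (hom_module (F a)) f (gen (idc (F a))))); first exact: tens_act.
rewrite -[RHS]/(tensor_map (ntid L) (hom_module_pre (fmap F f))
  (tens (M := hom_module (F b)) x (gen (idc (F b))))) tensor_mapE; congr tens.
rewrite -[LHS]/(free_map _ (gen _)) -[RHS]/(free_map _ (gen _)) !free_mapE.
by rewrite compf1 comp1f.
Qed.

Definition lan_unit : nattrans L (rres F lan) :=
  @Nattrans (opcat D) L (rres F lan) lan_unit_fun
    (fun a b (f : @hom D b a) x => lan_unit_nat f x).
End HomModule.

Section Adjunct.
Variables (C D : category) (F : functor D C).
Variables (L : right_module D) (L' : right_module C).
Variable a : nattrans L (rres F L').

Definition adjunct_gen (c : C) (d : D) (x : L d) :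
    {additive hom_module F c d -> L' c} :=
  free_lift (fun h : hom c (F d) => ract L' h (a d x)).

Lemma adjunct_balanced (c : C) :
  balanced (L := L) (M := hom_module F c) (fun d x z => adjunct_gen c x z).
Proof.
split=> [d x x' y|d x y y'|d0 d1 f x y].
- move: y; apply: (@free_ext _ _ (adjunct_gen c (x + x'))
    (adjunct_gen c x \+ adjunct_gen c x')) => h /=.
  by rewrite !free_liftE !raddfD.
- exact: raddfD.
- move: y; apply: (@free_ext _ _ (adjunct_gen c (ract L f x))
    (adjunct_gen c x \o mact (hom_module F c) f)) => h /=.
  rewrite free_mapE !free_liftE.
  have -> : a d0 (ract L f x) = ract L' (fmap F f) (a d1 x) by exact: nt_nat.
  by rewrite /ract -mactM.
Qed.

Definition adjunct_fun (c : C) : {additive lan F L c -> L' c} :=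
  tensor_lift (adjunct_balanced c).

Lemma adjunct_nat (c0 c1 : C) (f : hom c0 c1) (x : lan F L c1) :
  adjunct_fun c0 (ract (lan F L) f x) = ract L' f (adjunct_fun c1 x).
Proof.
move: x; apply: (@tensor_ext _ _ _ _ (adjunct_fun c0 \o ract (lan F L) f)
  (ract L' f \o adjunct_fun c1)) => d x z.
rewrite -[LHS]/(adjunct_fun c0 (tensor_map (ntid L) (hom_module_pre F f)
  (tens x z))) tensor_mapE.
rewrite -[RHS]/(ract L' f (adjunct_fun c1 (tens x z))) !tensor_liftE.
move: z; apply: (@free_ext _ _ (adjunct_gen c0 x \o free_map (fun h => h \oc f))
  (ract L' f \o adjunct_gen c1 x)) => h /=.
by rewrite free_mapE !free_liftE /ract -mactM.
Qed.

(* The morphism F_! L -> L' corresponding to a : L -> F^* L'. *)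
Definition adjunct : nattrans (lan F L) L' :=
  @Nattrans (opcat C) (lan F L) L' adjunct_fun
    (fun c c' (f : @hom C c' c) x => adjunct_nat f x).

Lemma adjunctE (c : C) (d : D) (x : L d) (h : hom c (F d)) :
  adjunct c (tens (M := hom_module F c) x (gen h)) = ract L' h (a d x).
Proof.
rewrite -[LHS]/(adjunct_fun c (tens (M := hom_module F c) x (gen h))) tensor_liftE.
exact: free_liftE.
Qed.
End Adjunct.

Lemma adjunctP (C D : category) (F : functor D C) (L : right_module D)
    (L' : right_module C) (a : nattrans L (rres F L')) (b : nattrans (lan F L) L') :
  ntcomp (ntres (fop F) b) (lan_unit F L) = a <-> b = adjunct a.
Proof.
split=> [<-|->]; apply: nattrans_ext.
  move=> c; apply: tensor_ext => d x z.
  set b' := adjunct _.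
  have H (h : @hom C c (F d)) : b c (tens (M := hom_module F c) x (gen h)) =
      b' c (tens (M := hom_module F c) x (gen h)).
    rewrite [RHS]adjunctE.
    rewrite -[RHS](nt_nat b (h : @hom (opcat C) (F d) c)).
    congr (b c _).
    rewrite -[RHS]/(tensor_map (ntid L) (hom_module_pre F h)
      (tens (M := hom_module F (F d)) x (gen (idc (F d))))) tensor_mapE.
    congr tens; rewrite -[RHS]/(free_map _ (gen _)) free_mapE.
    by rewrite comp1f.
  pose t : {additive hom_module F c d -> lan F L c} :=
    tens (M := hom_module F c) x.
  pose u : {additive hom_module F c d -> L' c} := b c \o t.
  pose u' : {additive hom_module F c d -> L' c} := b' c \o t.
  exact: (@free_ext _ _ u u' H z).
by move=> d x; rewrite /= -[LHS]/(adjunct a (F d) _) adjunctE /ract mact1.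
Qed.

Section LanTensor.
Variables (C D : category) (F : functor D C).
Variables (L : right_module D) (M : left_module C).

Lemma lan_tensor_balanced :
  balanced (L := L) (M := lres F M)
    (fun d x y => tens (L := lan F L) (M := M) (lan_unit F L d x) y).
Proof.
split=> [d x x' y|d x y y'|d0 d1 f x y].
- by rewrite raddfD tensDl.
- by rewrite tensDr.
- have -> : lan_unit F L d0 (ract L f x) =
      ract (lan F L) (fmap F f) (lan_unit F L d1 x) by exact: lan_unit_nat.
  exact: tens_act.
Qed.

(* The canonical isomorphism L (x)_D F^* M -> F_! L (x)_C M. *)
Definition lan_tensor : {additive tensor L (lres F M) -> tensor (lan F L) M} :=
  tensor_lift lan_tensor_balanced.
End LanTensor.

Section DerivedColimit.
Variables (C : category) (M : left_module C).

Lemma colim_dd n (x : tensor (ZN C n.+2) M) :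
  tensor_map (ZN_d C n) (ntid M) (tensor_map (ZN_d C n.+1) (ntid M) x) = 0.
Proof.
move: x; apply: (@tensor_ext _ _ _ _ (tensor_map _ _ \o tensor_map _ _) \0).
move=> c x y; rewrite -[LHS]/(tensor_map (ZN_d C n) (ntid M)
  (tensor_map (ZN_d C n.+1) (ntid M) (tens x y))) !tensor_mapE ZN_dd.
exact: (@tensl_additive _ (ZN C n) M c y).1.
Qed.

Definition colim_complex : chain_complex :=
  @ChainComplex (fun n => tensor (ZN C n) M)
    (fun n => tensor_map (ZN_d C n) (ntid M)) colim_dd.

Definition colim (n : nat) : zmodType := homology colim_complex n.
End DerivedColimit.

Section DerivedLimit.
Variables (C : category) (L : right_module C).

Lemma lim_dd n (s : nattrans (ZN C n) L) :
  nt_pre L (ZN_d C n.+1) (nt_pre L (ZN_d C n) s) = 0.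
Proof. by apply: nattrans_ext => c x; rewrite /= ZN_dd raddf0. Qed.

Definition lim_complex : cochain_complex :=
  @CochainComplex (fun n => nattrans (ZN C n) L) (fun n => nt_pre L (ZN_d C n))
    lim_dd.

Definition lim (n : nat) : zmodType := cohomology lim_complex n.
End DerivedLimit.

Section InducedMaps.
Variables (C D : category) (F : functor D C).

Section Colim.
Variable M : left_module C.

Definition ind_colim_fun n :
    {additive colim_complex (lres F M) n -> colim_complex M n} :=
  tensor_map (adjunct (ZN_map F n)) (ntid M) \o lan_tensor F (ZN D n) M.

Lemma ind_colim_funE n d (x : ZN D n d) (y : M (F d)) :
  ind_colim_fun n (tens (M := lres F M) x y) =
  tens (L := ZN C n) (ZN_map F n d x) y.
Proof.
rewrite -[LHS]/(tensor_map (adjunct (ZN_map F n)) (ntid M)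
  (lan_tensor F (ZN D n) M (tens (M := lres F M) x y))) tensor_liftE tensor_mapE.
congr tens.
by rewrite [LHS]adjunctE /ract mact1.
Qed.

Lemma ind_colim_d n (x : colim_complex (lres F M) n.+1) :
  ind_colim_fun n (chain_d _ n x) = chain_d _ n (ind_colim_fun n.+1 x).
Proof.
move: x; apply: (@tensor_ext _ _ _ _ (ind_colim_fun n \o chain_d _ n)
  (chain_d _ n \o ind_colim_fun n.+1)) => d x y.
rewrite -[LHS]/(ind_colim_fun n (tensor_map (ZN_d D n) (ntid (lres F M))
  (tens (M := lres F M) x y))) tensor_mapE ind_colim_funE ZN_map_d.
rewrite -[RHS]/(tensor_map (ZN_d C n) (ntid M) (ind_colim_fun n.+1
  (tens (M := lres F M) x y))) ind_colim_funE.
by rewrite tensor_mapE.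
Qed.

Definition ind_colim (n : nat) : {additive colim (lres F M) n -> colim M n} :=
  homology_map (ChainMap ind_colim_d) n.
End Colim.

Section Lim.
Variable L : right_module C.

(* Precomposition with the adjunct F_! ZN(-/D) -> ZN(-/C), followed by the
   adjunction isomorphism Hom(F_! ZN(-/D), L) -> Hom(ZN(-/D), F^* L). *)
Definition ind_lim_fun n :
    {additive lim_complex L n -> lim_complex (rres F L) n} :=
  nt_pre (rres F L) (lan_unit F (ZN D n)) \o nt_res (fop F) (lan F (ZN D n)) L
    \o nt_pre L (adjunct (ZN_map F n)).

Lemma ind_lim_funE n (s : nattrans (ZN C n) L) d (x : ZN D n d) :
  (ind_lim_fun n s : nattrans _ _) d x = s (F d) (ZN_map F n d x).
Proof.
rewrite -[LHS]/(s (F d) (adjunct (ZN_map F n) (F d) (lan_unit F _ d x))).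
by congr (s _ _); rewrite [LHS]adjunctE /ract mact1.
Qed.

Lemma ind_lim_d n (s : lim_complex L n) :
  ind_lim_fun n.+1 (cochain_d _ n s) = cochain_d _ n (ind_lim_fun n s).
Proof.
apply: nattrans_ext => d x; rewrite ind_lim_funE.
rewrite -[RHS]/((ind_lim_fun n s : nattrans _ _) d (ZN_d D n d x)).
by rewrite ind_lim_funE ZN_map_d.
Qed.

Definition ind_lim (n : nat) : {additive lim L n -> lim (rres F L) n} :=
  cohomology_map (CochainMap ind_lim_d) n.
End Lim.
End InducedMaps.

(* F_* and F^* with values in, resp. coming from, a module N that is only
   propositionally equal to F^* M; needed since I0^* M is a restriction along
   two different factorizations I0 = I1 F1 = I2 F2. *)
Definition colim_map (C D : category) (F : functor D C) (M : left_module C)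
    (N : left_module D) (e : N = lres F M) (n : nat) :
    {additive colim N n -> colim M n} :=
  eq_rect_r (fun N => {additive colim N n -> colim M n}) (ind_colim F M n) e.

Definition lim_map (C D : category) (F : functor D C) (L : right_module C)
    (N : right_module D) (e : N = rres F L) (n : nat) :
    {additive lim L n -> lim N n} :=
  eq_rect_r (fun N => {additive lim L n -> lim N n}) (ind_lim F L n) e.

(* Main.v *)
(** Everything is cohomological.  A weak equivalence of simplicial sets induces
    isomorphisms on cohomology, as one sees by mapping into the Kan complexes
    K(B, n); hence a local covering I has H^n(N(c/I); B) = 0 for n > 0 and all
    B.  In degree 0, the pushout property yields, for every c, the exact row
      0 -> B -> H^0(N(c/I1); B) + H^0(N(c/I2); B) -> H^0(N(c/I0); B) -> 0,
    by mapping the square into categories over C whose sections are 0- and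
    1-cocycles of C with values in the coinduced module Map(Hom(c, -), B);
    injectivity on objects is what makes a 0-cochain on C0 extend to C1 or C2.
    So the total complex of the cochains of C, C1 + C2 and C0 is acyclic for
    coinduced coefficients, and then for all coefficients L by dimension
    shifting along L -> coind L -> coker.  This is the Mayer-Vietoris sequence
    for limits.  For colimits, a cycle of the total chain complex with
    coefficients in M is a boundary as soon as it is killed by all W-valued
    functionals vanishing on boundaries, and these are the total cocycles with
    coefficients in Hom(M, W). *)

Require Import Defs.
From HB Require Import structures.
From mathcomp Require Import all_boot ssralg ssrint boolp zify.
From Stdlib Require Import JMeq.
From Stdlib.Relations Require Import Relation_Operators.

Set Implicit Arguments.
Unset Strict Implicit.
Unset Printing Implicit Defensive.

Import GRing.Theory.
Local Open Scope ring_scope.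

(** Weak equivalences are given only by homotopy classes of maps into Kan complexes, so what they
    control directly is cohomology; this is why homology enters last, by duality. There W may be any
    abelian group, so the projection onto the quotient by the boundaries already separates. The
    second obstacle is the pushout: its morphisms are words without a usable normal form, so it is
    used only through its universal property, against target categories whose functors over C encode
    cocycles. Coinduced coefficients fit the local covering hypothesis, which concerns one c at a
    time: cochains with values in the product over c of Map(Hom(c, -), B c) split into the cochains
    of the nerves N(c/I). Finally, the square gives in general no short exact sequence of cochain
    complexes, since simplices of C need not come from C1 or C2; the connecting homomorphisms are
    therefore defined as zigzag relations, whose totality and single-valuedness are instances of
    acyclicity of the total complex. *)

Lemma dependent_choice_fun (A : Type) (B : A -> Type)
  (P : forall a, B a -> Prop) :
  (forall a, exists b, P a b) -> exists f : forall a, B a, forall a, P a (f a).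
Proof.
move=> H; exists (fun a => projT1 (cid (H a))) => a.
exact: (projT2 (cid (H a))).
Qed.

(** * Cohomology of simplicial sets *)

Section SimplicialCochains.
Variable B : zmodType.

Definition scob (K : sset) n (z : K n -> B) : K n.+1 -> B :=
  fun x => \sum_(i < n.+2) z (face i x) *~ (-1) ^+ i.

Lemma free_lift_simplicial_d (K : sset) n (z : K n -> B) w :
  free_lift z (simplicial_d K n w) = free_lift (scob z) w.
Proof.
move: w; apply: (@free_ext _ _ (free_lift z \o simplicial_d K n)) => x /=.
rewrite !free_liftE raddf_sum; apply: eq_bigr => i _.
by rewrite raddfMz free_liftE.
Qed.

Lemma scob_scob (K : sset) n (z : K n -> B) x : scob (scob z) x = 0.
Proof.
rewrite -[LHS]free_liftE -!free_lift_simplicial_d simplicial_dd; exact: raddf0.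
Qed.

Lemma scob_smap (K L : sset) (f : smap K L) n (z : L n -> B) x :
  scob (fun x => z (f n x)) x = scob z (f n.+1 x).
Proof. by apply: eq_bigr => i _; rewrite /face sfun_act. Qed.

Lemma scobB (K : sset) n (z w : K n -> B) x :
  scob (fun x => z x - w x) x = scob z x - scob w x.
Proof. by rewrite -sumrB; apply: eq_bigr => i _; rewrite mulrzBl. Qed.

Lemma scobD (K : sset) n (z w : K n -> B) x :
  scob (fun x => z x + w x) x = scob z x + scob w x.
Proof. by rewrite -big_split; apply: eq_bigr => i _; rewrite mulrzDl. Qed.

Lemma scobN (K : sset) n (z : K n -> B) x : scob (fun x => - z x) x =
  - scob z x.
Proof. by rewrite -sumrN; apply: eq_bigr => i _; rewrite mulNrz. Qed.

Lemma scob0 (K : sset) n (x : K n.+1) : scob (fun=> 0) x = 0.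
Proof. by apply: big1 => i _; rewrite mul0rz. Qed.

Lemma eq_scob (K : sset) n (z w : K n -> B) : z =1 w -> scob z =1 scob w.
Proof. by move=> e x; apply: eq_bigr => i _; rewrite e. Qed.

End SimplicialCochains.

(** * Eilenberg-MacLane complexes and their Kan property *)

Section EilenbergMacLane.
Variables (B : zmodType) (n : nat).

(* The m-simplices of K(B, n) are the n-cocycles of Delta^m. *)
Record em_simplex m := EmSimplex {
  em_fun :> simplex_std m n -> B;
  em_cocycle : forall t, scob em_fun t = 0 }.

Lemma em_simplex_ext m (z w : em_simplex m) : z =1 w -> z = w.
Proof.
case: z w => z hz [w hw] /= /funext e.
by case: w / e hw => hw; rewrite (Prop_irrelevance hz hw).
Qed.

Lemma yoneda_act (K : sset) m (x : K m) k l (a : monotone k l)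
    (b : simplex_std m l) :
  sact (sact a b) x = sact a (sact b x).
Proof. exact: sactM. Qed.

Definition yoneda (K : sset) m (x : K m) : smap (simplex_std m) K :=
  @Smap (simplex_std m) K (fun k a => sact a x)
    (fun k l a b => yoneda_act x a b).

Lemma cocycle_pull (K L : sset) (f : smap K L) (z : L n -> B) :
  (forall x, scob z x = 0) -> forall x, scob (fun x => z (f n x)) x = 0.
Proof. by move=> hz x; rewrite scob_smap. Qed.

Definition em_act k m (a : monotone k m) (z : em_simplex m) : em_simplex k :=
  EmSimplex (cocycle_pull (yoneda (K := simplex_std m) a) (em_cocycle z)).

Lemma em_act1 m (z : em_simplex m) : em_act (mono_id m) z = z.
Proof. by apply: em_simplex_ext => b /=; congr (em_fun z _);
  exact: monotone_ext. Qed.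

Lemma em_actM l m k (a : monotone m k) (b : monotone l m) (z : em_simplex k) :
  em_act (mono_comp a b) z = em_act b (em_act a z).
Proof. exact: em_simplex_ext. Qed.

Definition em : sset := Sset em_act1 em_actM.

(** The pullback along u of the fundamental cocycle of K(B, n). Together with [em_map] it identifies
    maps K -> K(B, n) with n-cocycles of K. *)
Definition em_val (K : sset) (u : smap K em) : K n -> B :=
  fun x => u n x (mono_id n).

Lemma em_valE (K : sset) (u : smap K em) m (x : K m) (b : monotone n m) :
  u m x b = em_val u (sact b x).
Proof.
by rewrite /em_val sfun_act /=; congr (em_fun (u m x) _); exact: monotone_ext.
Qed.

Lemma em_val_cocycle (K : sset) (u : smap K em) x : scob (em_val u) x = 0.
Proof.
rewrite -[RHS](em_cocycle (u n.+1 x) (mono_id n.+1)); apply: eq_bigr => i _.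
rewrite em_valE; congr (em_val u _ *~ _); rewrite /face.
Qed.

Section EmMap.
Variables (K : sset) (z : K n -> B).
Hypothesis z_cocycle : forall x, scob z x = 0.

Lemma em_map_act k m (a : monotone k m) (x : K m) :
  EmSimplex (cocycle_pull (yoneda (sact a x)) z_cocycle) =
  em_act a (EmSimplex (cocycle_pull (yoneda x) z_cocycle)).
Proof. by apply: em_simplex_ext => b /=; rewrite -sactM. Qed.

Definition em_map : smap K em :=
  @Smap K em (fun m x => EmSimplex (cocycle_pull (yoneda x) z_cocycle))
    (fun k m a x => em_map_act a x).

Lemma em_map_val x : em_val em_map x = z x.
Proof. by rewrite /em_val /= sact1. Qed.
End EmMap.

Section Filler.
Variables (N : nat) (k : 'I_N.+1) (u : smap (horn k) em).

(** The value 0 off the horn is a default: the cocycle condition is only claimed on simplices of the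
    horn, all of whose faces lie in the horn. *)
Definition horn_cochain (a : monotone n N) : B :=
  if pselect (in_horn k a) is left h then em_val u (exist _ a h) else 0.

Lemma horn_cochainE (a : horn k n) : horn_cochain (sval a) = em_val u a.
Proof.
rewrite /horn_cochain; case: pselect => [h|/(_ (svalP a))//].
by congr em_val; exact: eq_sig_hprop.
Qed.

Lemma horn_cochain_cocycle (t : simplex_std N n.+1) :
  in_horn k t -> scob (K := simplex_std N) horn_cochain t = 0.
Proof.
move=> h; pose t' : horn k n.+1 := exist _ t h.
rewrite -[RHS](em_val_cocycle u t'); apply: eq_bigr => i _.
by rewrite -horn_cochainE.
Qed.

(* The retraction of Delta^N onto the face opposite to i which moves i to its
   neighbour in the direction of k. *)
Definition retract_fun (i j : 'I_N.+1) : 'I_N.+1 :=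
  if j == i then inord (if (i < k)%N then i.+1 else i.-1) else j.

Lemma retract_funE (i j : 'I_N.+1) : i != k -> retract_fun i j =
  (if j == i :> nat then if (i < k)%N then i.+1 else i.-1 else j) :> nat.
Proof.
move=> ik; have := ltn_ord i; have := ltn_ord k; rewrite /retract_fun val_eqE.
have {}ik : (i != k :> nat) by [].
by case: eqVneq => // _; case: (ltnP i k) => ? ? ?; rewrite inordK; lia.
Qed.

Lemma retract_homo (i : 'I_N.+1) :
  i != k -> {homo retract_fun i : a b / (a <= b)%N}.
Proof.
move=> ik a b; rewrite !retract_funE //.
have {}ik : (i != k :> nat) by [].
do 2![case: eqP => ?]; case: (ltnP i k) => ?; lia.
Qed.

Definition retraction (i : 'I_N.+1) (ik : i != k) : monotone N N :=
  Monotone (retract_homo ik).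

Lemma retraction_fix i (ik : i != k) m (a : monotone m N) :
  (forall j, a j != i) -> mono_comp (retraction ik) a = a.
Proof.
by move=> ai; apply: monotone_ext => j; rewrite /= /retract_fun (negPf (ai j)).
Qed.

Lemma retraction_horn i (ik : i != k) m (a : monotone m N) :
  in_horn k (mono_comp (retraction ik) a).
Proof.
exists i => // j; rewrite -val_eqE /= retract_funE //.
have {}ik : (i != k :> nat) by [].
by case: (eqVneq (a j : nat)) => //; case: (ltnP i k); lia.
Qed.

Lemma retraction_miss i (ik : i != k) m (a : monotone m N) (j : 'I_N.+1) :
  (if (i < k)%N then i.+1 else i.-1) != j -> (forall l, a l != j) ->
  forall l, mono_comp (retraction ik) a l != j.
Proof.
move=> tj aj l; rewrite -val_eqE /= retract_funE //.
by case: (eqVneq (a l : nat)) => // _; exact: aj.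
Qed.

Definition fills (P : nat -> Prop) (w : monotone n N -> B) : Prop :=
  (forall t, scob (K := simplex_std N) w t = 0) /\ forall a : monotone n N,
    (exists2 i : 'I_N.+1, P i /\ i != k & forall j, a j != i) ->
    w a = horn_cochain a.

(** Correct w by its error pulled back along the retraction onto the face opposite to i. That face
    is fixed, so the error there disappears. A face opposite to a vertex j in P is mapped into
    itself, since i moves to a vertex outside P, and there the error was already 0. The correction
    is a cocycle because the retraction lands in the horn. *)
Lemma fill_step (P Q : nat -> Prop) (i : 'I_N.+1) : i != k ->
  ~ P (if (i < k)%N then i.+1 else i.-1) ->
  (forall j, Q j -> P j \/ j = i) ->
  (exists w, fills P w) -> exists w, fills Q w.
Proof.
move=> ik Pt QP [w [wc wP]]; pose e a := mono_comp (retraction ik) a.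
pose r := yoneda (K := simplex_std N) (retraction ik).
exists (fun a => w a - (w (e n a) - horn_cochain (e n a))); split=> [t|a].
  rewrite (scobB (K := simplex_std N)) wc (scobB (K := simplex_std N)) sub0r.
  rewrite (scob_smap r w) wc (scob_smap r horn_cochain) horn_cochain_cocycle.
    by rewrite subrr oppr0.
  exact: retraction_horn.
case=> j [Qj jk] aj; case: (QP j Qj) => [Pj|/val_inj ji].
  rewrite wP; last by exists j.
  rewrite wP ?subrr ?subr0 //; exists j => //; apply: retraction_miss => //.
  by apply/eqP => tj; apply: Pt; rewrite tj.
by subst j; rewrite /e retraction_fix // subKr.
Qed.

(** The faces are settled in the order 0, ..., k-1 and then N, ..., k+1: in this way the neighbour
    of i in the direction of k is never the index of a face settled before i. *)
Lemma fill : exists w, fills (fun=> True) w.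
Proof.
have kN := ltn_ord k.
have A r : (r <= k)%N -> exists w, fills (fun j => (j < r)%N) w.
  elim: r => [_|r IH rk]; first by exists (fun=> 0); split=> [t|a [i []//]];
    exact: (@scob0 _ (simplex_std N)).
  have rN : (r < N.+1)%N by lia.
  apply: (@fill_step _ _ (Ordinal rN)) (IH (ltnW rk)).
  - by rewrite -val_eqE /=; lia.
  - by rewrite /= rk; lia.
  - by move=> j /=; lia.
have D r : (r <= N - k)%N -> exists w,
  fills (fun j => (j < k \/ N - r < j)%N) w.
  elim: r => [_|r IH rk].
    have [w [wc wP]] := A k (leqnn k); exists w; split=> // a [i [Pi ik] ai].
    by apply: wP; exists i => //; split=> //; have := ltn_ord i; lia.
  have rN : (N - r < N.+1)%N by lia.
  apply: (@fill_step _ _ (Ordinal rN)) (IH (ltnW rk)).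
  - by rewrite -val_eqE /=; lia.
  - by rewrite /= ltnNge; case: leqP; lia.
  - by move=> j /=; lia.
have [w [wc wP]] := D _ (leqnn _); exists w; split=> // a [i [_ ik] ai].
apply: wP; exists i => //; split=> //; have {}ik : (i != k :> nat) by [].
by lia.
Qed.

Lemma em_filler : exists v : smap (simplex_std N) em,
  forall m (a : horn k m), v m (sval a) = u m a.
Proof.
have [w [wc wP]] := fill.
exists (em_map wc) => m a; apply: em_simplex_ext => b.
rewrite /= em_valE -horn_cochainE /=.
have [i ik ai] := svalP a; apply: (wP (mono_comp (sval a) b)).
by exists i => // j; exact: ai.
Qed.
End Filler.

Lemma em_kan : kan em.
Proof. by move=> N k _ u; exact: em_filler. Qed.
End EilenbergMacLane.

(** * The prism operator *)

Section Prism.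
Variable B : zmodType.

Lemma mulrz_signK (x : B) i : x *~ (-1) ^+ i *~ (-1) ^+ i = x.
Proof. by rewrite -mulrzA -expr2 sqrr_sign mulr1z. Qed.

(* T is the table of the faces of the prism: its two diagonals cancel against
   each other up to the ends, and the rest is the prism over the faces. *)
Lemma prism_sum m (T G : nat -> nat -> B) (V : nat -> B) :
  (forall i, (i < m.+2)%N -> \sum_(0 <= j < m.+3) T i j *~ (-1) ^+ j = 0) ->
  (forall i j, (j < i < m.+2)%N -> T i j = G i.-1 j) ->
  (forall i, (i < m.+2)%N -> T i i = V i) ->
  (forall i, (i < m.+2)%N -> T i i.+1 = V i.+1) ->
  (forall i j, (i.+1 < j < m.+3)%N -> T i j = G i j.-1) ->
  V 0%N - V m.+2 = \sum_(0 <= j < m.+2)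
    (\sum_(0 <= i < m.+1) G i j *~ (-1) ^+ i) *~ (-1) ^+ j.
Proof.
move=> T0 Tlt Td Td1 Tgt.
pose R k i := \sum_(0 <= j < i) G k j *~ (-1) ^+ j.
pose S k i := \sum_(i <= j < m.+2) G k j *~ (-1) ^+ j.
(* Row i of the table with its two diagonal entries isolated; the left-hand sides telescope over
   i. *)
have row i : (i < m.+2)%N ->
    V i - V i.+1 = (S i i.+1 - R i.-1 i) *~ (-1) ^+ i.
  move=> im; rewrite -[LHS](mulrz_signK _ i); congr (_ *~ _).
  apply/eqP; rewrite -subr_eq0; apply/eqP; rewrite -[RHS](T0 i im).
  rewrite (@big_cat_nat _ _ _ i) /=; [|by []|by lia].
  rewrite [X in _ = _ + X]big_ltn; last by lia.
  rewrite [X in _ = _ + (_ + X)]big_ltn; last by lia.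
  rewrite Td // Td1 // exprS mulN1r mulrNz opprB.
  have -> : \sum_(0 <= j < i) T i j *~ (-1) ^+ j = R i.-1 i.
    by apply: eq_big_nat => j ji; rewrite Tlt //; lia.
  have -> : \sum_(i.+2 <= j < m.+3) T i j *~ (-1) ^+ j = - S i i.+1.
    rewrite big_add1 /= -sumrN; apply: eq_big_nat => j ji.
    by rewrite Tgt /= ?exprS ?mulN1r ?mulrNz //; lia.
  by rewrite mulrzBl addrCA -!addrA.
transitivity (\sum_(0 <= i < m.+2) (V i - V i.+1)).
  rewrite (eq_bigr (fun i => - (V i.+1 - V i))) => [|i _];
    last by rewrite opprB.
  by rewrite sumrN telescope_sumr // opprB.
rewrite (eq_big_nat _ _ (fun i (h : (0 <= i < m.+2)%N) => row i h)).
rewrite (eq_bigr _ (fun i _ => mulrzBl _ _ _)) sumrB.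
(* The terms S at i = m+1 and R at i = 0 are empty sums. Without them, and with R shifted by one,
   both families run over i <= m. *)
rewrite big_nat_recr //= {2}/S (@big_geq _ _ _ m.+2) // mul0rz addr0.
rewrite [X in _ - X]big_nat_recl //= {1}/R (@big_geq _ _ _ 0 0) // mul0rz add0r
  -sumrN -big_split /=.
rewrite [RHS](eq_bigr
  (fun j => \sum_(0 <= i < m.+1) G i j *~ (-1) ^+ j *~ (-1) ^+ i)).
  rewrite exchange_big /=; apply: eq_big_nat => i im.
  rewrite exprS mulN1r mulrNz opprK -mulrzDl addrC -mulrz_suml.
  by congr (_ *~ _); rewrite -big_cat_nat //; lia.
move=> j _; rewrite mulrz_suml; apply: eq_bigr => i _.
by rewrite -!mulrzA mulrC.
Qed.

Lemma codegeneracy_homo n i :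
  {homo (fun j : 'I_n.+2 => inord (minn n (j - (i < j))) : 'I_n.+1) :
    j k / (j <= k)%N}.
Proof. by move=> j k jk; rewrite !inordK; lia. Qed.

(** The truncation [minn n] only acts when i > n; it makes the formula total in the natural number
    i. *)
Definition codegeneracy n i :
  monotone n.+1 n := Monotone (@codegeneracy_homo n i).

Lemma step_homo n i :
  {homo (fun j : 'I_n.+1 => inord (i <= j)%N : 'I_2) : j k / (j <= k)%N}.
Proof. by move=> j k jk; rewrite !inordK; lia. Qed.

Definition step n i : monotone n 1 := Monotone (@step_homo n i).

Lemma step_coface n i (j : 'I_n.+2) :
  mono_comp (step n.+1 i) (coface j) = step n (if (j < i)%N then i.-1 else i).
Proof.
apply: monotone_ext => k; rewrite /= /bump; congr inord.
by case: (ltnP j i); case: (leqP j k); lia.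
Qed.

Lemma step0 n : step n 0 = vertex ord_max n.
Proof. by apply: monotone_ext => j; apply: val_inj; rewrite /= inordK. Qed.

Lemma step_last n : step n n.+1 = vertex ord0 n.
Proof.
apply: monotone_ext => j; apply: val_inj.
by have := ltn_ord j; rewrite /= inordK; lia.
Qed.

Lemma codegeneracy_coface_lt n i (j : 'I_n.+3) : (j < i < n.+2)%N ->
  mono_comp (codegeneracy n.+1 i) (coface j) =
  mono_comp (coface (inord j)) (codegeneracy n i.-1).
Proof.
move=> ji; apply: monotone_ext => k; apply: val_inj; have := ltn_ord k.
by rewrite /= /bump !inordK; lia.
Qed.

Lemma codegeneracy_coface_gt n i (j : 'I_n.+3) : (i.+1 < j)%N ->
  mono_comp (codegeneracy n.+1 i) (coface j) =
  mono_comp (coface (inord j.-1)) (codegeneracy n i).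
Proof.
move=> ji; apply: monotone_ext => k; apply: val_inj.
by have kn := ltn_ord k; have jn := ltn_ord j; rewrite /= /bump !inordK; lia.
Qed.

Lemma codegeneracy_coface_id n i (j : 'I_n.+2) :
  (i <= n)%N -> j = i :> nat \/ j = i.+1 :> nat ->
  mono_comp (codegeneracy n i) (coface j) = mono_id n.
Proof.
move=> im ji; apply: monotone_ext => k; apply: val_inj.
by have := ltn_ord k; rewrite /= /bump !inordK; lia.
Qed.

(** The primitive is the signed sum of Z over the top-dimensional simplices of the prism over an
    m-simplex. The cocycle condition on the top simplices of the prism over x supplies the vanishing
    rows of [prism_sum]. *)
Lemma prism (K : sset) m (Z : sprod K (simplex_std 1) m.+1 -> B) :
  (forall x, scob Z x = 0) ->
  exists w : K m -> B, forall x : K m.+1,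
    Z (x, vertex ord_max m.+1) - Z (x, vertex ord0 m.+1) = scob w x.
Proof.
move=> Z0; pose w (y : K m) := \sum_(0 <= i < m.+1)
  Z (sact (codegeneracy m i) y, step m.+1 i.+1) *~ (-1) ^+ i.
exists w => x; rewrite -step0 -step_last.
pose y i : sprod K (simplex_std 1) m.+2 :=
  (sact (codegeneracy m.+1 i) x, step m.+2 i.+1).
pose T i j := Z (face (inord j) (y i)).
pose G i j := Z (sact (codegeneracy m i) (face (inord j) x), step m.+1 i.+1).
pose V i := Z (x, step m.+1 i).
have E i (j : 'I_m.+3) : face j (y i) =
  (sact (mono_comp (codegeneracy m.+1 i) (coface j)) x,
    step m.+1 (if (j < i.+1)%N then i else i.+1)).
  by rewrite sactM -[RHS]/(_,
    step m.+1 (if (j < i.+1)%N then i.+1.-1 else i.+1)) -step_coface.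
rewrite -[LHS]/(V 0%N - V m.+2) (@prism_sum m T G V).
- by rewrite /scob big_mkord; apply: eq_bigr => j _; rewrite /G /w inord_val.
- move=> i im; rewrite -[RHS](Z0 (y i)) big_mkord; apply: eq_bigr => j _.
  by rewrite /T inord_val.
- move=> i j ji; rewrite /T /G E inordK; last by lia.
  rewrite codegeneracy_coface_lt inordK; try lia.
  by rewrite sactM prednK; [rewrite ltnS ltnW //|]; lia.
- move=> i im; rewrite /T /G E inordK ?ltnSn; try lia.
  by rewrite codegeneracy_coface_id ?sact1 // inordK; lia.
- move=> i im; rewrite /T /G E inordK ?ltnn; try lia.
  by rewrite codegeneracy_coface_id ?sact1 // inordK; lia.
- move=> i j ij; rewrite /T /G E inordK; last by lia.
  rewrite codegeneracy_coface_gt inordK; try lia.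
  by rewrite sactM ltnNge ltnW //; lia.
Qed.
End Prism.

(** * Invariance of cohomology under weak equivalences *)

Definition cohomologous (B : zmodType) (K : sset) m (z z' : K m.+1 -> B)
  : Prop :=
  exists w : K m -> B, forall x, z x - z' x = scob w x.

(** All that is retained of homotopical discreteness: cohomology vanishes in positive degrees for
    all coefficients, while degree 0 is left free. *)
Definition coh_discrete (K : sset) : Prop :=
  forall (B : zmodType) m (z : K m.+1 -> B), (forall x, scob z x = 0) ->
  cohomologous z (fun=> 0).

Section WeakInvariance.
Variables (B : zmodType) (m : nat).

Lemma homotopic_cohomologous (K : sset) (u v : smap K (em B m.+1)) :
  homotopic u v -> cohomologous (em_val u) (em_val v).
Proof.
elim=> {u v} [u v [H Huv]|u|u v _ [w wE]|u v s _ [w wE] _ [w' w'E]].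
- have [w wE] := prism (@em_val_cocycle _ _ _ H).
  exists (fun x => - w x) => x.
  have [Hu Hv] := Huv m.+1 x.
  by rewrite scobN -wE opprB /em_val -Hu -Hv.
- by exists (fun=> 0) => x; rewrite subrr scob0.
- by exists (fun x => - w x) => x; rewrite scobN -wE opprB.
- exists (fun x => w x + w' x) => x.
  by rewrite scobD -wE -w'E addrA subrK.
Qed.

(* The cochain on K x Delta^1 which is w at one end and 0 elsewhere has as
   coboundary a homotopy from 0 to the coboundary of w. *)
Lemma coboundary_homotopic (K : sset) (u v : smap K (em B m.+1))
  (w : K m -> B) :
  (forall x, em_val u x = 0) -> (forall x, em_val v x = scob w x) ->
  homotopic u v.
Proof.
move=> u0 vw; apply: rst_step.
(* A simplex of Delta^1 whose first vertex is the last one is constant, so the test singles out one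
   end of the cylinder. *)
pose W (p : sprod K (simplex_std 1) m) : B :=
  if p.2 ord0 == ord_max then w p.1 else 0.
have W0 : forall p, scob (scob W) p = 0 by exact: scob_scob.
exists (em_map W0) => n x; split; apply: em_simplex_ext => b.
  by rewrite [RHS]em_valE u0 /= /scob big1 // => i _; rewrite /W /= mul0rz.
by rewrite [RHS]em_valE vw.
Qed.

(** For X = K(B, m+1), injectivity of [L, X] -> [K, X] carries the vanishing from K to L, and
    surjectivity carries it from L to K. *)
Lemma weak_equivalence_coh (K L : sset) (f : smap K L) : weak_equivalence f ->
  (forall z : K m.+1 -> B, (forall x, scob z x = 0) ->
    cohomologous z (fun=> 0)) <->
  (forall z : L m.+1 -> B, (forall x, scob z x = 0) ->
    cohomologous z (fun=> 0)).
Proof.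
move=> /(_ _ (@em_kan B m.+1)) [surj inj]; split=> H z z0.
  have zf0 x : scob (fun x => z (f _ x)) x = 0 by rewrite scob_smap.
  have [w wE] := H _ zf0.
  have c0 : forall x : L m.+2, scob (fun=> 0 : B) x = 0 by exact: scob0.
  have : homotopic (smap_comp (em_map c0) f) (smap_comp (em_map z0) f).
    apply: (@coboundary_homotopic _ _ _ w) => [//|x].
    by rewrite -wE subr0 /em_val /= sact1.
  move=> /inj h; have [w' w'E] := homotopic_cohomologous (rst_sym _ _ _ _ h).
  by exists w' => x; rewrite -w'E !em_map_val.
have [v] := surj (em_map z0).
move=> /homotopic_cohomologous [w wE].
have [w' w'E] := H _ (@em_val_cocycle _ _ _ v).
exists (fun x => w' (f _ x) - w x) => x.
rewrite scobB scob_smap -w'E -wE em_map_val !subr0.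
by rewrite /em_val /= opprB addrC subrK.
Qed.
End WeakInvariance.

Lemma weakly_equivalent_coh_discrete (K L : sset) :
  weakly_equivalent K L -> coh_discrete K <-> coh_discrete L.
Proof.
elim=> {K L} [K L [f fP]|K|K L _ ->|K L X _ -> _ ->] //.
by split=> H B m; [apply: (proj1 (weak_equivalence_coh B m fP)) |
  apply: (proj2 (weak_equivalence_coh B m fP))] => z; exact: H.
Qed.

(** All faces are identities, so the coboundary out of degree m is the identity for odd m and 0 for
    even m. A cocycle of positive degree is thus 0 or its own primitive. *)
Lemma sdiscrete_coh_discrete T : coh_discrete (sdiscrete T).
Proof.
have E (B : zmodType) m (z : sdiscrete T m -> B) x :
    scob z x = z x *~ (odd m)%:Z.
  rewrite /scob /= -mulrz_sumr; congr (_ *~ _).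
  elim: m {z x} => [|m IH]; first by rewrite 2!big_ord_recr big_ord0.
  by rewrite big_ord_recr IH /= -signr_odd /= negbK; case: odd.
move=> B m z z0; exists z => x; have := z0 x; rewrite !E /= subr0.
by case: odd => /=; rewrite ?mulr1z // mulr0z.
Qed.

Lemma homotopically_discrete_coh (U : category) :
  homotopically_discrete U -> coh_discrete (nerve U).
Proof.
move=> [T /weakly_equivalent_coh_discrete ->]; exact: sdiscrete_coh_discrete.
Qed.

(** * Cohomology of a category with an initial object *)

Section Initial.
Variables (U : category) (o : U) (t : forall x : U, hom o x).
Hypothesis t_unique : forall x (f : hom o x), f = t x.

Section Contraction.
Variables (n : nat) (s : functor (ordcat n) U) (a : monotone n 1).

(* The simplicial homotopy from the constant map at the initial object o to the
   identity: the vertices of s on which a vanishes are moved to o. *)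
Definition contract_ob (i : ordcat n) : U := if a i == ord0 then o else s i.

Lemma contract_le (i j : ordcat n) (ij : (i <= j)%N) :
  (a i == ord0) = false -> (a j == ord0) = false.
Proof.
move=> /negbT ai; apply/negbTE; have := mfun_homo a ij;
  apply: contraL => /eqP ->.
by rewrite -ltnNge lt0n.
Qed.

(** The impossible case, a morphism from s i back to o, is excluded by [contract_le], which is
    passed as an argument so that the two tests can be generalized independently. *)
Definition contract_hom (i j : ordcat n) (ij : hom i j) :
    hom (contract_ob i) (contract_ob j) :=
  (if a i == ord0 as b return
      ((b = false -> (a j == ord0) = false) ->
       hom (if b then o else s i) (contract_ob j))
   then fun _ => t (contract_ob j)
   else fun h =>
     (if a j == ord0 as b' return
         (b' = false -> hom (s i) (if b' then o else s j))
      then fun h' => match Bool.diff_true_false h' with end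
      else fun _ => fmap s ij) (h erefl)) (contract_le ij).

Lemma contract1 i : contract_hom (idc i) = idc (contract_ob i).
Proof.
rewrite /contract_hom /contract_ob; move: (contract_le _).
by case: (a i == ord0) => h; [exact/esym/t_unique|exact: fmap1].
Qed.

Lemma contractM (i j k : ordcat n) (g : hom j k) (f : hom i j) :
  contract_hom (g \oc f) = contract_hom g \oc contract_hom f.
Proof.
rewrite /contract_hom /contract_ob.
move: (contract_le _) (contract_le _) (contract_le _).
case: (a i == ord0) => h1 h2 h3; first exact/esym/t_unique.
move: (h1) (h2) (h3); case: (a j == ord0) {h1 h2 h3} => h1 h2 h3.
  by case: (Bool.diff_true_false (h1 erefl)).
move: (h2) (h3); case: (a k == ord0) {h2 h3} => h2 h3; last exact: fmapM.
by case: (Bool.diff_true_false (h3 erefl)).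
Qed.

Definition contract : functor (ordcat n) U := Functor contract1 contractM.
End Contraction.

Lemma contract_act m n (b : monotone m n)
    (p : sprod (nerve U) (simplex_std 1) n) :
  contract (sact b p).1 (sact b p).2 = sact (s := nerve U) b (contract p.1 p.2).
Proof.
apply: functor_ext => // i j ij.
rewrite /= /contract_hom; move: (contract_le _) (contract_le _) => h h'.
by rewrite (Prop_irrelevance h h').
Qed.

Definition contraction : smap (sprod (nerve U) (simplex_std 1)) (nerve U) :=
  @Smap (sprod (nerve U) (simplex_std 1)) (nerve U)
    (fun n p => contract p.1 p.2) (fun m n b p => contract_act b p).

Definition collapse : smap (nerve U) (sdiscrete unit) :=
  @Smap (nerve U) (sdiscrete unit) (fun n s => tt) (fun m n b s => erefl).

Definition const_simplex n : functor (ordcat n) U :=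
  @Functor (ordcat n) U (fun=> o) (fun _ _ _ => idc o)
    (fun=> erefl) (fun _ _ _ _ _ => esym (comp1f (idc o))).

Lemma const_simplex_act m n (a : monotone m n) :
  const_simplex m = sact (s := nerve U) a (const_simplex n).
Proof. exact: functor_ext. Qed.

Definition basepoint : smap (sdiscrete unit) (nerve U) :=
  @Smap (sdiscrete unit) (nerve U) (fun n _ => const_simplex n)
    (fun m n a _ => const_simplex_act a).

(** The contraction, followed by the map to K(B, m+1) that classifies z, makes z cohomologous to its
    pullback along nerve U -> point -> nerve U, and that pullback comes from a point. *)
Lemma initial_coh_discrete : coh_discrete (nerve U).
Proof.
move=> B m z z0; pose u := em_map z0.
pose H := smap_comp u contraction.
have h : homotopic (smap_comp u (smap_comp basepoint collapse)) u.
  apply: rst_step; exists H => n s; split; congr (u n _).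
    apply: functor_ext => // i j ij /=.
    by rewrite [contract_hom _ _ _](t_unique (_ : hom o o)) -(t_unique (idc o)).
  exact: functor_ext.
have [w wE] := homotopic_cohomologous h.
have z0' x : scob (fun x => z (basepoint m.+1 x)) x = 0 by rewrite scob_smap.
have [w' w'E] := sdiscrete_coh_discrete z0'.
exists (fun x => w' (collapse m x) - w x) => x.
have vE : em_val (smap_comp u (smap_comp basepoint collapse)) x =
  z (basepoint m.+1 tt) by exact: em_map_val.
by rewrite scobB scob_smap -w'E -wE em_map_val vE !subr0 opprB addrC subrK.
Qed.
End Initial.

(** * Zero-cocycles on a pushout square *)

(* Transport along an equality of objects, as a morphism. *)
Definition ceq (C : category) (a b : C) (p : a = b) : hom a b :=
  match p with erefl => idc a end.

Lemma ceq_id (C : category) (a : C) (p : a = a) : ceq p = idc a.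
Proof. by rewrite (Prop_irrelevance p erefl). Qed.

Lemma ceq_comp (C : category) (a b d : C) (p : a = b) (q : b = d) (r : a = d) :
  ceq q \oc ceq p = ceq r.
Proof. by case: _ / q r; case: _ / p => r; rewrite !ceq_id comp1f. Qed.

Lemma ceqK (C : category) (a b : C) (p : a = b) :
  ceq (esym p) \oc ceq p = idc a.
Proof. by case: _ / p; exact: comp1f. Qed.

Lemma ceqKV (C : category) (a b : C) (p : a = b) :
  ceq p \oc ceq (esym p) = idc b.
Proof. by case: _ / p; exact: comp1f. Qed.

Lemma ob_eq (C D : category) (F G : functor C D) : F = G -> forall x, F x = G x.
Proof. by move=> ->. Qed.

Lemma ceq_nat (C D : category) (F G : functor C D) (e : F = G) (x y : C)
    (f : hom x y) (p : F x = G x) (q : F y = G y) :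
  fmap G f \oc ceq p = ceq q \oc fmap F f.
Proof. by case: _ / e p q => p q; rewrite !ceq_id compf1 comp1f. Qed.

(** * Cocycles of degrees 0 and 1 as functors over C *)

Section Twisting.
Variables (C : category) (c : C) (T : Type) (B : zmodType).

(** On the under category c/I, [tw_ob] is a T-valued 0-cocycle and [tw_hom] a B-valued 1-cocycle.
    One record serves two uses: gluing 0-cocycles, with [tw_hom] zero, and gluing 1-cocycles, with T
    the unit type. *)
Record twisting (D : category) (I : functor D C) := Twisting {
  tw_ob : forall d : D, hom c (I d) -> T;
  tw_hom : forall d d' : D, hom d d' -> hom c (I d) -> B;
  tw_obE : forall d d' (f : hom d d') h, tw_ob (fmap I f \oc h) = tw_ob h;
  tw_homM : forall a b d (g : hom b d) (f : hom a b) h,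
    tw_hom (g \oc f) h = tw_hom f h + tw_hom g (fmap I f \oc h) }.

Lemma twisting_ext (D : category) (I : functor D C) (t u : twisting I) :
  (forall d h, tw_ob t (d := d) h = tw_ob u h) ->
  (forall d d' (f : hom d d') h, tw_hom t f h = tw_hom u f h) -> t = u.
Proof.
case: t u => [a b p q] [a' b' p' q'] /= ea eb.
have {}ea : a = a'.
  by apply: functional_extensionality_dep => d; apply: funext => h; exact: ea.
have {}eb : b = b'.
  do 3![apply: functional_extensionality_dep => ?]; apply: funext => h;
    exact: eb.
case: _ / ea p' => p'; case: _ / eb q' => q'.
by congr Twisting; exact: Prop_irrelevance.
Qed.

Lemma tw_hom1 (D : category) (I : functor D C) (t : twisting I) d h :
  tw_hom t (idc d) h = 0.
Proof.
apply: (@addrI _ (tw_hom t (idc d) h)).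
by rewrite addr0 -{3}(comp1f (idc d)) tw_homM fmap1 comp1f.
Qed.

(* Objects are pairs (x, hom(c, x) -> T) and morphisms are decorated with maps
   hom(c, x) -> B; functors to this category over C are the twistings. *)
Definition twist_ob := {x : C & hom c x -> T}.

Definition twist_hom (X Y : twist_ob) :=
  {p : hom (projT1 X) (projT1 Y) * (hom c (projT1 X) -> B) |
    forall h, projT2 Y (p.1 \oc h) = projT2 X h}.

Lemma twist_hom_ext (X Y : twist_ob) (f g : twist_hom X Y) :
  (sval f).1 = (sval g).1 -> (sval f).2 =1 (sval g).2 -> f = g.
Proof.
by move=> e1 /funext e2; apply: eq_sig_hprop => //;
  move: e1 e2; case: (sval f) (sval g) => ? ? [? ?] /= -> ->.
Qed.

Lemma twist_id_subproof (X : twist_ob) h : projT2 X (idc _ \oc h) = projT2 X h.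
Proof. by rewrite comp1f. Qed.

Definition twist_id (X : twist_ob) : twist_hom X X :=
  exist _ (idc _, fun=> 0) (@twist_id_subproof X).

Lemma twist_comp_subproof (X Y Z : twist_ob) (g : twist_hom Y Z)
    (f : twist_hom X Y) h :
  projT2 Z (((sval g).1 \oc (sval f).1) \oc h) = projT2 X h.
Proof. by rewrite -Defs.compA (svalP g) (svalP f). Qed.

Definition twist_comp (X Y Z : twist_ob) (g : twist_hom Y Z)
    (f : twist_hom X Y) : twist_hom X Z :=
  exist _ ((sval g).1 \oc (sval f).1,
    fun h => (sval f).2 h + (sval g).2 ((sval f).1 \oc h))
    (twist_comp_subproof g f).

Lemma twist_comp1f (X Y : twist_ob) (f : twist_hom X Y) :
  twist_comp (twist_id Y) f = f.
Proof. by apply: twist_hom_ext => [|h] /=; rewrite ?comp1f ?addr0. Qed.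

Lemma twist_compf1 (X Y : twist_ob) (f : twist_hom X Y) :
  twist_comp f (twist_id X) = f.
Proof. by apply: twist_hom_ext => [|h] /=; rewrite ?compf1 ?comp1f ?add0r. Qed.

Lemma twist_compA (X Y Z W : twist_ob) (h : twist_hom Z W) (g : twist_hom Y Z)
    (f : twist_hom X Y) :
  twist_comp h (twist_comp g f) = twist_comp (twist_comp h g) f.
Proof. by apply: twist_hom_ext => [|k] /=; rewrite ?Defs.compA ?addrA. Qed.

Definition twist_cat :
  category := Category twist_comp1f twist_compf1 twist_compA.

Definition twist_forget : functor twist_cat C :=
  @Functor twist_cat C (fun X => projT1 X) (fun X Y f => (sval f).1)
    (fun X => erefl) (fun X Y Z g f => erefl).

Section Lift.
Variables (D : category) (I : functor D C) (t : twisting I).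

Definition twist_lift_ob (d : D) : twist_cat := existT _ (I d) (@tw_ob _ _ t d).

Definition twist_lift_hom (d d' : D) (f : hom d d') :
  hom (twist_lift_ob d) (twist_lift_ob d') :=
  exist _ (fmap I f, tw_hom t f) (tw_obE t f).

Lemma twist_lift1 d : twist_lift_hom (idc d) = idc (twist_lift_ob d).
Proof. by apply: twist_hom_ext => [|h] /=; rewrite ?fmap1 ?tw_hom1. Qed.

Lemma twist_liftM a b d (g : hom b d) (f : hom a b) :
  twist_lift_hom (g \oc f) = twist_lift_hom g \oc twist_lift_hom f.
Proof. by apply: twist_hom_ext => [|h] /=; rewrite ?fmapM ?tw_homM. Qed.

Definition twist_lift : functor D twist_cat := Functor twist_lift1 twist_liftM.

Lemma twist_lift_forget : fcomp twist_forget twist_lift = I.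
Proof. exact: functor_ext. Qed.
End Lift.

Definition tw_comp (D D' : category) (I : functor D C) (F : functor D' D)
    (t : twisting I) : twisting (fcomp I F) :=
  @Twisting _ (fcomp I F) (fun d => @tw_ob _ _ t (F d))
    (fun d d' f => tw_hom t (fmap F f)) (fun d d' f => tw_obE t (fmap F f))
    (fun a b d g f h => etrans (congr1 (fun k => tw_hom t k h) (fmapM F g f))
       (tw_homM t (fmap F g) (fmap F f) h)).

Lemma twist_lift_comp (D D' : category) (I : functor D C) (F : functor D' D)
    (t : twisting I) : fcomp (twist_lift t) F = twist_lift (tw_comp F t).
Proof. exact: functor_ext. Qed.

Lemma twist_lift_eq (D : category) (I I' : functor D C) (e : I = I')
    (t : twisting I) (t' : twisting I') :
  (forall d (p : I d = I' d) h, tw_ob t h = tw_ob t' (ceq p \oc h)) ->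
  (forall d d' (f : hom d d') (p : I d = I' d) h,
    tw_hom t f h = tw_hom t' f (ceq p \oc h)) ->
  twist_lift t = twist_lift t'.
Proof.
case: _ / e t' => t' eo eh; congr twist_lift;
  apply: twisting_ext => [d h|d d' f h].
  by rewrite (eo d erefl) /= comp1f.
by rewrite (eh d d' f erefl) /= comp1f.
Qed.

Section FromLift.
Variables (D : category) (I : functor D C) (G : functor D twist_cat).
Hypothesis e : fcomp twist_forget G = I.

Let p d : I d = projT1 (G d) := esym (ob_eq e d).

Lemma untwist_obE d d' (f : hom d d') (h : hom c (I d)) :
  projT2 (G d') (ceq (p d') \oc (fmap I f \oc h)) =
    projT2 (G d) (ceq (p d) \oc h).
Proof.
by rewrite Defs.compA -(ceq_nat (esym e) f (p d) (p d')) -Defs.compA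
  (svalP (fmap G f)).
Qed.

Lemma untwist_homM a b d (g : hom b d) (f : hom a b) (h : hom c (I a)) :
  (sval (fmap G (g \oc f))).2 (ceq (p a) \oc h) =
  (sval (fmap G f)).2 (ceq (p a) \oc h) +
  (sval (fmap G g)).2 (ceq (p b) \oc (fmap I f \oc h)).
Proof.
rewrite fmapM /=; congr (_ + (sval (fmap G g)).2 _).
by rewrite !Defs.compA -(ceq_nat (esym e) f (p a) (p b)).
Qed.

(** [G] lies over [I] only up to a propositional equality, so morphisms out of c are transported by
    [ceq] before the decorations are evaluated. *)
Definition untwist : twisting I :=
  @Twisting D I (fun d h => projT2 (G d) (ceq (p d) \oc h))
    (fun d d' f h => (sval (fmap G f)).2 (ceq (p d) \oc h))
    untwist_obE untwist_homM.

Lemma untwistP (t : twisting I) : G = twist_lift t -> untwist = t.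
Proof.
rewrite /untwist; move: (untwist_obE) (untwist_homM); rewrite {}/p.
move: e => e' po ph G_t; subst G; apply: twisting_ext => [d h|d d' f h] /=.
  by rewrite ceq_id comp1f.
by rewrite ceq_id comp1f.
Qed.
End FromLift.
End Twisting.

(** The 0-cocycles of N(c/I), written without the nerve and for an arbitrary type of values. *)
Definition invariant_on (D C : category) (I : functor D C) (c : C) (T : Type)
    (a : forall d : D, hom c (I d) -> T) : Prop :=
  forall d d' (f : hom d d') h, a d' (fmap I f \oc h) = a d h.

Lemma invariant_on_ceq (C : category) (c : C) (T : Type)
    (a : forall x : C, hom c x -> T) x y (p : x = y) h :
  a y (ceq p \oc h) = a x h.
Proof. by case: _ / p; rewrite /= comp1f. Qed.

Section Chaotic.
Variable T : Type.

Definition chaotic : category :=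
  @Category T (fun _ _ => unit) (fun=> tt) (fun _ _ _ _ _ => tt)
    (fun _ _ f => match f with tt => erefl end)
    (fun _ _ f => match f with tt => erefl end)
    (fun _ _ _ _ _ _ _ => erefl).

Definition to_chaotic (C : category) (a : C -> T) : functor C chaotic :=
  @Functor C chaotic a (fun _ _ _ => tt) (fun=> erefl) (fun _ _ _ _ _ => erefl).

Lemma to_chaotic_eq (C : category) (F G : functor C chaotic) :
  (forall x, F x = G x :> T) -> F = G.
Proof.
move=> e; apply: functor_ext => // a b f.
by case: (fmap F f); case: (fmap G f).
Qed.
End Chaotic.

(** * Gluing cocycles along the pushout *)

Section Pushout.
Variables (C0 C1 C2 C : category) (F1 : functor C0 C1) (F2 : functor C0 C2).
Variables (I1 : functor C1 C) (I2 : functor C2 C) (I0 : functor C0 C).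
Hypotheses (e1 : I0 = fcomp I1 F1) (e2 : I0 = fcomp I2 F2).
Hypothesis po : is_pushout F1 F2 I1 I2.

(* Functors to a chaotic category are mere functions on objects. *)
Lemma pushout_ob (x : C) : (exists d, I1 d = x) \/ (exists d, I2 d = x).
Proof.
apply: contrapT => /not_orP [n1 n2].
pose a (y : C) := `[< y <> x >].
have a1 d : a (I1 d) by apply/asboolP => dx; apply: n1; exists d.
have a2 d : a (I2 d) by apply/asboolP => dx; apply: n2; exists d.
have [] := po.2 (chaotic bool) (to_chaotic (fun=> true))
  (to_chaotic (fun=> true)).
  exact: to_chaotic_eq.
move=> G [_ uG].
have GE (b : C -> bool) : (forall d, b (I1 d)) -> (forall d, b (I2 d)) ->
    G = to_chaotic b.
  by move=> b1 b2; apply: uG; split; exact: to_chaotic_eq.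
have Gx : G x = true :> bool by rewrite (GE (fun=> true)).
move: Gx; rewrite (GE a) //= => /asboolP; exact.
Qed.

Section Twistings.
Variables (c : C) (T : Type) (B : zmodType).
Variables (t1 : twisting c T B I1) (t2 : twisting c T B I2).

(** Existence in the universal property, for the target [twist_cat], gives a functor G out of C.
    Uniqueness, for the target C itself, shows that G is a section of [twist_forget]: both the
    composite and the identity restrict to I1 and I2. *)
Lemma pushout_twisting :
  (forall x (p1 : I0 x = I1 (F1 x)) (p2 : I0 x = I2 (F2 x)) h,
    tw_ob t1 (ceq p1 \oc h) = tw_ob t2 (ceq p2 \oc h)) ->
  (forall x y (f : hom x y) (p1 : I0 x = I1 (F1 x)) (p2 : I0 x = I2 (F2 x)) h,
    tw_hom t1 (fmap F1 f) (ceq p1 \oc h) =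
      tw_hom t2 (fmap F2 f) (ceq p2 \oc h)) ->
  exists t : twisting c T B (fid C),
    [/\ forall d h, tw_ob t (d := I1 d) h = tw_ob t1 h,
        forall d h, tw_ob t (d := I2 d) h = tw_ob t2 h,
        forall d d' (f : hom d d') h, tw_hom t (fmap I1 f) h = tw_hom t1 f h
      & forall d d' (f : hom d d') h, tw_hom t (fmap I2 f) h = tw_hom t2 f h].
Proof.
move=> ob12 hom12.
have [] := po.2 _ (twist_lift t1) (twist_lift t2).
  rewrite !twist_lift_comp; apply: twist_lift_eq; first exact: po.1.
    move=> x p h /=.
    have p1 : I0 x = I1 (F1 x) by exact: (ob_eq e1).
    have p2 : I0 x = I2 (F2 x) by exact: (ob_eq e2).
    rewrite -[h in LHS]comp1f -(ceqKV p1) -Defs.compA (ob12 x p1 p2).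
    by rewrite Defs.compA (ceq_comp _ _ p).
  move=> x y f p h /=.
  have p1 : I0 x = I1 (F1 x) by exact: (ob_eq e1).
  have p2 : I0 x = I2 (F2 x) by exact: (ob_eq e2).
  rewrite -[h in LHS]comp1f -(ceqKV p1) -Defs.compA (hom12 x y f p1 p2).
  by rewrite Defs.compA (ceq_comp _ _ p).
move=> G [[G1 G2] _].
have GI : fcomp (twist_forget c T B) G = fid C.
  have [] := po.2 C I1 I2 po.1; move=> H [_ uH].
  rewrite -(uH (fid C)); last by split; exact: functor_ext.
  by apply/esym/uH; rewrite -!fcompA G1 G2 !twist_lift_forget.
have E1 : fcomp (twist_forget c T B) (fcomp G I1) =
  I1 by rewrite G1 twist_lift_forget.
have E2 : fcomp (twist_forget c T B) (fcomp G I2) =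
  I2 by rewrite G2 twist_lift_forget.
have eqI1 d : ob_eq GI (I1 d) = ob_eq E1 d by exact: Prop_irrelevance.
have eqI2 d : ob_eq GI (I2 d) = ob_eq E2 d by exact: Prop_irrelevance.
exists (untwist GI); rewrite -(untwistP E1 G1) -(untwistP E2 G2).
by split=> *; rewrite /= ?eqI1 ?eqI2.
Qed.
End Twistings.

(** Exactness in the middle of the row of 0-cocycles: the data are glued as twistings whose
    1-cocycle is 0. *)
Lemma pushout_invariant (c : C) (T : Type)
    (b1 : forall d, hom c (I1 d) -> T) (b2 : forall d, hom c (I2 d) -> T) :
  invariant_on b1 -> invariant_on b2 ->
  (forall x (p1 : I0 x = I1 (F1 x)) (p2 : I0 x = I2 (F2 x)) h,
    b1 (F1 x) (ceq p1 \oc h) = b2 (F2 x) (ceq p2 \oc h)) ->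
  exists a : forall x, hom c (fid C x) -> T,
    [/\ invariant_on a, forall d h, a (I1 d) h = b1 d h
      & forall d h, a (I2 d) h = b2 d h].
Proof.
move=> i1 i2 b12.
pose t D (I : functor D C) (b : forall d, hom c (I d) -> T)
  (i : invariant_on b) :=
  @Twisting C c T int D I b (fun _ _ _ _ => 0) i
    (fun _ _ _ _ _ _ => esym (addr0 0)).
have [|//|u [u1 u2 _ _]] := @pushout_twisting c T int (t _ _ _ i1) (t _ _ _ i2).
  by [].
by exists (@tw_ob _ _ _ _ _ _ u); split=> //; exact: tw_obE.
Qed.
(* Extend e by zero along F2 to a 0-cochain psi on C2.  The twisting of I2 by its
   coboundary agrees on C0 with the trivial twisting of I1, so both come from a
   1-cocycle t on C, and t is the coboundary of th : h |-> t h (idc c). *)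
Lemma pushout_difference (c : C) (B : zmodType)
    (e : forall x, hom c (I0 x) -> B) :
  injective (fob F2) -> invariant_on e ->
  exists (g1 : forall d, hom c (I1 d) -> B) (g2 : forall d, hom c (I2 d) -> B),
    [/\ invariant_on g1, invariant_on g2
      & forall x (p1 : I0 x = I1 (F1 x)) (p2 : I0 x = I2 (F2 x)) h,
        e x h = g1 (F1 x) (ceq p1 \oc h) - g2 (F2 x) (ceq p2 \oc h)].
Proof.
move=> inj ie.
pose psi (y : C2) (h : hom c (I2 y)) : B :=
  if pselect (exists x, F2 x = y) is left w then
    e (projT1 (cid w)) (ceq (etrans (congr1 I2 (esym (projT2 (cid w))))
      (esym (ob_eq e2 (projT1 (cid w))))) \oc h) else 0.
have psiE x (p : I0 x = I2 (F2 x)) h : psi (F2 x) (ceq p \oc h) = e x h.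
  rewrite /psi; case: pselect => [w|[]]; last by exists x.
  move: (etrans _ _); case: (cid w) => x' /= /inj xx'; subst x' => q.
  by rewrite Defs.compA (Prop_irrelevance q (esym p)) ceqK comp1f.
pose t1 : twisting c unit B I1 := @Twisting C c unit B _ I1 (fun _ _ => tt)
  (fun _ _ _ _ => 0) (fun _ _ _ _ => erefl) (fun _ _ _ _ _ _ => esym (addr0 0)).
have psiM a b d (g : hom b d) (f : hom a b) (h : hom c (I2 a)) :
    psi d (fmap I2 (g \oc f) \oc h) - psi a h =
    (psi b (fmap I2 f \oc h) - psi a h) +
    (psi d (fmap I2 g \oc (fmap I2 f \oc h)) - psi b (fmap I2 f \oc h)).
  by rewrite [RHS]addrC addrA subrK fmapM -Defs.compA.
pose t2 : twisting c unit B I2 := @Twisting C c unit B _ I2 (fun _ _ => tt)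
  (fun a b f h => psi b (fmap I2 f \oc h) - psi a h)
    (fun _ _ _ _ => erefl) psiM.
have [//||t [_ _ h1 h2]] := pushout_twisting (t1 := t1) (t2 := t2).
  move=> x y f p1 p2 h /=; apply/esym/eqP; rewrite subr_eq0; apply/eqP.
  have q := ob_eq e2 y.
  rewrite Defs.compA -[fmap I2 (fmap F2 f)]/(fmap (fcomp I2 F2) f).
  by rewrite (ceq_nat e2 f p2 q) -Defs.compA !psiE ie.
pose th x (h : hom c x) : B := tw_hom t h (idc c).
have thE x y (f : hom x y) (h : hom c x) : th y (f \oc h) =
  th x h + tw_hom t f h.
  by rewrite /th tw_homM /= compf1.
(* On C1 the cocycle t vanishes, so th is invariant there; on C2 the cochains th and psi have the
   same coboundary. On C0 the difference is psi, that is, e. *)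
exists (fun d h => th (I1 d) h), (fun d h => th (I2 d) h - psi d h); split.
- by move=> d d' f h; rewrite thE h1 addr0.
- by move=> d d' f h; rewrite thE h2 /= [_ - psi d h]addrC addrA addrK.
- move=> x p1 p2 h; rewrite !(invariant_on_ceq th) psiE.
  by rewrite subKr.
Qed.
End Pushout.

Lemma pushout_sym (C0 C1 C2 C : category)
    (F1 : functor C0 C1) (F2 : functor C0 C2)
    (I1 : functor C1 C) (I2 : functor C2 C) :
  is_pushout F1 F2 I1 I2 -> is_pushout F2 F1 I2 I1.
Proof.
move=> po; split=> [|E G2 G1 /esym e]; first exact/esym/po.1.
have [G [[h1 h2] u]] := po.2 _ _ _ e.
by exists G; split=> // H [? ?]; exact: u.
Qed.

Lemma pushout_difference_sym (C0 C1 C2 C : category)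
    (F1 : functor C0 C1) (F2 : functor C0 C2)
    (I1 : functor C1 C) (I2 : functor C2 C) (I0 : functor C0 C)
    (e1 : I0 = fcomp I1 F1) (e2 : I0 = fcomp I2 F2)
    (c : C) (B : zmodType) (e : forall x, hom c (I0 x) -> B) :
  is_pushout F1 F2 I1 I2 ->
  injective (fob F1) \/ injective (fob F2) -> invariant_on e ->
  exists (g1 : forall d, hom c (I1 d) -> B) (g2 : forall d, hom c (I2 d) -> B),
    [/\ invariant_on g1, invariant_on g2
      & forall x (p1 : I0 x = I1 (F1 x)) (p2 : I0 x = I2 (F2 x)) h,
        e x h = g1 (F1 x) (ceq p1 \oc h) - g2 (F2 x) (ceq p2 \oc h)].
Proof.
move=> po [] inj ie; last exact: (pushout_difference e1 e2 po inj ie).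
have ine : invariant_on (fun x h => - e x h) by move=> d d' f h; rewrite ie.
have [g2 [g1 [i2 i1 g12]]] := pushout_difference e2 e1 (pushout_sym po) inj ine.
exists g1, g2; split=> // x p1 p2 h.
by rewrite -[LHS]opprK (g12 x p2 p1) opprB.
Qed.

(** * Acyclicity of the total complex *)

(* All degrees are treated simultaneously, so that the total complex needs no
   degree shift; the coboundary is 0 in degree 0. *)
Definition gcob (B : zmodType) (K : sset) (z : forall n, K n -> B) n :
  K n -> B :=
  match n with
  | 0 => fun=> 0
  | m.+1 => scob (z m)
  end.

Lemma gcob_scob (B : zmodType) (K : sset) (z : forall n, K n -> B) n x :
  scob (gcob z (n := n)) x = 0.
Proof. by case: n x => [|n] x; [exact: scob0|exact: scob_scob]. Qed.

Lemma coh_discrete_family (B : zmodType) (K : sset) (z : forall n, K n -> B) :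
  coh_discrete K -> (forall n x, scob (z n) x = 0) ->
  exists w : forall n, K n -> B, forall n x, z n.+1 x = scob (w n) x.
Proof.
move=> Kd z0.
have H n : exists w : K n -> B, forall x, z n.+1 x = scob w x.
  by have [w wE] := Kd B n _ (z0 n.+1); exists w => x; rewrite -wE subr0.
exact: (dependent_choice_fun H).
Qed.

Section Chase.
Variables (B : zmodType) (K K1 K2 K0 : sset).
Variables (p1 : smap K1 K) (p2 : smap K2 K) (r1 : smap K0 K1) (r2 : smap K0 K2).
Hypothesis pr : forall n x, p1 n (r1 n x) = p2 n (r2 n x).
Hypotheses (Kd : coh_discrete K) (K1d : coh_discrete K1).
Hypotheses (K2d : coh_discrete K2) (K0d : coh_discrete K0).
Hypothesis H0_left : forall a : K 0 -> B, (forall x, scob a x = 0) ->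
  (forall x, a (p1 0 x) = 0) -> (forall x, a (p2 0 x) = 0) -> forall x, a x = 0.
Hypothesis H0_middle : forall (b1 : K1 0 -> B) (b2 : K2 0 -> B),
  (forall x, scob b1 x = 0) -> (forall x, scob b2 x = 0) ->
  (forall x, b1 (r1 0 x) = b2 (r2 0 x)) ->
  exists a : K 0 -> B, [/\ forall x, scob a x = 0,
    forall x, a (p1 0 x) = b1 x & forall x, a (p2 0 x) = b2 x].
Hypothesis H0_right : forall e : K0 0 -> B, (forall x, scob e x = 0) ->
  exists (b1 : K1 0 -> B) (b2 : K2 0 -> B),
    [/\ forall x, scob b1 x = 0, forall x, scob b2 x = 0
      & forall x, e x = b1 (r1 0 x) - b2 (r2 0 x)].

(* The total complex of a double complex whose columns are exact in positive
   degrees and whose row of 0-cocycles is exact is acyclic. *)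
Lemma chase (a : forall n, K n -> B) (b1 : forall n, K1 n -> B)
    (b2 : forall n, K2 n -> B) (e : forall n, K0 n -> B) :
  (forall n x, scob (a n) x = 0) ->
  (forall n x, a n (p1 n x) = gcob b1 x) ->
  (forall n x, a n (p2 n x) = gcob b2 x) ->
  (forall n x, b1 n (r1 n x) - b2 n (r2 n x) + gcob e x = 0) ->
  exists (a' : forall n, K n -> B) (b1' : forall n, K1 n -> B)
      (b2' : forall n, K2 n -> B) (e' : forall n, K0 n -> B),
    [/\ forall n x, a n x = gcob a' x,
        forall n x, b1 n x = a' n (p1 n x) - gcob b1' x,
        forall n x, b2 n x = a' n (p2 n x) - gcob b2' x
      & forall n x, e n x = b1' n (r1 n x) - b2' n (r2 n x) + gcob e' x].
Proof.
move=> a0 ab1 ab2 be.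
have [u uE] := coh_discrete_family Kd a0.
have {}uE n x : a n x = gcob u x.
  case: n x => [|n] x; last exact: uE.
  by apply: H0_left => // y; rewrite ?ab1 ?ab2.
pose c1 n (x : K1 n) := u n (p1 n x) - b1 n x.
pose c2 n (x : K2 n) := u n (p2 n x) - b2 n x.
have c10 n x : scob (@c1 n) x = 0.
  by rewrite scobB scob_smap -[X in X - _](uE n.+1) ab1 subrr.
have c20 n x : scob (@c2 n) x = 0.
  by rewrite scobB scob_smap -[X in X - _](uE n.+1) ab2 subrr.
have [v1 v1E] := coh_discrete_family K1d c10.
have [v2 v2E] := coh_discrete_family K2d c20.
(* In degree 0 the cocycles c1 and c2 need not vanish. They agree on K0, hence come from a 0-cocycle
   al of K, and subtracting al from u does not change its coboundary. *)
have [|al [al0 al1 al2]] := H0_middle (c10 0%N) (c20 0%N).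
  move=> x; rewrite /c1 /c2 pr; congr (_ - _); apply/eqP.
  by have := be 0%N x; rewrite addr0 => /eqP; rewrite subr_eq0.
pose a' n : K n -> B :=
  match n with 0 => fun x => u 0%N x - al x | m.+1 => u m.+1 end.
have a'1 n x : b1 n x = a' n (p1 n x) - gcob v1 x.
  case: n x => [|n] x /=; first by rewrite al1 /c1 subr0 subKr.
  by rewrite -v1E /c1 subKr.
have a'2 n x : b2 n x = a' n (p2 n x) - gcob v2 x.
  case: n x => [|n] x /=; first by rewrite al2 /c2 subr0 subKr.
  by rewrite -v2E /c2 subKr.
pose f n (x : K0 n) := e n x - (v1 n (r1 n x) - v2 n (r2 n x)).
have f0 n x : scob (@f n) x = 0.
  have := be n.+1 x; rewrite a'1 a'2 /= pr /f scobB scobB !scob_smap => h.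
  rewrite -[RHS]h [RHS]addrC; congr (_ + _).
  by rewrite opprB [in RHS]opprB [RHS]addrC addrA subrK.
have [w wE] := coh_discrete_family K0d f0.
(* The remainder f in degree 0 is a difference of 0-cocycles; adding these to v1 and v2 leaves the
   coboundaries unchanged. *)
have [g1 [g2 [g10 g20 gE]]] := H0_right (f0 0%N).
pose z1 n : K1 n -> B :=
  match n with 0 => fun x => v1 0%N x + g1 x | m.+1 => v1 m.+1 end.
pose z2 n : K2 n -> B :=
  match n with 0 => fun x => v2 0%N x + g2 x | m.+1 => v2 m.+1 end.
have z1E n (x : K1 n) : gcob z1 x = gcob v1 x.
  by case: n x => [|[|n]] x //=; rewrite scobD g10 addr0.
have z2E n (x : K2 n) : gcob z2 x = gcob v2 x.
  by case: n x => [|[|n]] x //=; rewrite scobD g20 addr0.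
exists a', z1, z2, w; split=> n x.
- rewrite uE; case: n x => [|[|n]] x //=.
  by rewrite scobB al0 subr0.
- by rewrite z1E.
- by rewrite z2E.
- case: n x => [|n] x /=; last by rewrite -wE /f addrC subrK.
  by rewrite addr0 opprD addrACA -gE /f addrC subrK.
Qed.
End Chase.

(** * Simplices and 0-cocycles of under categories *)

Section Cone.
Variables (C D : category) (I : functor D C) (c : C).

Definition under_forget : functor (under I c) D :=
  @Functor (under I c) D (fun x => projT1 x) (fun x y g => sval g)
    (fun=> erefl) (fun _ _ _ _ _ => erefl).

Section ConeDef.
Variables (n : nat) (s : functor (ordcat n) D) (h : hom c (I (s ord0))).

Definition from_first (j : ordcat n) : hom (s ord0) (s j) :=
  fmap s (leq0n j : @hom (ordcat n) ord0 j).

Definition cone_ob (j : ordcat n) : under I c :=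
  existT _ (s j) (fmap I (from_first j) \oc h).

Lemma cone_hom_subproof (i j : ordcat n) (ij : hom i j) :
  fmap I (fmap s ij) \oc (fmap I (from_first i) \oc h) =
  fmap I (from_first j) \oc h.
Proof.
rewrite Defs.compA -fmapM -fmapM; congr (fmap I (fmap s _) \oc h).
exact: bool_irrelevance.
Qed.

Definition cone_hom (i j : ordcat n) (ij : hom i j) :
  hom (cone_ob i) (cone_ob j) :=
  exist _ (fmap s ij) (cone_hom_subproof ij).

Lemma cone1 i : cone_hom (idc i) = idc (cone_ob i).
Proof. by apply: under_hom_ext; exact: fmap1. Qed.

Lemma coneM i j k (g : @hom (ordcat n) j k) (f : hom i j) :
  cone_hom (g \oc f) = cone_hom g \oc cone_hom f.
Proof. by apply: under_hom_ext; exact: fmapM. Qed.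

Definition cone : functor (ordcat n) (under I c) := Functor cone1 coneM.

Lemma from_first0 : from_first ord0 = idc (s ord0).
Proof. by rewrite -fmap1; congr fmap; exact: bool_irrelevance. Qed.

Lemma cone_first : projT2 (cone ord0) = h.
Proof. by rewrite /= from_first0 fmap1 comp1f. Qed.

Lemma cone_forget : fcomp under_forget cone = s.
Proof. exact: functor_ext. Qed.
End ConeDef.


(** Every leg c -> I (s j) is the first leg followed by the image of s 0 -> s j. The first legs have
    different types before s and t are identified, hence [JMeq]. *)
Lemma under_simplex_ext n (s t : functor (ordcat n) (under I c)) :
  fcomp under_forget s = fcomp under_forget t ->
  JMeq (projT2 (s ord0)) (projT2 (t ord0)) -> s = t.
Proof.
move=> st h0.
have st_ob j : projT1 (s j) = projT1 (t j) by exact: (ob_eq st).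
have S j : projT2 (s j) =
  fmap I (sval (fmap s (leq0n j : @hom (ordcat n) ord0 j))) \oc projT2 (s ord0).
  exact/esym/(svalP (fmap s _)).
have T j : projT2 (t j) =
  fmap I (sval (fmap t (leq0n j : @hom (ordcat n) ord0 j))) \oc projT2 (t ord0).
  exact/esym/(svalP (fmap t _)).
have E (u v : functor (ordcat n) D) j (h : hom c (I (u ord0)))
  (h' : hom c (I (v ord0))) :
   u = v -> JMeq h h' ->
     existT (fun d => hom c (I d)) (u j) (fmap I (from_first u j) \oc h) =
     existT _ (v j) (fmap I (from_first v j) \oc h').
  by move=> uv; subst v => hh; rewrite (JMeq_eq hh).
have eta (x : under I c) : x = existT _ (projT1 x) (projT2 x) by case: x.
have ob j : s j = t j.
  rewrite (eta (s j)) (eta (t j)) S T.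
  exact: (E (fcomp under_forget s) (fcomp under_forget t)).
apply: functor_ext => // i j ij.
have H (x y x' y' : under I c) (f : hom x y) (g : hom x' y') :
   x = x' -> y = y' -> JMeq (sval f) (sval g) -> JMeq f g.
  by move=> xx yy; case: _ / xx g => g; case: _ / yy g => g fg;
    rewrite (under_hom_ext (JMeq_eq fg)).
apply: H => //.
have K (u v : functor (ordcat n) D) : u =
  v -> JMeq (fmap u ij) (fmap v ij) by move=> ->.
exact: (K _ _ st).
Qed.

Lemma cone_eta n (s : functor (ordcat n) (under I c)) :
  cone (s := fcomp under_forget s) (projT2 (s ord0)) = s.
Proof.
apply: under_simplex_ext; first exact: functor_ext.
by rewrite cone_first.
Qed.
End Cone.

Section Invariants.
Variables (U : category) (B : zmodType).

Definition point (x : U) : nerve U 0 :=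
  @Functor (ordcat 0) U (fun=> x) (fun _ _ _ => idc x)
    (fun=> erefl) (fun _ _ _ _ _ => esym (comp1f (idc x))).

Lemma pointE (s : nerve U 0) : s = point (fob s ord0).
Proof.
apply: functor_ext => [i|i j ij]; first by rewrite (ord1 i).
move: ij; rewrite (ord1 i) (ord1 j) => ij /=.
by rewrite -fmap1 (bool_irrelevance ij (idc (ord0 : ordcat 0))).
Qed.

Section Edge.
Variables (x y : U) (f : hom x y).

Definition edge_ob (i : ordcat 1) : U := if val i == 0%N then x else y.

Definition edge_hom (i j : ordcat 1) (ij : hom i j) :
  hom (edge_ob i) (edge_ob j) :=
  match val i == 0%N as b, val j == 0%N as b' return
    (b' ==> b) -> hom (if b then x else y) (if b' then x else y)
  with
  | true, true => fun=> idc x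
  | true, false => fun=> f
  | false, true => fun ff => match Bool.diff_false_true ff with end
  | false, false => fun=> idc y
  end (introT implyP (fun j0 : val j == 0%N =>
    (eq_ind _ (fun k => (i <= k)%N -> val i == 0%N)
      (fun h => etrans (esym (leqn0 i)) h) _ (esym (eqP j0)) ij))).

Lemma edge1 i : edge_hom (idc i) = idc (edge_ob i).
Proof. by rewrite /edge_hom /edge_ob; move: (introT _ _); case: eqP. Qed.

Lemma edgeM i j k (g : @hom (ordcat 1) j k) (h : hom i j) :
  edge_hom (g \oc h) = edge_hom g \oc edge_hom h.
Proof.
rewrite /edge_hom /edge_ob; do 3![move: (introT _ _)].
by case: (val i == 0%N); case: (val j == 0%N); case: (val k == 0%N) => //= *;
  rewrite ?comp1f ?compf1.
Qed.

Definition edge : nerve U 1 := Functor edge1 edgeM.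
End Edge.

Lemma scob_point (z : nerve U 0 -> B) x y (f : hom x y) :
  (forall s, scob z s = 0) -> z (point x) = z (point y).
Proof.
move=> /(_ (edge f)).
have E (i : 'I_2) : z (face i (edge f)) =
  z (point (edge_ob x y (coface i ord0))).
  by congr z; exact: pointE.
rewrite /scob (eq_bigr _ (fun i _ => congr1 (fun b => b *~ _) (E i))).
rewrite 2!big_ord_recr big_ord0 /= add0r mulr1z expr1 mulrN1z.
by move=> /eqP; rewrite subr_eq0 => /eqP ->.
Qed.

Lemma invariant_scob (a : U -> B) : (forall x y, hom x y -> a x = a y) ->
  forall s, scob (fun s : nerve U 0 => a (fob s ord0)) s = 0.
Proof.
move=> ai s; rewrite /scob 2!big_ord_recr big_ord0 /= add0r.
rewrite mulr1z expr1 mulrN1z; apply/eqP; rewrite subr_eq0; apply/eqP.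
set i := fintype.lift _ _; set j := fintype.lift _ _.
have ji : (j <= i)%N by [].
exact/esym/(ai _ _ (fmap s (ji : @hom (ordcat 1) j i))).
Qed.
End Invariants.

Lemma ractM (C : category) (L : right_module C) (a b c : C) (g : hom b c)
    (f : hom a b) x : ract L f (ract L g x) = ract L (g \oc f) x.
Proof. by rewrite /ract -mactM. Qed.

Lemma ract1 (C : category) (L : right_module C) (a : C) x :
  ract L (idc a) x = x.
Proof. exact: mact1. Qed.

Lemma ract_nat (C : category) (L L' : right_module C) (t : nattrans L L')
    (a b : C) (f : hom a b) x : t a (ract L f x) = ract L' f (t b x).
Proof. exact: nt_nat. Qed.

(** * Cochains of categories with module coefficients *)

Section Cochains.
Variables (C D : category) (I : functor D C).

(* An n-cochain with values in I^* L assigns to d_0 -> ... -> d_n an element of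
   L (I d_0); by the Yoneda lemma these are the natural transformations from
   ZN(-/D)_n to I^* L, see [to_coch]. *)
Definition cochain (L : right_module C) : Type :=
  forall n (s : functor (ordcat n) D), L (I (s ord0)).

(** Only the face i = 0 moves the first vertex. For i > 0 the action is that of an identity, but the
    uniform formula avoids a change of type. *)
Definition coface_restr (L : right_module C) n (i : 'I_n.+2)
    (a : forall s : functor (ordcat n) D, L (I (s ord0)))
    (s : functor (ordcat n.+1) D) : L (I (s ord0)) :=
  ract L (fmap I (from_first s (coface i ord0)))
    (a (fcomp s (ordfunctor (coface i)))).

Definition dco (L : right_module C) n
    (a : forall s : functor (ordcat n) D, L (I (s ord0)))
    (s : functor (ordcat n.+1) D) : L (I (s ord0)) :=
  \sum_(i < n.+2) coface_restr i a s *~ (-1) ^+ i.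

Definition gdco (L : right_module C) (a : cochain L) : cochain L :=
  fun n => match n with
  | 0 => fun=> 0
  | m.+1 => dco (a m)
  end.

Lemma eq_gdco (L : right_module C) (a b : cochain L) n s :
  (forall m s', (m < n)%N -> a m s' = b m s') -> gdco a (n := n) s = gdco b s.
Proof.
case: n s => [//|n] s ab /=; apply: eq_bigr => i _.
by rewrite /coface_restr ab.
Qed.

Lemma gdco_nat (L L' : right_module C) (t : nattrans L L') (a : cochain L) n s :
  t _ (gdco a (n := n) s) = gdco (fun n s => t _ (a n s)) s.
Proof.
case: n s => [|n] s /=; first exact: raddf0.
rewrite raddf_sum; apply: eq_bigr => i _.
by rewrite raddfMz /coface_restr ract_nat.
Qed.

Lemma gdcoB (L : right_module C) (a b : cochain L) n s :
  gdco (fun n s => a n s - b n s) (n := n) s = gdco a s - gdco b s.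
Proof.
case: n s => [|n] s /=; first by rewrite subr0.
rewrite -sumrB; apply: eq_bigr => i _.
by rewrite /coface_restr raddfB mulrzBl.
Qed.
End Cochains.

Section Pull.
Variables (C D D' : category) (I : functor D C) (F : functor D' D).
Variables (I' : functor D' C) (e : I' = fcomp I F).

Definition pull (L : right_module C) (a : cochain I L) : cochain I' L :=
  fun n s => ract L (ceq (ob_eq e (s ord0))) (a n (fcomp F s)).

Lemma pull_nat (L L' : right_module C) (t : nattrans L L')
  (a : cochain I L) n s :
  t _ (pull a (n := n) s) = pull (fun n s => t _ (a n s)) s.
Proof. exact: ract_nat. Qed.

Lemma pullB (L : right_module C) (a b : cochain I L) n s :
  pull (fun n s => a n s - b n s) (n := n) s = pull a s - pull b s.
Proof. exact: raddfB. Qed.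

Section UnderMap.
Variable c : C.

Definition under_map_ob (x : under I' c) : under I c :=
  existT (fun d => hom c (I d)) (F (projT1 x))
    (ceq (ob_eq e (projT1 x)) \oc projT2 x).

Lemma under_map_subproof (x y : under I' c) (g : hom x y) :
  fmap I (fmap F (sval g)) \oc (ceq (ob_eq e (projT1 x)) \oc projT2 x) =
  ceq (ob_eq e (projT1 y)) \oc projT2 y.
Proof.
transitivity (ceq (ob_eq e (projT1 y)) \oc (fmap I' (sval g) \oc projT2 x)).
  rewrite !Defs.compA; congr (_ \oc _); exact: (ceq_nat e (sval g)).
by rewrite (svalP g).
Qed.

Definition under_map_hom (x y : under I' c) (g : hom x y) :
    hom (under_map_ob x) (under_map_ob y) :=
  exist _ (fmap F (sval g)) (under_map_subproof g).

Lemma under_map1 x : under_map_hom (idc x) = idc (under_map_ob x).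
Proof. by apply: under_hom_ext; exact: fmap1. Qed.

Lemma under_mapM (x y z : under I' c) (g : hom y z) (h : hom x y) :
  under_map_hom (g \oc h) = under_map_hom g \oc under_map_hom h.
Proof. by apply: under_hom_ext; exact: fmapM. Qed.

Definition under_map : functor (under I' c) (under I c) :=
  Functor under_map1 under_mapM.
End UnderMap.
End Pull.

(** * Coinduced modules and cokernels *)

Section Coinduced.
Variables (C : category) (B : C -> zmodType).

(** The product over all c of the modules Map(Hom(c, -), B c). Taking all c at once makes room for
    an embedding of every L, with B = L. *)
Definition coind_ob (x : C) : Type := forall c, hom c x -> B c.

Section Zmodule.
Variable x : C.
Implicit Types a b : coind_ob x.

HB.instance Definition _ := gen_eqMixin (coind_ob x).
HB.instance Definition _ := gen_choiceMixin (coind_ob x).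

Lemma coind_ext a b : (forall c h, a c h = b c h) -> a = b.
Proof.
move=> ab; apply: functional_extensionality_dep => c; apply: funext => h;
  exact: ab.
Qed.

Definition coind0 : coind_ob x := fun c h => 0.
Definition coindN a : coind_ob x := fun c h => - a c h.
Definition coindD a b : coind_ob x := fun c h => a c h + b c h.

Lemma coindDA : associative coindD.
Proof. by move=> a b d; apply: coind_ext => c h; exact: addrA. Qed.

Lemma coindDC : commutative coindD.
Proof. by move=> a b; apply: coind_ext => c h; exact: addrC. Qed.

Lemma coind0D : left_id coind0 coindD.
Proof. by move=> a; apply: coind_ext => c h; exact: add0r. Qed.

Lemma coindND : left_inverse coind0 coindN coindD.
Proof. by move=> a; apply: coind_ext => c h; exact: addNr. Qed.

HB.instance Definition _ :=
  GRing.isZmodule.Build (coind_ob x) coindDA coindDC coind0D coindND.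

Lemma coind_eval_additive c (h : hom c x) :
  zmod_morphism (fun a : coind_ob x => a c h).
Proof. by []. Qed.

Definition coind_eval c (h : hom c x) : {additive coind_ob x -> B c} :=
  HB.pack (fun a : coind_ob x => a c h)
    (GRing.isZmodMorphism.Build _ _ _ (coind_eval_additive h)).
End Zmodule.

Lemma coind_pre_additive x y (f : hom x y) :
  zmod_morphism (fun (a : coind_ob y) => (fun c h => a c (f \oc h)) :
    coind_ob x).
Proof. by []. Qed.

Definition coind_pre x y (f : hom x y) : {additive coind_ob y -> coind_ob x} :=
  HB.pack (fun (a : coind_ob y) => (fun c h => a c (f \oc h)) : coind_ob x)
    (GRing.isZmodMorphism.Build _ _ _ (@coind_pre_additive x y f)).

Lemma coind_act1 x (a : coind_ob x) : coind_pre (idc x) a = a.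
Proof. by apply: coind_ext => c h; rewrite /= comp1f. Qed.

Lemma coind_actM x y z (g : hom y z) (f : hom x y) (a : coind_ob z) :
  coind_pre (g \oc f) a = coind_pre f (coind_pre g a).
Proof. by apply: coind_ext => c h; rewrite /= Defs.compA. Qed.

Definition coind : right_module C :=
  @Cmodule (opcat C) (fun x => coind_ob x : zmodType)
    (fun a b (f : @hom C b a) => coind_pre f)
    coind_act1 (fun a b c (g : @hom C c b) (f : @hom C b a) => @coind_actM c
      b a f g).
End Coinduced.

(* A cochain of D with values in I^* (coind B) is the same as a family, indexed
   by c, of cochains of N(c/I) with values in B c. *)
Section CoindEval.
Variables (C : category) (B : C -> zmodType) (c : C).

Definition ev (D : category) (I : functor D C) (a : cochain I (coind B)) n
    (s : nerve (under I c) n) : B c :=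
  a n (fcomp (under_forget I c) s) c (projT2 (fob s ord0)).

Section Eval.
Variables (D : category) (I : functor D C).

Lemma ev_eq (a : cochain I (coind B)) n (s t : functor (ordcat n) D)
    (h : hom c (I (s ord0))) (k : hom c (I (t ord0))) :
  s = t -> JMeq h k -> a n s c h = a n t c k.
Proof. by move=> st; subst t => hk; rewrite (JMeq_eq hk). Qed.

Lemma ev_cone (a : cochain I (coind B)) n (s : functor (ordcat n) D)
    (h : hom c (I (s ord0))) : ev a (n := n) (cone h) = a n s c h.
Proof.
have E : JMeq (projT2 (cone h ord0)) h by rewrite cone_first.
exact: (ev_eq a (cone_forget h) E).
Qed.

Lemma ev_gdco (a : cochain I (coind B)) n s : ev (gdco a) (n := n) s =
  gcob (ev a) s.
Proof.
case: n s => [//|n] s; rewrite /ev /= /dco -[LHS]/(coind_eval _ _ _) raddf_sum.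
apply: eq_bigr => i _; rewrite raddfMz; congr (_ *~ _).
set f := @fmap _ _ s ord0 _ (leq0n (coface i ord0)).
have E : fcomp (fcomp (under_forget I c) s) (ordfunctor (coface i)) =
  fcomp (under_forget I c) (face (K := nerve (under I c)) i s) by exact:
    functor_ext.
by apply: (ev_eq a E); rewrite -(svalP f).
Qed.
End Eval.

Lemma ev_pull (D D' : category) (I : functor D C) (F : functor D' D)
    (I' : functor D' C) (e : I' = fcomp I F) (a : cochain I (coind B)) n s :
  ev (pull e a) (n := n) s = ev a (nerve_map (under_map e c) n s).
Proof.
have E : fcomp F (fcomp (under_forget I' c) s) =
  fcomp (under_forget I c) (nerve_map (under_map e c) n s) by exact:
    functor_ext.
exact: (ev_eq a E).
Qed.
End CoindEval.

Section Cokernel.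
Variables (C : category) (L J : cmodule C) (t : nattrans L J).

Lemma coker_act_subproof (a b : C) (f : hom a b) x :
  Defs.image (t a) x -> (quotient_pi (Defs.image (t b)) \o mact J f) x = 0.
Proof.
move=> [y ->]; rewrite -(raddf0 (quotient_pi (Defs.image (t b)))).
by apply/quotient_eq; rewrite subr0; exists (mact L f y); exact/esym/nt_nat.
Qed.

Definition coker_act (a b : C) (f : hom a b) :
    {additive quotient (Defs.image (t a)) -> quotient (Defs.image (t b))} :=
  quotient_lift (coker_act_subproof f).

Lemma coker_actE (a b : C) (f : hom a b) x :
  coker_act f (quotient_pi _ x) = quotient_pi _ (mact J f x).
Proof. exact: quotient_liftE. Qed.

Lemma coker_act1 a x : coker_act (idc a) x = x.
Proof. by have [y <-] := quotient_piP x; rewrite coker_actE mact1. Qed.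

Lemma coker_actM a b c (g : hom b c) (f : hom a b) x :
  coker_act (g \oc f) x = coker_act g (coker_act f x).
Proof. by have [y <-] := quotient_piP x; rewrite !coker_actE mactM. Qed.

Definition coker : cmodule C := Cmodule coker_act1 coker_actM.

Lemma coker_pi_nat a b (f : hom a b) x :
  quotient_pi (Defs.image (t b)) (mact J f x) =
    coker_act f (quotient_pi (Defs.image (t a)) x).
Proof. by rewrite coker_actE. Qed.

Definition coker_pi : nattrans J coker :=
  @Nattrans C J coker (fun c => quotient_pi (Defs.image (t c))) coker_pi_nat.

Lemma coker_pi_surj c (x : coker c) : exists y, coker_pi c y = x.
Proof. exact: quotient_piP. Qed.

Lemma coker_pi_eq0 c (x : J c) : coker_pi c x = 0 -> exists y, x = t c y.
Proof. by rewrite -(raddf0 (coker_pi c)) => /quotient_eq; rewrite subr0. Qed.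

Lemma coker_pi_image c (y : L c) : coker_pi c (t c y) = 0.
Proof.
by rewrite -(raddf0 (coker_pi c)); apply/quotient_eq; rewrite subr0; exists y.
Qed.
End Cokernel.

Section CoindUnit.
Variables (C : category) (L : right_module C).

Lemma coind_unit_additive (x : C) :
  zmod_morphism (fun (a : L x) => (fun c h => ract L h a) : @coind C L x).
Proof. by move=> a b; apply: coind_ext => c h; exact: raddfB. Qed.

Definition coind_unit_fun (x : C) : {additive L x -> @coind C L x} :=
  HB.pack (fun (a : L x) => (fun c h => ract L h a) : @coind C L x)
    (GRing.isZmodMorphism.Build _ _ _ (@coind_unit_additive x)).

Lemma coind_unit_nat (a b : C) (f : hom a b) (x : L b) :
  coind_unit_fun a (ract L f x) = ract (@coind C L) f (coind_unit_fun b x).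
Proof. by apply: coind_ext => c h; exact: ractM. Qed.

Definition coind_unit : nattrans L (@coind C L) :=
  @Nattrans (opcat C) L (@coind C L) coind_unit_fun
    (fun a b (f : @hom C b a) x => coind_unit_nat f x).

Lemma coind_unit_inj (x : C) : injective (coind_unit x).
Proof. by move=> a b /(congr1 (fun u => u x (idc x))) /=; rewrite !ract1. Qed.
End CoindUnit.

Lemma fid_comp (C D : category) (I : functor D C) : I = fcomp (fid C) I.
Proof. exact: functor_ext. Qed.

Lemma eq_gcob (B : zmodType) (K : sset) (z w : forall n, K n -> B) n x :
  (forall n x, z n x = w n x) -> gcob z (n := n) x = gcob w x.
Proof. by case: n x => [|n] x zw //; apply: eq_scob => y. Qed.

Lemma gcob_gcob (B : zmodType) (K : sset) (z : forall n, K n -> B) n x :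
  gcob (gcob z) (n := n) x = 0.
Proof. by case: n x => [|n] x //; exact: gcob_scob. Qed.

Lemma gcobB (B : zmodType) (K : sset) (z w : forall n, K n -> B) n x :
  gcob (fun n x => z n x - w n x) (n := n) x = gcob z x - gcob w x.
Proof. by case: n x => [|n] x /=; [rewrite subr0|exact: scobB]. Qed.

Lemma gcobD (B : zmodType) (K : sset) (z w : forall n, K n -> B) n x :
  gcob (fun n x => z n x + w n x) (n := n) x = gcob z x + gcob w x.
Proof. by case: n x => [|n] x /=; [rewrite addr0|exact: scobD]. Qed.

Lemma gcob_smap (B : zmodType) (K L : sset) (f : smap K L)
  (z : forall n, L n -> B) n x :
  gcob (fun n x => z n (f n x)) (n := n) x = gcob z (f n x).
Proof. by case: n x => [|n] x //; exact: scob_smap. Qed.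

(** * The total complex of the square *)

Section Total.
Variables (C0 C1 C2 C : category) (F1 : functor C0 C1) (F2 : functor C0 C2).
Variables (I1 : functor C1 C) (I2 : functor C2 C) (I0 : functor C0 C).
Hypotheses (e1 : I0 = fcomp I1 F1) (e2 : I0 = fcomp I2 F2).

(* An element of [tot] is a cochain of C, C1, C2 and C0 in every degree; the
   total degree only enters as a bound on what is known about a primitive. *)
Inductive tot_index :=
  | TotC n of functor (ordcat n) C
  | Tot1 n of functor (ordcat n) C1
  | Tot2 n of functor (ordcat n) C2
  | Tot0 n of functor (ordcat n) C0.

Definition tot_base (s : tot_index) : C :=
  match s with
  | TotC n s => s ord0
  | Tot1 n s => I1 (s ord0)
  | Tot2 n s => I2 (s ord0)
  | Tot0 n s => I0 (s ord0)
  end.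

(** The columns C, C1 + C2 and C0 are shifted by 0, 1 and 2, so that [tot_d] raises the degree by
    one. *)
Definition tot_deg (s : tot_index) : nat :=
  match s with
  | TotC n s => n
  | Tot1 n s => n.+1
  | Tot2 n s => n.+1
  | Tot0 n s => n.+2
  end.

Definition tot (L : right_module C) : Type := forall s, L (tot_base s).

Section Legs.
Variables (L : right_module C) (x : tot L).
Definition legC : cochain (fid C) L := fun n s => x (TotC s).
Definition leg1 : cochain I1 L := fun n s => x (Tot1 s).
Definition leg2 : cochain I2 L := fun n s => x (Tot2 s).
Definition leg0 : cochain I0 L := fun n s => x (Tot0 s).

Definition tot_d : tot L := fun s =>
  match s return L (tot_base s) with
  | TotC n s => gdco legC s
  | Tot1 n s => pull (fid_comp I1) legC s - gdco leg1 s
  | Tot2 n s => pull (fid_comp I2) legC s - gdco leg2 s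
  | Tot0 n s => pull e1 leg1 s - pull e2 leg2 s + gdco leg0 s
  end.
End Legs.

Definition tot_of (L : right_module C) (a : cochain (fid C) L)
  (b1 : cochain I1 L)
    (b2 : cochain I2 L) (e : cochain I0 L) : tot L := fun s =>
  match s return L (tot_base s) with
  | TotC n s => a n s
  | Tot1 n s => b1 n s
  | Tot2 n s => b2 n s
  | Tot0 n s => e n s
  end.

Lemma tot_d_nat (L L' : right_module C) (t : nattrans L L') (x : tot L) s :
  t _ (tot_d x s) = tot_d (fun s => t _ (x s)) s.
Proof.
case: s => n s /=.
- exact: (gdco_nat t (legC x)).
- rewrite raddfB (gdco_nat t (leg1 x)); congr (_ - _).
  exact: (pull_nat (fid_comp I1) t (legC x)).
- rewrite raddfB (gdco_nat t (leg2 x)); congr (_ - _).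
  exact: (pull_nat (fid_comp I2) t (legC x)).
- rewrite raddfD raddfB (pull_nat e1 t (leg1 x)) (pull_nat e2 t (leg2 x)).
  by rewrite (gdco_nat t (leg0 x)).
Qed.

Lemma tot_dB (L : right_module C) (x y : tot L) s :
  tot_d (fun s => x s - y s) s = tot_d x s - tot_d y s.
Proof.
have sub2 (V : zmodType) (a b c d : V) : a - b - (c - d) = a - c - (b - d).
  by rewrite !opprB addrACA [RHS]addrACA [- b + _]addrC [- c + _]addrC.
case: s => n s /=.
- exact: (gdcoB (legC x) (legC y)).
- by rewrite (pullB _ (legC x) (legC y)) (gdcoB (leg1 x) (leg1 y)) sub2.
- by rewrite (pullB _ (legC x) (legC y)) (gdcoB (leg2 x) (leg2 y)) sub2.
- rewrite (pullB e1 (leg1 x) (leg1 y)) (pullB e2 (leg2 x) (leg2 y)).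
  by rewrite (gdcoB (leg0 x) (leg0 y)) sub2 [in RHS]opprD addrACA.
Qed.

(** This lets dimension shifting work with primitives that are controlled only below a bound. *)
Lemma tot_d_local (L : right_module C) (x y : tot L) s :
  (forall s', (tot_deg s' < tot_deg s)%N -> x s' = y s') -> tot_d x s =
    tot_d y s.
Proof.
case: s => n s /= xy.
- by apply: (eq_gdco (a := legC x) (b := legC y)) => m s' mn;
  exact: (xy (TotC s')).
- rewrite /pull /legC xy //; congr (_ - _).
  by apply: (eq_gdco (a := leg1 x) (b := leg1 y)) => m s' mn;
    exact: (xy (Tot1 s')).
- rewrite /pull /legC xy //; congr (_ - _).
  by apply: (eq_gdco (a := leg2 x) (b := leg2 y)) => m s' mn;
    exact: (xy (Tot2 s')).
- rewrite /pull /leg1 /leg2 !xy //; congr (_ + _).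
  by apply: (eq_gdco (a := leg0 x) (b := leg0 y)) => m s' mn;
    exact: (xy (Tot0 s')).
Qed.

Section Pointwise.
Variable c : C.

Let p1 := nerve_map (under_map (fid_comp I1) c).
Let p2 := nerve_map (under_map (fid_comp I2) c).
Let r1 := nerve_map (under_map e1 c).
Let r2 := nerve_map (under_map e2 c).

Lemma ceq_JMeq (a b : C) (p : a = b) (h : hom c a) : JMeq (ceq p \oc h) h.
Proof. by case: _ / p; rewrite /= comp1f. Qed.

Lemma under_square n (s : nerve (under I0 c) n) : p1 n (r1 n s) = p2 n (r2 n s).
Proof.
apply: under_simplex_ext.
  have E : fcomp I1 F1 = fcomp I2 F2 by rewrite -e1.
  have -> : fcomp (under_forget (fid C) c) (p1 n (r1 n s)) =
    fcomp (fcomp I1 F1) (fcomp (under_forget I0 c) s) by exact: functor_ext.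
  by rewrite E; exact: functor_ext.
apply: (@JMeq_trans _ _ _ _ (projT2 (fob s ord0))).
  by apply: JMeq_trans (ceq_JMeq _ _) _; exact: ceq_JMeq.
by apply: JMeq_sym; apply: JMeq_trans (ceq_JMeq _ _) _; exact: ceq_JMeq.
Qed.

Variable B : C -> zmodType.
Implicit Type x : tot (coind B).

Lemma evC_tot_d x n s :
  ev (c := c) (legC (tot_d x)) (n := n) s = gcob (ev (legC x)) s.
Proof. exact: (ev_gdco (legC x)). Qed.

Lemma ev1_tot_d x n s : ev (c := c) (leg1 (tot_d x)) (n := n) s =
  ev (legC x) (p1 n s) - gcob (ev (leg1 x)) s.
Proof. by rewrite -(ev_gdco (leg1 x)) -(ev_pull (fid_comp I1) (legC x)). Qed.

Lemma ev2_tot_d x n s : ev (c := c) (leg2 (tot_d x)) (n := n) s =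
  ev (legC x) (p2 n s) - gcob (ev (leg2 x)) s.
Proof. by rewrite -(ev_gdco (leg2 x)) -(ev_pull (fid_comp I2) (legC x)). Qed.

Lemma ev0_tot_d x n s : ev (c := c) (leg0 (tot_d x)) (n := n) s =
  ev (leg1 x) (r1 n s) - ev (leg2 x) (r2 n s) + gcob (ev (leg0 x)) s.
Proof.
by rewrite -(ev_gdco (leg0 x)) -(ev_pull e1 (leg1 x)) -(ev_pull e2 (leg2 x)).
Qed.
End Pointwise.

Hypothesis po : is_pushout F1 F2 I1 I2.
Hypothesis inj : injective (fob F1) \/ injective (fob F2).
Hypotheses (lc1 : local_covering I1) (lc2 : local_covering I2).
Hypothesis lc0 : local_covering I0.

Section CoindAcyclic.
Variable B : C -> zmodType.
Implicit Types x y : tot (coind B).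

Lemma tot_coind_ext x y :
  (forall c n s, ev (c := c) (legC x) (n := n) s = ev (legC y) s) ->
  (forall c n s, ev (c := c) (leg1 x) (n := n) s = ev (leg1 y) s) ->
  (forall c n s, ev (c := c) (leg2 x) (n := n) s = ev (leg2 y) s) ->
  (forall c n s, ev (c := c) (leg0 x) (n := n) s = ev (leg0 y) s) ->
  forall s, x s = y s.
Proof.
move=> hC h1 h2 h0 [] n s; apply: coind_ext => c h.
- by have := hC c n (cone (I := fid C) h); rewrite !ev_cone.
- by have := h1 c n (cone h); rewrite !ev_cone.
- by have := h2 c n (cone h); rewrite !ev_cone.
- by have := h0 c n (cone h); rewrite !ev_cone.
Qed.

(** For coinduced coefficients the identity can be checked for each c on the simplicial cochains of
    the under categories, where [scob_scob] and [under_square] apply. *)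
Lemma tot_dd x s : tot_d (tot_d x) s = 0.
Proof.
apply: (tot_coind_ext (x := tot_d (tot_d x)) (y := fun s => 0)) => {s} c n s.
- by rewrite evC_tot_d (eq_gcob _ (@evC_tot_d c B x)) gcob_gcob.
- rewrite ev1_tot_d evC_tot_d (eq_gcob _ (@ev1_tot_d c B x)) gcobB gcob_smap.
  by rewrite gcob_gcob subr0 subrr.
- rewrite ev2_tot_d evC_tot_d (eq_gcob _ (@ev2_tot_d c B x)) gcobB gcob_smap.
  by rewrite gcob_gcob subr0 subrr.
- rewrite ev0_tot_d ev1_tot_d ev2_tot_d (eq_gcob _ (@ev0_tot_d c B x))
  gcobD gcobB.
  rewrite !gcob_smap gcob_gcob addr0 under_square opprB [X in X + _]addrC.
  by rewrite !addrA !subrK subrr.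
Qed.

(** The identity of c is an initial object of c/C; this handles the column of C. *)
Lemma under_fid_coh_discrete c : coh_discrete (nerve (under (fid C) c)).
Proof.
pose o : under (fid C) c := existT (fun d => hom c (fid C d)) c (idc c).
have tP (x : under (fid C) c) : fmap (fid C) (projT2 x) \oc projT2 o = projT2 x.
  exact: compf1.
pose t (x : under (fid C) c) : hom o x := exist _ (projT2 x) (tP x).
apply: (@initial_coh_discrete _ o t) => x f; apply: under_hom_ext.
by rewrite -[LHS]compf1; exact: (svalP f).
Qed.

Lemma cocycle0_invariant (D : category) (I : functor D C) c (V : zmodType)
    (z : nerve (under I c) 0 -> V) : (forall s, scob z s = 0) ->
  invariant_on (fun d h => z (point (existT _ d h : under I c))).
Proof.
move=> z0 d d' f h; apply/esym; apply: scob_point z0.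
by exists f.
Qed.

Lemma invariant_cocycle0 (D : category) (I : functor D C) c (V : zmodType)
    (a : forall d, hom c (I d) -> V) : invariant_on a ->
  forall s, scob (fun s : nerve (under I c) 0 =>
    a (projT1 (fob s ord0)) (projT2 (fob s ord0))) s = 0.
Proof.
move=> ai; apply: (invariant_scob
  (a := fun x : under I c => a (projT1 x) (projT2 x))).
by move=> x y g; rewrite -(svalP g) ai.
Qed.

Lemma point_eta (D : category) (I : functor D C) c (s : nerve (under I c) 0) :
  point (existT (fun d => hom c (I d)) (projT1 (fob s ord0))
    (projT2 (fob s ord0)) : under I c) = s.
Proof.
rewrite [RHS]pointE; congr point; exact/esym/sigT_eta.
Qed.

Lemma tot_coind_pointwise c (x : tot (coind B)) : (forall s, tot_d x s = 0) ->
  exists (a' : forall n, nerve (under (fid C) c) n -> B c)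
    (b1' : forall n, nerve (under I1 c) n -> B c)
    (b2' : forall n, nerve (under I2 c) n -> B c)
    (e' : forall n, nerve (under I0 c) n -> B c),
    [/\ forall n s, ev (c := c) (legC x) (n := n) s = gcob a' s,
        forall n s, ev (c := c) (leg1 x) (n := n) s =
          a' n (nerve_map (under_map (fid_comp I1) c) n s) - gcob b1' s,
        forall n s, ev (c := c) (leg2 x) (n := n) s =
          a' n (nerve_map (under_map (fid_comp I2) c) n s) - gcob b2' s
      & forall n s, ev (c := c) (leg0 x) (n := n) s =
          b1' n (nerve_map (under_map e1 c) n s) -
          b2' n (nerve_map (under_map e2 c) n s) + gcob e' s].
Proof.
move=> x0; apply: chase.
- exact: under_square.
- exact: under_fid_coh_discrete.
- exact/homotopically_discrete_coh/lc1.
- exact/homotopically_discrete_coh/lc2.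
- exact/homotopically_discrete_coh/lc0.
(* A 0-cocycle on c/C is determined by its value at the initial object (c, idc), and c lies in the
   image of I1 or of I2, where the value is 0. *)
- move=> a /cocycle0_invariant ai a1 a2 s.
  rewrite -(point_eta s).
  have := ai c _ (projT2 (fob s ord0)) (idc c); rewrite /= compf1 => ->.
  have [[d dc]|[d dc]] := pushout_ob po c.
    rewrite -(a1 (point (existT _ d (ceq (esym dc)) : under I1 c))).
    congr a; rewrite [RHS]pointE; congr point.
    rewrite /= /under_map_ob /= ceq_id comp1f.
    by case: _ / dc.
  rewrite -(a2 (point (existT _ d (ceq (esym dc)) : under I2 c))).
  congr a; rewrite [RHS]pointE; congr point.
  rewrite /= /under_map_ob /= ceq_id comp1f.
  by case: _ / dc.
- move=> b1 b2 /cocycle0_invariant i1 /cocycle0_invariant i2 b12.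
  have [|a [ai a1 a2]] := pushout_invariant e1 e2 po i1 i2.
    move=> x' q1 q2 h; have := b12 (point (existT _ x' h : under I0 c)).
    rewrite [X in b1 X]pointE [X in b2 X]pointE /= /under_map_ob /=.
    by rewrite (Prop_irrelevance (ob_eq e1 x') q1)
      (Prop_irrelevance (ob_eq e2 x') q2).
  exists (fun s : nerve (under (fid C) c) 0 => a (projT1 (fob s ord0))
    (projT2 (fob s ord0))); split.
  + exact: invariant_cocycle0.
  + by move=> s; rewrite /= ceq_id comp1f a1 point_eta.
  + by move=> s; rewrite /= ceq_id comp1f a2 point_eta.
- move=> e /cocycle0_invariant ie.
  have [g1 [g2 [i1 i2 eg]]] := pushout_difference_sym e1 e2 po inj ie.
  exists (fun s : nerve (under I1 c) 0 => g1 (projT1 (fob s ord0))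
    (projT2 (fob s ord0))).
  exists (fun s : nerve (under I2 c) 0 => g2 (projT1 (fob s ord0))
    (projT2 (fob s ord0))).
  split; [exact: invariant_cocycle0|exact: invariant_cocycle0|move=> s].
  rewrite -{1}(point_eta s).
  exact: (eg _ (ob_eq e1 _) (ob_eq e2 _)).
- by move=> n s; rewrite -[LHS](evC_tot_d x (n := n.+1)) /ev /legC x0.
- move=> n s; apply/eqP; rewrite -subr_eq0; apply/eqP.
  by rewrite -[LHS](ev1_tot_d x) /ev /leg1 x0.
- move=> n s; apply/eqP; rewrite -subr_eq0; apply/eqP.
  by rewrite -[LHS](ev2_tot_d x) /ev /leg2 x0.
- by move=> n s; rewrite -[LHS](ev0_tot_d x) /ev /leg0 x0.
Qed.

Lemma tot_coind_acyclic (x : tot (coind B)) : (forall s, tot_d x s = 0) ->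
  exists y : tot (coind B), forall s, x s = tot_d y s.
Proof.
move=> x0.
pose fam (D : category) (I : functor D C) c := forall n,
  nerve (under I c) n -> B c.
have P c : exists t : fam _ (fid C) c * fam _ I1 c * fam _ I2 c * fam _ I0 c,
    [/\ forall n s, ev (c := c) (legC x) (n := n) s = gcob t.1.1.1 s,
        forall n s, ev (c := c) (leg1 x) (n := n) s =
          t.1.1.1 n (nerve_map (under_map (fid_comp I1) c) n s) - gcob
            t.1.1.2 s,
        forall n s, ev (c := c) (leg2 x) (n := n) s =
          t.1.1.1 n (nerve_map (under_map (fid_comp I2) c) n s) - gcob t.1.2 s
      & forall n s, ev (c := c) (leg0 x) (n := n) s =
          t.1.1.2 n (nerve_map (under_map e1 c) n s) -
          t.1.2 n (nerve_map (under_map e2 c) n s) + gcob t.2 s].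
  by have [a [b1 [b2 [e H]]]] := tot_coind_pointwise c x0;
    exists (a, b1, b2, e).
have [t tP] := dependent_choice_fun P.
(* The pointwise primitives are assembled: at c and h, the cochain chosen for c is evaluated at the
   simplex over s with first leg h. *)
pose y : tot (coind B) := tot_of (L := coind B)
  (fun n s => (fun c h => (t c).1.1.1 n (cone (I := fid C) h)) : coind_ob B _)
  (fun n s => (fun c h => (t c).1.1.2 n (cone h)) : coind_ob B _)
  (fun n s => (fun c h => (t c).1.2 n (cone h)) : coind_ob B _)
  (fun n s => (fun c h => (t c).2 n (cone h)) : coind_ob B _).
have yC c n s : ev (c := c) (legC y) (n := n) s = (t c).1.1.1 n s.
  by rewrite -[X in (t c).1.1.1 n X](cone_eta s).
have y1 c n s : ev (c := c) (leg1 y) (n := n) s = (t c).1.1.2 n s.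
  by rewrite -[X in (t c).1.1.2 n X](cone_eta s).
have y2 c n s : ev (c := c) (leg2 y) (n := n) s = (t c).1.2 n s.
  by rewrite -[X in (t c).1.2 n X](cone_eta s).
have y0 c n s : ev (c := c) (leg0 y) (n := n) s = (t c).2 n s.
  by rewrite -[X in (t c).2 n X](cone_eta s).
exists y; apply: tot_coind_ext => c n s; have [hC h1 h2 h0] := tP c.
- by rewrite evC_tot_d hC; exact/esym/eq_gcob.
- by rewrite ev1_tot_d h1 yC; congr (_ - _); exact/esym/eq_gcob.
- by rewrite ev2_tot_d h2 yC; congr (_ - _); exact/esym/eq_gcob.
- by rewrite ev0_tot_d h0 y1 y2; congr (_ + _); exact/esym/eq_gcob.
Qed.
End CoindAcyclic.

(* Dimension shifting along L -> coind L -> coker. *)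
Lemma tot_acyclic k (L : right_module C) (x : tot L) :
  (forall s, tot_d x s = 0) ->
  exists y : tot L, forall s, (tot_deg s < k)%N -> x s = tot_d y s.
Proof.
elim: k L x => [|k IH] L x x0; first by exists (fun=> 0).
pose u := coind_unit L; pose q := coker_pi u.
have [s|y yE] := @tot_coind_acyclic L (fun s => u _ (x s)).
  by rewrite -tot_d_nat x0 raddf0.
(* Since q kills the image of u, q y is again a total cocycle, now with coefficients in the
   cokernel. *)
have [s|w wE] := IH _ (fun s => q _ (y s)).
  by rewrite -tot_d_nat -yE; exact: coker_pi_image.
pose w' s := projT1 (cid (coker_pi_surj (w s))).
have w'E s : q _ (w' s) = w s by exact: projT2 (cid (coker_pi_surj (w s))).
(* This has the same coboundary as y, and below degree k it is killed by q, so it comes from L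
   there. *)
pose y' s := y s - tot_d (w' : tot (@coind C L)) s.
have y'im s : (tot_deg s < k)%N -> exists z, y' s = u _ z.
  move=> sk; apply: coker_pi_eq0; rewrite raddfB -/q wE // tot_d_nat.
  apply/eqP; rewrite subr_eq0; apply/eqP; apply: tot_d_local => s' _.
  by rewrite w'E.
(* The default 0 can only occur in degrees at least k, and the coboundary in degrees up to k reads
   only degrees below k. *)
pose z s : L (tot_base s) := if pselect (exists z, y' s = u _ z) is left h
  then projT1 (cid h) else 0.
exists z => s sk; apply: (@coind_unit_inj _ L).
rewrite -[LHS]/(u _ (x s)) yE -[RHS]/(u _ (tot_d z s)) tot_d_nat.
transitivity (tot_d y' s).
  by rewrite /y' (tot_dB y (tot_d (w' : tot (@coind C L)))) tot_dd subr0.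
apply: tot_d_local => s' s's; rewrite /z; case: pselect => [h|[]].
  exact: (projT2 (cid h)).
by apply: y'im; apply: leq_trans s's _.
Qed.
End Total.

(** * The connecting homomorphism *)

Section Class.
Variables (V : zmodType) (Z B : subgroup V).

Definition cls x (Zx : Z x) : subquotient Z B :=
  quotient_pi (sub_restr Z B) (to_sub Zx).

Lemma clsP (q : subquotient Z B) : exists x (Zx : Z x), q = cls Zx.
Proof.
have [z <-] := quotient_piP q; exists (val z), (sub_of_in z).
by rewrite /cls; congr (quotient_pi _ _); exact: val_inj.
Qed.

Lemma cls_eq x y (Zx : Z x) (Zy : Z y) : cls Zx = cls Zy <-> B (x - y).
Proof.
have E : sub_restr Z B (to_sub Zx - to_sub Zy) = B (x - y).
  by rewrite -[LHS]/(B (\val (to_sub Zx - to_sub Zy))) raddfB.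
by rewrite -E; exact: quotient_eq.
Qed.

Lemma cls_eq0 x (Zx : Z x) : cls Zx = 0 <-> B x.
Proof.
rewrite -(raddf0 (quotient_pi (sub_restr Z B))).
have E : sub_restr Z B (to_sub Zx - 0) = B x by rewrite subr0.
by rewrite -[in X in _ <-> X]E; exact: quotient_eq.
Qed.

Lemma clsB x y (Zx : Z x) (Zy : Z y) (Zxy : Z (x - y)) :
  cls Zxy = cls Zx - cls Zy.
Proof. by rewrite -raddfB; congr (quotient_pi _ _); apply: val_inj;
  rewrite raddfB. Qed.

Lemma clsN x (Zx : Z x) (ZNx : Z (- x)) : cls ZNx = - cls Zx.
Proof. by rewrite -raddfN; congr (quotient_pi _ _); apply: val_inj;
  rewrite raddfN. Qed.

Lemma clsD x y (Zx : Z x) (Zy : Z y) (Zxy : Z (x + y)) :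
  cls Zxy = cls Zx + cls Zy.
Proof. by rewrite -raddfD; congr (quotient_pi _ _); apply: val_inj;
  rewrite raddfD. Qed.
End Class.

Arguments cls {V Z} B {x}.

Lemma subquotient_map_cls (V W : zmodType) (Z B : subgroup V)
  (Z' B' : subgroup W)
    (f : {additive V -> W}) (fZ : forall x, Z x -> Z' (f x))
    (fB : forall x, B x -> B' (f x)) x (Zx : Z x) (Zfx : Z' (f x)) :
  subquotient_map fZ fB (cls B Zx) = cls B' Zfx.
Proof.
rewrite /subquotient_map quotient_liftE /=.
by congr (quotient_pi _ _); exact: val_inj.
Qed.

Lemma in_subN (V : zmodType) (S : subgroup V) x : S x -> S (- x).
Proof. by rewrite -sub0r; apply: in_subB; exact: in_sub0. Qed.

Lemma in_subD (V : zmodType) (S : subgroup V) x y : S x -> S y -> S (x + y).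
Proof. by move=> Sx Sy; rewrite -[y]opprK; apply: in_subB => //;
  exact: in_subN. Qed.

(** Closure under differences reduces single-valuedness to the value at 0, so no choice of
    representatives has to be compared. *)
Lemma additive_of_relation (V W : zmodType) (R : V -> W -> Prop) :
  (forall x, exists y, R x y) ->
  (forall x y x' y', R x y -> R x' y' -> R (x - x') (y - y')) ->
  (forall y, R 0 y -> y = 0) ->
  exists f : {additive V -> W}, forall x y, R x y <-> f x = y.
Proof.
move=> tot RB R0; pose f x := projT1 (cid (tot x)).
have fR x : R x (f x) by exact: projT2 (cid (tot x)).
have uniq x y : R x y <-> f x = y.
  split=> [Rxy|<-]; last exact: fR.
  apply/eqP; rewrite -subr_eq0; apply/eqP/R0.
  by rewrite -(subrr x); exact: RB.
have fB : zmod_morphism f by move=> x y; apply/uniq; exact: RB.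
pose g : {additive V -> W} := HB.pack f (GRing.isZmodMorphism.Build _ _ f fB).
by exists g.
Qed.

Section Connecting.
Variables (E B1 B2 A B1' B2' : zmodType).
Variables (ZE BE : subgroup E) (ZB1 BB1 : subgroup B1) (ZB2 BB2 : subgroup B2).
Variables (ZA BA : subgroup A) (ZB1' BB1' : subgroup B1')
  (ZB2' BB2' : subgroup B2').
Variables (q1 : {additive B1 -> E}) (q2 : {additive B2 -> E}).
Variables (p1 : {additive A -> B1'}) (p2 : {additive A -> B2'}).
Variables (d1 : {additive B1 -> B1'}) (d2 : {additive B2 -> B2'}).
Variable alpha : subquotient ZA BA ->
  subquotient ZB1' BB1' * subquotient ZB2' BB2'.
Variable beta : subquotient ZB1 BB1 * subquotient ZB2 BB2 -> subquotient ZE BE.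

Hypothesis alphaE : forall x (Zx : ZA x) (Z1 : ZB1' (p1 x)) (Z2 : ZB2' (p2 x)),
  alpha (cls BA Zx) = (cls BB1' Z1, cls BB2' Z2).
Hypothesis betaE : forall y1 y2 (Z1 : ZB1 y1) (Z2 : ZB2 y2)
  (Zq : ZE (q1 y1 + q2 y2)),
  beta (cls BB1 Z1, cls BB2 Z2) = cls BE Zq.
Hypotheses (p1Z : forall x, ZA x -> ZB1' (p1 x))
  (p2Z : forall x, ZA x -> ZB2' (p2 x)).
Hypotheses (ZB1E : forall y, ZB1 y <-> d1 y = 0)
  (ZB2E : forall y, ZB2 y <-> d2 y = 0).
Hypothesis BB1'E : forall y, BB1' y <-> exists z, y = d1 z.
Hypothesis BB2'E : forall y, BB2' y <-> exists z, y = d2 z.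
Hypothesis qZ : forall x y1 y2, ZA x -> d1 y1 = p1 x -> d2 y2 = p2 x ->
  ZE (q1 y1 + q2 y2).

(** The zigzag of the snake lemma. For limits, E and A are the cochains of C0 in degree n and of C
    in degree n+1; for colimits, the chains of C in degree n+1 and of C0 in degree n. The minus sign
    is part of q2 in the first case and of p2 in the second. *)
Definition connects (z : E) (x : A) : Prop :=
  exists y1 y2, [/\ BE (z - (q1 y1 + q2 y2)), d1 y1 = p1 x & d2 y2 = p2 x].

Hypothesis conn_total : forall z, ZE z -> exists2 x, ZA x & connects z x.
Hypothesis conn_single : forall x, ZA x -> connects 0 x -> BA x.
Hypothesis conn_boundary : forall x y1 y2, BA x -> d1 y1 =
  p1 x -> d2 y2 = p2 x ->
  exists y1' y2', [/\ d1 y1' = 0, d2 y2' = 0 &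
    q1 y1' + q2 y2' = q1 y1 + q2 y2].

Lemma connectsB z x z' x' :
  connects z x -> connects z' x' -> connects (z - z') (x - x').
Proof.
move=> [y1 [y2 [zy h1 h2]]] [y1' [y2' [zy' h1' h2']]].
exists (y1 - y1'), (y2 - y2'); rewrite !raddfB h1 h2 h1' h2'; split=> //.
have -> : z - z' - (q1 y1 - q1 y1' + (q2 y2 - q2 y2')) =
    (z - (q1 y1 + q2 y2)) - (z' - (q1 y1' + q2 y2')).
  rewrite [q1 y1 - _ + _]addrACA -opprD !opprB.
  by rewrite addrACA [RHS]addrACA [- z' + _]addrC [- (q1 y1 + _) + _]addrC.
exact: in_subB.
Qed.

(** The zigzag relation on classes is total by [conn_total] and single-valued by [conn_single]. If
    the end x is a boundary, [conn_boundary] replaces y1 and y2 by cycles with the same image in E,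
    which gives exactness at the source. *)
Lemma connecting_hom : exists d :
  {additive subquotient ZE BE -> subquotient ZA BA},
  exact_at beta d /\ exact_at d alpha.
Proof.
pose R (u : subquotient ZE BE) (v : subquotient ZA BA) :=
  exists z x (Zz : ZE z) (Zx : ZA x),
  [/\ u = cls BE Zz, v = cls BA Zx & connects z x].
have q0 y1 y2 : ZB1 y1 -> ZB2 y2 -> ZE (q1 y1 + q2 y2).
  move=> /ZB1E h1 /ZB2E h2; apply: (@qZ 0); rewrite ?raddf0 //; exact: in_sub0.
have conn_shift z z' x : BE (z - z') -> connects z' x -> connects z x.
  move=> zz' [y1 [y2 [h h1 h2]]]; exists y1, y2; split=> //.
  rewrite -(subrK z' z) -addrA; exact: in_subD.
have [u|u v u' v'|v|d dE] := @additive_of_relation _ _ R.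
- have [z [Zz ->]] := clsP u; have [x Zx zx] := conn_total Zz.
  by exists (cls BA Zx), z, x, Zz, Zx.
- move=> [z [x [Zz [Zx [-> -> c]]]]] [z' [x' [Zz' [Zx' [-> -> c']]]]].
  exists (z - z'), (x - x'), (in_subB Zz Zz'), (in_subB Zx Zx').
  by rewrite !clsB; split=> //; exact: connectsB.
- move=> [z [x [Zz [Zx [/esym/cls_eq0 Bz -> c]]]]]; apply/cls_eq0.
  apply: conn_single => //; apply: conn_shift c.
  by rewrite sub0r; exact: in_subN.
exists d; split=> [u|v].
- split=> [/dE [z [x [Zz [Zx [-> /esym/cls_eq0 Bx [y1 [y2 [h h1 h2]]]]]]]]|[[v1
  v2] <-]].
    have [y1' [y2' [/ZB1E Z1 /ZB2E Z2 yy']]] := conn_boundary Bx h1 h2.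
    exists (cls BB1 Z1, cls BB2 Z2); rewrite (betaE Z1 Z2 (q0 _ _ Z1 Z2)).
    by apply/cls_eq; rewrite yy' -opprB; exact: in_subN.
  have [y1 [Z1 ->]] := clsP v1; have [y2 [Z2 ->]] := clsP v2.
  rewrite (betaE Z1 Z2 (q0 _ _ Z1 Z2)); apply/dE.
  exists (q1 y1 + q2 y2), 0, (q0 _ _ Z1 Z2), (in_sub0 ZA); split=> //.
    by apply/esym/cls_eq0; exact: in_sub0.
  exists y1, y2; rewrite subrr !raddf0; split;
    [exact: in_sub0|exact/ZB1E|exact/ZB2E].
- split=> [|[u /dE [z [x [Zz [Zx [_ -> [y1 [y2 [_ h1 h2]]]]]]]]]].
    have [x [Zx ->]] := clsP v; rewrite (alphaE Zx (p1Z Zx) (p2Z Zx)).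
    move=> [/cls_eq0/BB1'E [y1 h1] /cls_eq0/BB2'E [y2 h2]].
    have Zq := qZ Zx (esym h1) (esym h2).
    exists (cls BE Zq); apply/dE; exists (q1 y1 + q2 y2), x, Zq, Zx; split=> //.
    by exists y1, y2; rewrite subrr; split=> //; exact: in_sub0.
  rewrite (alphaE Zx (p1Z Zx) (p2Z Zx)); congr pair; apply/cls_eq0.
    by apply/BB1'E; exists y1.
  by apply/BB2'E; exists y2.
Qed.
End Connecting.

(** * Derived limits *)

Section Single.
Variables (C D : category) (I : functor D C) (L : right_module C).

(** Extension by 0 to the other degrees, because the total complex handles families in all degrees
    at once. *)
Definition single n (a : forall s : functor (ordcat n) D, L (I (s ord0))) :
    cochain I L := fun m =>
  if pselect (n = m) is left p then
    match p in _ = m return forall s : functor (ordcat m) D, L (I (s ord0)) with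
    | erefl => a
    end
  else fun=> 0.
Arguments single [n] a m s : rename.

Lemma singleE n (a : forall s : functor (ordcat n) D, L (I (s ord0))) s :
  single a n s = a s.
Proof.
by rewrite /single; case: pselect => // p; rewrite (Prop_irrelevance p erefl).
Qed.

Lemma single_neq n (a : forall s : functor (ordcat n) D, L (I (s ord0))) m s :
  n <> m -> single a m s = 0.
Proof. by rewrite /single; case: pselect. Qed.

Lemma single0 n (a : forall s : functor (ordcat n) D, L (I (s ord0))) m s :
  (forall s, a s = 0) -> single a m s = 0.
Proof.
move=> a0; case: (pselect (n = m)) => [p|]; last exact: single_neq.
by subst m; rewrite singleE.
Qed.

Lemma eq_single n (a b : forall s : functor (ordcat n) D, L (I (s ord0))) m s :
  (forall s, a s = b s) -> single a m s = single b m s.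
Proof.
move=> ab; case: (pselect (n = m)) => [p|p]; last by rewrite !single_neq.
by subst m; rewrite !singleE.
Qed.

Lemma singleB n (a b : forall s : functor (ordcat n) D, L (I (s ord0))) m s :
  single (fun s => a s - b s) m s = single a m s - single b m s.
Proof.
case: (pselect (n = m)) => [p|p]; last by rewrite !single_neq // subr0.
by subst m; rewrite !singleE.
Qed.

Lemma gdco_single n (a : forall s : functor (ordcat n) D, L (I (s ord0))) m s :
  gdco (single a) (n := m) s = single (dco a) m s.
Proof.
case: m s => [|m] s; first by rewrite single_neq.
case: (pselect (n = m)) => [p|p].
  subst m; rewrite singleE /=; apply: eq_bigr => i _.
  by rewrite /coface_restr singleE.
rewrite single_neq => [|[]//]; apply: big1 => i _.
by rewrite /coface_restr single_neq // raddf0 mul0rz.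
Qed.
End Single.
Arguments single {C D I L} [n] a m s : rename.

Lemma pull_single (C D D' : category) (I : functor D C) (F : functor D' D)
    (I' : functor D' C) (e : I' = fcomp I F) (L : right_module C) n
    (a : forall s : functor (ordcat n) D, L (I (s ord0))) m s :
  pull e (single a) (n := m) s =
  single (fun s => ract L (ceq (ob_eq e (s ord0))) (a (fcomp F s))) m s.
Proof.
rewrite /pull; case: (pselect (n = m)) => [p|p].
  by subst m; rewrite !singleE.
by rewrite !single_neq // raddf0.
Qed.

(** * Natural transformations out of the nerve modules as cochains *)

Section NattransCochains.
Variables (D : category) (N : right_module D) (n : nat).

(** The universal simplex over s. By [star_eta] every simplex of d/D is a translate of one of these,
    which is the Yoneda lemma for [ZN]. *)
Definition star m (s : functor (ordcat m) D) :
  nerve (under (fid D) (s ord0)) m :=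
  cone (I := fid D) (idc (s ord0)).

Definition to_coch (t : nattrans (ZN D n) N) (s : functor (ordcat n) D) :
    N (fid D (s ord0)) := t (s ord0) (gen (star s)).

Lemma star_first m (s : functor (ordcat m) D) :
  projT2 (fob (star s) ord0) = idc (s ord0).
Proof. exact: cone_first. Qed.

Lemma star_eta m (d : D) (s : nerve (under (fid D) d) m) :
  fcomp (under_pre (fid D) (projT2 (fob s ord0)))
    (star (fcomp (under_forget (fid D) d) s)) = s.
Proof.
apply: under_simplex_ext; first exact: functor_ext.
set s' := fcomp (under_forget _ _) s.
rewrite -[X in JMeq X _]/(projT2 (fob (star s') ord0) \oc projT2 (fob s ord0)).
by rewrite star_first comp1f.
Qed.

(** This is the source of the action of [from_first] in [coface_restr]: a face of a universal
    simplex is a translate of a universal simplex. *)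
Lemma star_act k m (a : monotone k m) (s : functor (ordcat m) D) :
  fcomp (star s) (ordfunctor a) =
  fcomp (under_pre (fid D) (from_first s (a ord0)))
    (star (fcomp s (ordfunctor a))).
Proof.
apply: under_simplex_ext; first exact: functor_ext.
set s' := fcomp s _; rewrite
  -[X in JMeq _ X]/(projT2 (fob (star s') ord0) \oc _).
by rewrite star_first comp1f /= compf1.
Qed.

Section OfCoch.
Variable a : forall s : functor (ordcat n) D, N (fid D (s ord0)).

Definition of_coch_fun (d : D) : {additive ZN D n d -> N d} :=
  free_lift (fun s : nerve (under (fid D) d) n =>
    ract N (projT2 (fob s ord0)) (a (fcomp (under_forget (fid D) d) s))).

Lemma coch_eq (s t : functor (ordcat n) D) : s = t -> JMeq (a s) (a t).
Proof. by move=> ->. Qed.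

Lemma of_coch_nat (c d : D) (f : hom c d) (x : ZN D n d) :
  of_coch_fun c (ract (ZN D n) f x) = ract N f (of_coch_fun d x).
Proof.
move: x; apply: (@free_ext _ _ (of_coch_fun c \o ract (ZN D n) f)
  (ract N f \o of_coch_fun d)) => s.
rewrite -[LHS]/(free_lift _ (free_map _ (gen s))) free_mapE free_liftE.
rewrite -[RHS]/(ract N f (free_lift _ (gen s))) free_liftE ractM /=.
have E : fcomp (under_forget (fid D) c) (fcomp (under_pre (fid D) f) s) =
  fcomp (under_forget (fid D) d) s by exact: functor_ext.
congr (ract N _ _); exact: (JMeq_eq (coch_eq E)).
Qed.

Definition of_coch : nattrans (ZN D n) N :=
  @Nattrans (opcat D) (ZN D n) N of_coch_fun
    (fun c d (f : @hom D d c) x => of_coch_nat f x).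

Lemma of_cochK s : to_coch of_coch s = a s.
Proof.
rewrite /to_coch -[LHS]/(free_lift _ (gen (star s))) free_liftE
  star_first ract1.
have E : fcomp (under_forget (fid D) (s ord0)) (star s) =
  s by exact: functor_ext.
exact: (JMeq_eq (coch_eq E)).
Qed.
End OfCoch.

Lemma to_coch_inj (t u : nattrans (ZN D n) N) :
  (forall s, to_coch t s = to_coch u s) -> t = u.
Proof.
move=> tu; apply: nattrans_ext => d; apply: free_ext => s.
rewrite -(star_eta s).
set f := projT2 _; set s' := fcomp (under_forget _ _) _.
have E : gen (fcomp (under_pre (fid D) f) (star s')) =
  ract (ZN D n) f (gen (star s')) :> ZN D n d by rewrite [RHS]free_mapE.
rewrite E (ract_nat t) (ract_nat u); congr (ract N f _); exact: (tu s').
Qed.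
End NattransCochains.

Lemma to_coch_d (D : category) (N : right_module D) n
  (t : nattrans (ZN D n) N) s :
  to_coch (nt_pre N (ZN_d D n) t) s = dco (I := fid D) (to_coch t) s.
Proof.
rewrite -[LHS]/(t _ (simplicial_d _ n (gen (star s)))) free_liftE raddf_sum.
apply: eq_bigr => i _; rewrite raddfMz /coface_restr /to_coch; congr (_ *~ _).
rewrite -[RHS](ract_nat t); congr (t _ _).
by rewrite [RHS]free_mapE /face /= star_act.
Qed.

Lemma ZN_map_star (C D : category) (F : functor D C) n
  (s : functor (ordcat n) D) :
  ZN_map F n (s ord0) (gen (star s)) = gen (star (fcomp F s)).
Proof.
rewrite [LHS]free_mapE; congr gen.
apply: under_simplex_ext; first exact: functor_ext.
rewrite -[X in JMeq X _]/(fmap F (projT2 (fob (star s) ord0))) star_first fmap1.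
have E : JMeq (projT2 (fob (star (fcomp F s)) ord0)) (idc (fcomp F s ord0)).
  by rewrite star_first.
exact: (JMeq_sym E).
Qed.

Lemma to_coch_ind_lim (C D : category) (F : functor D C) (L : right_module C) n
    (t : nattrans (ZN C n) L) s :
  to_coch (N := rres F L) (ind_lim_fun F L n t) s = to_coch t (fcomp F s).
Proof.
by rewrite /to_coch ind_lim_funE; congr (t _ _); exact: ZN_map_star.
Qed.

Section Cobound.
Variables (D : category) (N : right_module D).

Lemma coboundary_family n (t : lim_complex N n) :
  coboundaries (lim_complex N) n t ->
  exists e : cochain (fid D) N, forall m s, gdco e (n := m) s =
    single (I := fid D) (to_coch t) m s.
Proof.
case: n t => [|n] t [u ->].
  exists (fun _ _ => 0) => m s; rewrite single0 //.
  case: m s => [|m] s //; apply: big1 => i _.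
  by rewrite /coface_restr raddf0 mul0rz.
exists (single (I := fid D) (to_coch u)) => m s.
by rewrite gdco_single; apply: eq_single => s'; rewrite [RHS]to_coch_d.
Qed.

Lemma family_coboundary n (t : lim_complex N n) (e : cochain (fid D) N) :
  (forall s, to_coch t s = gdco e s) -> coboundaries (lim_complex N) n t.
Proof.
case: n t => [|n] t te.
  by exists 0; apply: to_coch_inj => s; rewrite te.
exists (of_coch (e n)); apply: to_coch_inj => s.
rewrite te [RHS]to_coch_d; apply: eq_bigr => i _.
by rewrite /coface_restr of_cochK.
Qed.
End Cobound.

(* Restrictions along the two factorizations of I0 are only propositionally
   equal. *)
Definition mcast (D : category) (N N' : cmodule D) (e : N = N') (d : D) :
    N' d -> N d :=
  match e in _ = N' return N' d -> N d with erefl => id end.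

Lemma mcastE (D : category) (N N' : cmodule D) (e : N = N') (d : D) (x : N' d)
    (p : N' d = N d) : mcast e x = eq_rect _ (fun V : zmodType => V) x _ p.
Proof. by case: _ / e x p => x p; rewrite (Prop_irrelevance p erefl). Qed.

Lemma mcast_rres (C0 C1 C : category) (I0 : functor C0 C) (I : functor C1 C)
    (F : functor C0 C1) (L : right_module C) (e : I0 = fcomp I F)
    (e' : rres I0 L = rres F (rres I L)) (d : C0) (x : L (I (F d))) :
  mcast e' (d := d) x = ract L (ceq (ob_eq e d)) x.
Proof.
move: e'; case: _ / (esym e) (ob_eq e d) => p e'; rewrite ceq_id ract1.
exact: (mcastE e' x erefl).
Qed.

Section LimFun.
Variables (C D : category) (F : functor D C) (L : right_module C).
Variables (N : right_module D) (e : N = rres F L).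

Definition lim_fun n : {additive lim_complex L n -> lim_complex N n} :=
  eq_rect_r (fun N => {additive lim_complex L n -> lim_complex N n})
    (ind_lim_fun F L n) e.

Lemma lim_fun_d n t :
  lim_fun n.+1 (cochain_d (lim_complex L) n t) =
    cochain_d (lim_complex N) n (lim_fun n t).
Proof. by rewrite /lim_fun; subst N; exact: ind_lim_d. Qed.

Lemma lim_fun_kernel n t : kernel (cochain_d (lim_complex L) n) t ->
  kernel (cochain_d (lim_complex N) n) (lim_fun n t).
Proof.
by move=> t0; have := lim_fun_d t;
  rewrite (t0 : cochain_d _ n t = 0) raddf0 => /esym.
Qed.

Lemma lim_fun_coboundaries n t : coboundaries (lim_complex L) n t ->
  coboundaries (lim_complex N) n (lim_fun n t).
Proof.
case: n t => [|n] t [u ->]; last by exists (lim_fun n u); exact: lim_fun_d.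
by exists 0; exact: raddf0.
Qed.

Lemma lim_map_cls n t (Zt : kernel (cochain_d (lim_complex L) n) t)
    (Zft : kernel (cochain_d (lim_complex N) n) (lim_fun n t)) :
  lim_map e n (cls (coboundaries (lim_complex L) n) Zt) =
  cls (coboundaries (lim_complex N) n) Zft.
Proof.
rewrite /lim_map; move: Zft; rewrite /lim_fun; subst N => Zft.
exact: subquotient_map_cls.
Qed.

Lemma to_coch_lim_fun n t s :
  to_coch (lim_fun n t) s = mcast e (to_coch t (fcomp F s)).
Proof. by rewrite /lim_fun; subst N; exact: to_coch_ind_lim. Qed.
End LimFun.

Lemma gdco0 (C D : category) (I : functor D C) (L : right_module C) n s :
  gdco (fun _ _ => 0 : L _) (I := I) (n := n) s = 0.
Proof.
case: n s => [|n] s //; apply: big1 => i _.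
by rewrite /coface_restr raddf0 mul0rz.
Qed.

Lemma pull0 (C D D' : category) (I : functor D C) (F : functor D' D)
    (I' : functor D' C) (e : I' = fcomp I F) (L : right_module C) n s :
  pull e (fun _ _ => 0 : L _) (n := n) s = 0.
Proof. exact: raddf0. Qed.

Lemma d_of_coch (D : category) (N : right_module D)
  (a : cochain (fid D) N) n s :
  to_coch (cochain_d (lim_complex N) n (of_coch (a n))) s =
    gdco a (n := n.+1) s.
Proof.
rewrite [LHS]to_coch_d; apply: eq_bigr => i _.
by rewrite /coface_restr of_cochK.
Qed.

(** * The exact sequence for derived limits *)

Section LimMayerVietoris.
Variables (C0 C1 C2 C : category) (F1 : functor C0 C1) (F2 : functor C0 C2).
Variables (I1 : functor C1 C) (I2 : functor C2 C) (I0 : functor C0 C).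
Hypotheses (e1 : I0 = fcomp I1 F1) (e2 : I0 = fcomp I2 F2).
Hypothesis po : is_pushout F1 F2 I1 I2.
Hypothesis inj : injective (fob F1) \/ injective (fob F2).
Hypotheses (lc1 : local_covering I1) (lc2 : local_covering I2).
Hypothesis lc0 : local_covering I0.
Variable L : right_module C.

Lemma pull_fid (D : category) (I : functor D C) (a : cochain (fid C) L) n s :
  pull (fid_comp I) a (n := n) s = a n (fcomp I s).
Proof. by rewrite /pull ceq_id ract1. Qed.

Lemma cochain_acyclic (a : cochain (fid C) L) (b1 : cochain I1 L)
    (b2 : cochain I2 L) (e : cochain I0 L) :
  (forall n s, gdco a (n := n) s = 0) ->
  (forall n s, a n (fcomp I1 s) = gdco b1 (n := n) s) ->
  (forall n s, a n (fcomp I2 s) = gdco b2 (n := n) s) ->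
  (forall n s, pull e1 b1 (n := n) s - pull e2 b2 s + gdco e s = 0) ->
  forall k, exists (a' : cochain (fid C) L) (b1' : cochain I1 L)
      (b2' : cochain I2 L) (e' : cochain I0 L),
    [/\ forall n s, (n < k)%N -> a n s = gdco a' s,
        forall n s, (n < k)%N -> b1 n s = a' n (fcomp I1 s) - gdco b1' s,
        forall n s, (n < k)%N -> b2 n s = a' n (fcomp I2 s) - gdco b2' s
      & forall n s, (n < k)%N -> e n s =
        pull e1 b1' s - pull e2 b2' s + gdco e' s].
Proof.
move=> a0 ab1 ab2 be k; pose x := tot_of a b1 b2 e.
(* The bound is k+2 because n-cochains of C0 have total degree n+2. *)
have [s|y yE] := @tot_acyclic _ _ _ _ _ _ _ _ _ e1 e2 po inj lc1 lc2 lc0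
  k.+2 L x.
  case: s => n s /=.
  - exact: a0.
  - by rewrite (pull_fid I1 a) ab1 subrr.
  - by rewrite (pull_fid I2 a) ab2 subrr.
  - exact: be.
exists (legC y), (leg1 y), (leg2 y), (leg0 y); split=> n s nk.
- by rewrite -[LHS]/(x (TotC C0 C1 C2 s)) yE //=; lia.
- by rewrite -[LHS]/(x (Tot1 C0 C2 C s)) yE /= ?(pull_fid I1) //; lia.
- by rewrite -[LHS]/(x (Tot2 C0 C1 C s)) yE /= ?(pull_fid I2) //; lia.
- by rewrite -[LHS]/(x (Tot0 C1 C2 C s)) yE //=; lia.
Qed.


Local Notation i1 := (lim_fun (erefl (rres I1 L))).
Local Notation i2 := (lim_fun (erefl (rres I2 L))).
Local Notation f1 := (lim_fun (rres_fcomp L e1)).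
Local Notation f2 := (lim_fun (rres_fcomp L e2)).
Local Notation SC t := (single (I := fid C) (L := L) (to_coch t)).
Local Notation S1 t := (single (I := I1) (L := L) (to_coch t)).
Local Notation S2 t := (single (I := I2) (L := L) (to_coch t)).
Local Notation S0 t := (single (I := I0) (L := L) (to_coch t)).

Lemma gdco_nt (D : category) (I : functor D C) n
  (t : lim_complex (rres I L) n) m s :
  gdco (single (I := I) (L := L) (to_coch t)) (n := m) s =
  single (I := I) (L := L)
    (to_coch (cochain_d (lim_complex (rres I L)) n t)) m s.
Proof.
by rewrite gdco_single; apply: eq_single => s'; rewrite [RHS]to_coch_d.
Qed.

Lemma gdco_SC n (t : lim_complex L n) m s :
  gdco (SC t) (n := m) s = SC (cochain_d (lim_complex L) n t) m s.
Proof.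
by rewrite gdco_single; apply: eq_single => s'; rewrite [RHS]to_coch_d.
Qed.

Lemma SC_restr (D : category) (I : functor D C) n (t : lim_complex L n) m s :
  SC t m (fcomp I s) =
  single (I := I) (L := L) (to_coch (lim_fun (erefl (rres I L)) n t)) m s.
Proof.
case: (pselect (n = m)) => [p|p]; last by rewrite !single_neq.
by subst m; rewrite !singleE to_coch_lim_fun.
Qed.

Lemma to_coch_f (D : category) (I : functor D C) (F : functor C0 D)
  (e : I0 = fcomp I F)
    n (t : lim_complex (rres I L) n) s :
  to_coch (lim_fun (rres_fcomp L e) n t) s =
  ract L (ceq (ob_eq e (s ord0))) (to_coch t (fcomp F s)).
Proof. by rewrite to_coch_lim_fun; exact: mcast_rres. Qed.

Lemma pull_nt (D : category) (I : functor D C) (F : functor C0 D)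
  (e : I0 = fcomp I F)
    n (t : lim_complex (rres I L) n) m s :
  pull e (single (I := I) (L := L) (to_coch t)) (n := m) s =
  S0 (lim_fun (rres_fcomp L e) n t) m s.
Proof. by rewrite pull_single; apply: eq_single => s'; rewrite to_coch_f. Qed.

(** Totality of the connecting relation: the components of a primitive of the total cocycle (0, 0,
    0, z) form the zigzag. *)
Lemma lim_total n (z : lim_complex (rres I0 L) n) :
  cochain_d (lim_complex (rres I0 L)) n z = 0 ->
  exists (y1 : lim_complex (rres I1 L) n) (y2 : lim_complex (rres I2 L) n)
      (x : lim_complex L n.+1),
    [/\ coboundaries (lim_complex (rres I0 L)) n (z - (f1 n y1 - f2 n y2)),
      cochain_d (lim_complex (rres I1 L)) n y1 = i1 n.+1 x,
      cochain_d (lim_complex (rres I2 L)) n y2 = i2 n.+1 x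
      & cochain_d (lim_complex L) n.+1 x = 0].
Proof.
move=> dz.
(* The bound n+3 reaches degree n+2, where the cocycle condition on x is read off. *)
have [||||a [b1 [b2 [e [aE b1E b2E eE]]]]] := @cochain_acyclic
  (fun _ _ => 0) (fun _ _ => 0) (fun _ _ => 0) (S0 z) _ _ _ _ n.+3.
- by move=> m s; exact: gdco0.
- by move=> m s; rewrite gdco0.
- by move=> m s; rewrite gdco0.
- move=> m s; rewrite !pull0 subrr add0r gdco_nt dz.
  exact: single0.
exists (of_coch (N := rres I1 L) (b1 n)), (of_coch (N := rres I2 L) (b2 n)),
  (of_coch (N := L) (a n.+1)).
split.
- apply: (family_coboundary (N := rres I0 L) (e := e)) => s.
  rewrite -[LHS]/(to_coch z s - (to_coch (f1 n _) s - to_coch (f2 n _) s)).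
  rewrite !to_coch_f !of_cochK.
  have := eE n s; rewrite singleE => -> //; last by lia.
  by rewrite /pull addrC addKr.
- apply: to_coch_inj => s; rewrite to_coch_lim_fun [RHS](of_cochK (N := L)).
  rewrite (d_of_coch (N := rres I1 L) b1); apply/esym/eqP; rewrite -subr_eq0.
  exact/eqP/esym/(b1E n.+1 s (ltnW (ltnSn _))).
- apply: to_coch_inj => s; rewrite to_coch_lim_fun [RHS](of_cochK (N := L)).
  rewrite (d_of_coch (N := rres I2 L) b2); apply/esym/eqP; rewrite -subr_eq0.
  exact/eqP/esym/(b2E n.+1 s (ltnW (ltnSn _))).
- apply: to_coch_inj => s; rewrite (d_of_coch (N := L) a).
  exact/esym/(aE n.+2 s (ltnSn _)).
Qed.

Lemma coboundary_opp n (t : lim_complex (rres I0 L) n) :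
  coboundaries (lim_complex (rres I0 L)) n t ->
  exists e : cochain I0 L, forall m s, gdco e (n := m) s = - S0 t m s.
Proof.
move=> /coboundary_family [e eE]; exists (fun n s => 0 - e n s) => m s.
rewrite (gdcoB (I := I0) (L := L) (fun _ _ => 0) e) gdco0 sub0r; congr (- _);
  exact: eE.
Qed.

Lemma S0B n (t u : lim_complex (rres I0 L) n) m s :
  S0 (t - u) m s = S0 t m s - S0 u m s.
Proof. by rewrite -singleB. Qed.

(** The C-component of a primitive of the total cocycle (x, y1, y2, e), where the coboundary of e is
    minus f1 y1 - f2 y2. *)
Lemma lim_single n (x : lim_complex L n.+1) (y1 : lim_complex (rres I1 L) n)
    (y2 : lim_complex (rres I2 L) n) :
  cochain_d (lim_complex L) n.+1 x = 0 ->
  cochain_d (lim_complex (rres I1 L)) n y1 = i1 n.+1 x ->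
  cochain_d (lim_complex (rres I2 L)) n y2 = i2 n.+1 x ->
  coboundaries (lim_complex (rres I0 L)) n (f1 n y1 - f2 n y2) ->
  Defs.image (cochain_d (lim_complex L) n) x.
Proof.
move=> dx dy1 dy2 /coboundary_opp [e eE].
have [||||a [b1 [b2 [e' [aE _ _ _]]]]] :=
  @cochain_acyclic (SC x) (S1 y1) (S2 y2) e _ _ _ _ n.+2.
- by move=> m s; rewrite gdco_SC dx; exact: single0.
- by move=> m s; rewrite SC_restr gdco_nt dy1.
- by move=> m s; rewrite SC_restr gdco_nt dy2.
- by move=> m s; rewrite !pull_nt eE S0B subrr.
exists (of_coch (N := L) (a n)); apply: to_coch_inj => s.
by rewrite (d_of_coch (N := L) a) -[LHS](singleE (I := fid C)) aE.
Qed.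

(** The total cocycle (0, y1, y2, e) has a primitive whose C-component x is a cocycle; its other
    components bound the differences between y1, y2 and the restrictions of x. *)
Lemma lim_middle n (y1 : lim_complex (rres I1 L) n)
  (y2 : lim_complex (rres I2 L) n) :
  cochain_d (lim_complex (rres I1 L)) n y1 = 0 ->
  cochain_d (lim_complex (rres I2 L)) n y2 = 0 ->
  coboundaries (lim_complex (rres I0 L)) n (f1 n y1 - f2 n y2) ->
  exists x : lim_complex L n, [/\ cochain_d (lim_complex L) n x = 0,
    coboundaries (lim_complex (rres I1 L)) n (y1 - i1 n x)
    & coboundaries (lim_complex (rres I2 L)) n (y2 - i2 n x)].
Proof.
move=> dy1 dy2 /coboundary_opp [e eE].
have [||||a [b1 [b2 [e' [aE b1E b2E _]]]]] :=
  @cochain_acyclic (fun _ _ => 0) (S1 y1) (S2 y2) e _ _ _ _ n.+2.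
- by move=> m s; exact: gdco0.
- by move=> m s; rewrite gdco_nt dy1 single0.
- by move=> m s; rewrite gdco_nt dy2 single0.
- by move=> m s; rewrite !pull_nt eE S0B subrr.
exists (of_coch (N := L) (a n)); split.
- apply: to_coch_inj => s; rewrite (d_of_coch (N := L) a).
  exact/esym/(aE n.+1 s (ltnSn _)).
- apply: (family_coboundary (N := rres I1 L) (e := fun n s => 0 - b1 n s)) => s.
  rewrite (gdcoB (I := fid C1) (L := rres I1 L) (fun _ _ => 0) b1) gdco0 sub0r.
  rewrite -[LHS]/(to_coch y1 s - to_coch (i1 n _) s).
  rewrite to_coch_lim_fun -[X in X - _](singleE (I := I1)) b1E //.
  by rewrite [X in _ - X](of_cochK (N := L)) addrC addKr.
- apply: (family_coboundary (N := rres I2 L) (e := fun n s => 0 - b2 n s)) => s.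
  rewrite (gdcoB (I := fid C2) (L := rres I2 L) (fun _ _ => 0) b2) gdco0 sub0r.
  rewrite -[LHS]/(to_coch y2 s - to_coch (i2 n _) s).
  rewrite to_coch_lim_fun -[X in X - _](singleE (I := I2)) b2E //.
  by rewrite [X in _ - X](of_cochK (N := L)) addrC addKr.
Qed.

(** The total cocycle (x, 0, 0, 0) is a coboundary, and in degree 0 of C the only coboundary is
    0. *)
Lemma lim_left (x : lim_complex L 0) : cochain_d (lim_complex L) 0 x = 0 ->
  i1 0%N x = 0 -> i2 0%N x = 0 -> x = 0.
Proof.
move=> dx ix1 ix2.
have [||||a [b1 [b2 [e' [aE _ _ _]]]]] :=
  @cochain_acyclic (SC x) (fun _ _ => 0) (fun _ _ => 0) (fun _ _ => 0) _ _
    _ _ 1%N.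
- by move=> m s; rewrite gdco_SC dx; exact: single0.
- by move=> m s; rewrite SC_restr ix1 gdco0 single0.
- by move=> m s; rewrite SC_restr ix2 gdco0 single0.
- by move=> m s; rewrite !pull0 gdco0 subrr addr0.
apply: to_coch_inj => s; rewrite -[LHS](singleE (I := fid C)) aE //.
Qed.

Theorem lim_mayer_vietoris :
  let f1 := lim_map (rres_fcomp L e1) in
  let f2 := lim_map (rres_fcomp L e2) in
  let i1 := lim_map (erefl (rres I1 L)) in
  let i2 := lim_map (erefl (rres I2 L)) in
  let alpha n (z : lim L n) := (i1 n z, i2 n z) in
  let beta n (p : lim (rres I1 L) n * lim (rres I2 L) n) :=
    f1 n p.1 - f2 n p.2 in
  exists d : forall n, {additive lim (rres I0 L) n -> lim L n.+1},
    [/\ forall z, alpha 0%N z = 0 -> z = 0,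
        forall n, exact_at (alpha n) (beta n),
        forall n, exact_at (beta n) (d n)
      & forall n, exact_at (d n) (alpha n.+1)].
Proof.
move=> mf1 mf2 mi1 mi2 alpha beta.
have alphaE n x Zx Z1 Z2 : alpha n (@cls _ _ _ x Zx) =
  (@cls _ _ _ (i1 n x) Z1, @cls _ _ _ (i2 n x) Z2).
  by rewrite /alpha /mi1 /mi2 (lim_map_cls Zx Z1) (lim_map_cls Zx Z2).
have betaE n y1 y2 Z1 Z2 Zq : beta n (@cls _ _ _ y1 Z1, @cls _ _ _ y2 Z2) =
    @cls _ _ _ (f1 n y1 - f2 n y2) Zq.
  rewrite /beta /mf1 /mf2 /=
    (lim_map_cls Z1 (lim_fun_kernel (rres_fcomp L e1) Z1)).
  rewrite (lim_map_cls Z2 (lim_fun_kernel (rres_fcomp L e2) Z2)).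
  exact/esym/clsB.
have comp n (x : lim_complex L n) : f1 n (i1 n x) = f2 n (i2 n x).
  apply: to_coch_inj => s; rewrite !to_coch_f !to_coch_lim_fun /=.
  have E (D : category) (I : functor D C) (F : functor C0 D) (J : functor C0 C)
      (j : J = fcomp I F) (t : functor (ordcat n) C0) :
    ract L (ceq (ob_eq j (t ord0))) (to_coch x (fcomp I (fcomp F t))) =
    to_coch x (fcomp J t).
    subst J; rewrite ceq_id ract1.
    exact: (JMeq_eq (coch_eq (to_coch x) (fcompA I F t))).
  by rewrite (E _ I1 F1 _ e1) (E _ I2 F2 _ e2).
have H n : exists d : {additive lim (rres I0 L) n -> lim L n.+1},
    exact_at (beta n) d /\ exact_at d (alpha n.+1).
  apply: (@connecting_hom _ _ _ _ _ _ _ _ _ _ _ _ _ _ _ _ _ _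
    (f1 n) (\- f2 n) (i1 n.+1) (i2 n.+1) (cochain_d _ n) (cochain_d _ n)).
  - by move=> x Zx Z1 Z2; exact: alphaE.
  - by move=> y1 y2 Z1 Z2 Zq; exact: betaE.
  - by move=> x; exact: lim_fun_kernel.
  - by move=> x; exact: lim_fun_kernel.
  - by [].
  - by [].
  - by [].
  - by [].
  - move=> x y1 y2 _ h1 h2; rewrite -[_ + _]/(f1 n y1 - f2 n y2).
    suff E : cochain_d (lim_complex (rres I0 L)) n (f1 n y1 - f2 n y2) =
      0 by exact: E.
    by rewrite raddfB -!lim_fun_d h1 h2 comp subrr.
  - move=> z /lim_total [y1 [y2 [x [h h1 h2 dx]]]].
    by exists x => //; exists y1, y2.
  - move=> x Zx [y1 [y2 [h h1 h2]]].
    apply: lim_single Zx h1 h2 _.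
    by have := in_subN h; rewrite sub0r opprK.
  - move=> x y1 y2 [u ->]; rewrite !lim_fun_d => h1 h2.
    exists (y1 - i1 n u), (y2 - i2 n u); rewrite !raddfB h1 h2 !subrr;
      split=> //.
    rewrite -[LHS]/(f1 n y1 - f1 n (i1 n u) + (- f2 n y2 - - f2 n (i2 n u))).
    by rewrite comp opprK addrACA addNr addr0.
exists (fun n => projT1 (cid (H n))); split=> [z|n|n|n].
- have [x [Zx ->]] := clsP z.
  rewrite (alphaE _ _ _ (lim_fun_kernel _ Zx) (lim_fun_kernel _ Zx)).
  move=> [/cls_eq0 [u1 h1] /cls_eq0 [u2 h2]]; apply/cls_eq0.
  by rewrite (lim_left Zx h1 h2); exact: in_sub0.
- move=> [v1 v2]; have [y1 [Z1 ->]] := clsP v1; have [y2 [Z2 ->]] := clsP v2.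
  rewrite (betaE _ _ _ _ _
    (in_subB (lim_fun_kernel _ Z1) (lim_fun_kernel _ Z2))).
  split=> [/cls_eq0 h|[z]].
    have [x [dx h1 h2]] := lim_middle Z1 Z2 h.
    exists (cls _ (dx : kernel _ x)).
    rewrite (alphaE _ _ _ (lim_fun_kernel _ dx) (lim_fun_kernel _ dx)).
    by congr pair; apply/cls_eq; rewrite -opprB; exact: in_subN.
  have [x [Zx ->]] := clsP z.
  rewrite (alphaE _ _ _ (lim_fun_kernel _ Zx) (lim_fun_kernel _ Zx)).
  move=> [/cls_eq h1 /cls_eq h2]; apply/cls_eq0.
  have -> : f1 n y1 - f2 n y2 = f2 n (i2 n x - y2) - f1 n (i1 n x - y1).
    by rewrite (raddfB (f1 n)) (raddfB (f2 n)) comp opprB [RHS]addrC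
      addrA subrK.
  by apply: in_subB; apply: lim_fun_coboundaries.
- by case: (projT2 (cid (H n))).
- by case: (projT2 (cid (H n))).
Qed.
End LimMayerVietoris.

(** * Derived colimits *)

Section AdditiveMaps.
Variables (U W : zmodType).

Definition add_hom : Type := {additive U -> W}.
Implicit Types f g : add_hom.

HB.instance Definition _ := gen_eqMixin add_hom.
HB.instance Definition _ := gen_choiceMixin add_hom.

Definition add_hom0 : add_hom := \0.
Definition add_homN f : add_hom := \- (f : {additive U -> W}).
Definition add_homD f g :
  add_hom := (f : {additive U -> W}) \+ (g : {additive U -> W}).

Lemma add_homDA : associative add_homD.
Proof. by move=> f g h; apply: additive_ext => x; exact: addrA. Qed.

Lemma add_homDC : commutative add_homD.
Proof. by move=> f g; apply: additive_ext => x; exact: addrC. Qed.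

Lemma add_hom0D : left_id add_hom0 add_homD.
Proof. by move=> f; apply: additive_ext => x; exact: add0r. Qed.

Lemma add_homND : left_inverse add_hom0 add_homN add_homD.
Proof. by move=> f; apply: additive_ext => x; exact: addNr. Qed.

HB.instance Definition _ :=
  GRing.isZmodule.Build add_hom add_homDA add_homDC add_hom0D add_homND.

Definition add_app (f : add_hom) : {additive U -> W} := f.

Lemma add_eval_additive (x : U) :
  zmod_morphism (fun f : add_hom => add_app f x).
Proof. by []. Qed.

Definition add_eval (x : U) : {additive add_hom -> W} :=
  HB.pack (fun f : add_hom => add_app f x)
    (GRing.isZmodMorphism.Build _ _ _ (add_eval_additive x)).
End AdditiveMaps.

(** * Functionals on chains as cochains with dual coefficients *)

Section Dual.
Variables (D : category) (N : left_module D) (W : zmodType).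

Lemma dual_act_additive (a b : D) (f : hom a b) :
  zmod_morphism (fun g : add_hom (N b) W =>
    (add_app g \o mact N f : {additive _ -> _}) : add_hom (N a) W).
Proof. by move=> g h; apply: additive_ext. Qed.

Definition dual_act (a b : D) (f : hom a b) :
  {additive add_hom (N b) W -> add_hom (N a) W} :=
  HB.pack (fun g : add_hom (N b) W =>
    (add_app g \o mact N f : {additive _ -> _}) : add_hom (N a) W)
    (GRing.isZmodMorphism.Build _ _ _ (@dual_act_additive a b f)).

Lemma dual_act1 a (g : add_hom (N a) W) : dual_act (idc a) g = g.
Proof. by apply: additive_ext => x; rewrite /= mact1. Qed.

Lemma dual_actM a b c (h : hom b c) (f : hom a b) (g : add_hom (N c) W) :
  dual_act (h \oc f) g = dual_act f (dual_act h g).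
Proof. by apply: additive_ext => x; rewrite /= mactM. Qed.

Definition dual : right_module D :=
  @Cmodule (opcat D) (fun d => add_hom (N d) W : zmodType)
    (fun a b (f : @hom D b a) => dual_act f)
    dual_act1 (fun a b c (g : @hom D c b) (f : @hom D b a) => @dual_actM c
      b a f g).

(** The tensor-hom adjunction combined with the Yoneda lemma: W-valued functionals on n-chains with
    coefficients in N are n-cochains with coefficients in Hom(N, W). *)
Definition tcoch n (G : {additive tensor (ZN D n) N -> W})
  (s : functor (ordcat n) D) :
    dual (fid D (s ord0)) :=
  (G \o tens (L := ZN D n) (M := N) (gen (star s)) : {additive _ -> _}).

Lemma tcoch_inj n (G H : {additive tensor (ZN D n) N -> W}) :
  (forall s, tcoch G s = tcoch H s) -> G =1 H.
Proof.
move=> GH; apply: tensor_ext => d x y.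
pose tl : {additive ZN D n d -> tensor (ZN D n) N} :=
  HB.pack (fun x : ZN D n d => tens (L := ZN D n) x y)
    (GRing.isNmodMorphism.Build _ _ _ (@tensl_additive _ (ZN D n) N d y)).
move: x; apply: (@free_ext _ _ (G \o tl) (H \o tl)) => s.
rewrite -[LHS]/(G (tens (L := ZN D n) (gen s) y))
  -[RHS]/(H (tens (L := ZN D n) (gen s) y)).
rewrite -(star_eta s).
set f := projT2 _; set s' := fcomp (under_forget _ _) _.
have E : gen (fcomp (under_pre (fid D) f) (star s')) =
  ract (ZN D n) f (gen (star s')) :> ZN D n d by rewrite [RHS]free_mapE.
rewrite E !tens_act; exact: (congr1 (fun g => add_app g (mact N f y)) (GH s')).
Qed.

Lemma tcoch_d n (G : {additive tensor (ZN D n) N -> W}) s :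
  tcoch (G \o tensor_map (ZN_d D n) (ntid N)) s = dco (I := fid D) (tcoch G) s.
Proof.
apply: additive_ext => y;
  rewrite -[LHS]/(G (tensor_map (ZN_d D n) (ntid N) (tens _ y))).
rewrite tensor_mapE -[RHS]/(add_eval W y (dco (I := fid D) (tcoch G) s)).
rewrite /dco raddf_sum.
pose tl : {additive ZN D n (s ord0) -> tensor (ZN D n) N} :=
  HB.pack (fun x : ZN D n (s ord0) => tens (L := ZN D n) x y)
    (GRing.isNmodMorphism.Build _ _ _ (@tensl_additive _ (ZN D n) N _ y)).
rewrite -[LHS]/(G (tl (simplicial_d _ n (gen (star s))))) free_liftE !raddf_sum.
apply: eq_bigr => i _; rewrite !raddfMz; congr (_ *~ _).
rewrite -[RHS]/(G (tens (L := ZN D n)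
  (gen (star (fcomp s (ordfunctor (coface i)))))
  (mact N (from_first s (coface i ord0)) y))) -tens_act; congr (G (tens _ y)).
by rewrite [RHS]free_mapE /face /= star_act.
Qed.

Section OfTcoch.
Variables (n : nat) (a : forall s : functor (ordcat n) D,
  dual (fid D (s ord0))).

Lemma of_tcoch_balanced : balanced (L := ZN D n) (M := N)
  (fun d x y => add_app (of_coch a d x) y).
Proof.
split=> [d x x' y|d x y y'|c d f x y].
- by rewrite raddfD.
- exact: raddfD.
- by rewrite (ract_nat (of_coch a)).
Qed.

Definition of_tcoch : {additive tensor (ZN D n) N -> W} :=
  tensor_lift of_tcoch_balanced.

Lemma of_tcochK s : tcoch of_tcoch s = a s.
Proof.
apply: additive_ext => y; rewrite -[LHS]/(of_tcoch (tens _ y)) tensor_liftE.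
by rewrite -[in RHS](of_cochK a).
Qed.
End OfTcoch.
End Dual.

Section ColimFun.
Variables (C D : category) (F : functor D C) (M : left_module C).
Variables (N : left_module D) (e : N = lres F M).

Definition colim_fun n : {additive colim_complex N n -> colim_complex M n} :=
  eq_rect_r (fun N => {additive colim_complex N n -> colim_complex M n})
    (ind_colim_fun F M n) e.

Lemma colim_fun_d n t :
  colim_fun n (chain_d (colim_complex N) n t) =
    chain_d (colim_complex M) n (colim_fun n.+1 t).
Proof. by rewrite /colim_fun; subst N; exact: ind_colim_d. Qed.

Lemma colim_fun_cycles n t : cycles (colim_complex N) n t ->
  cycles (colim_complex M) n (colim_fun n t).
Proof.
case: n t => [//|n] t t0.
suff E : chain_d (colim_complex M) n (colim_fun n.+1 t) = 0 by exact: E.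
by rewrite -colim_fun_d (t0 : chain_d _ n t = 0) raddf0.
Qed.

Lemma colim_fun_boundaries n t : Defs.image (chain_d (colim_complex N) n) t ->
  Defs.image (chain_d (colim_complex M) n) (colim_fun n t).
Proof. by move=> [u ->]; exists (colim_fun n.+1 u); exact: colim_fun_d. Qed.

Lemma colim_map_cls n t (Zt : cycles (colim_complex N) n t)
    (Zft : cycles (colim_complex M) n (colim_fun n t)) :
  colim_map e n (cls (Defs.image (chain_d (colim_complex N) n)) Zt) =
  cls (Defs.image (chain_d (colim_complex M) n)) Zft.
Proof.
rewrite /colim_map; move: Zft; rewrite /colim_fun; subst N => Zft.
exact: subquotient_map_cls.
Qed.

(** The transpose of the map induced by F on chains is restriction of cochains along F. *)
Lemma tcoch_colim_fun (W : zmodType) n (G : {additive colim_complex M n -> W})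
    (s : functor (ordcat n) D) (y : N (s ord0)) :
  add_app (tcoch (N := N) (n := n)
    (G \o colim_fun n : {additive colim_complex N n -> W}) s) y =
  add_app (tcoch (N := M) (n := n) G (fcomp F s))
    (mcast (esym e) (d := s ord0) y).
Proof.
rewrite /colim_fun; subst N.
rewrite -[LHS]/(G (ind_colim_fun F M n
  (tens (L := ZN D n) (M := lres F M) (gen (star s)) y))).
by rewrite ind_colim_funE ZN_map_star.
Qed.
End ColimFun.

Lemma mcast_lres (C0 C1 C : category) (I0 : functor C0 C) (I : functor C1 C)
    (F : functor C0 C1) (M : left_module C) (e : I0 = fcomp I F)
    (e' : lres F (lres I M) = lres I0 M) (d : C0) (y : M (I0 d)) :
  mcast e' (d := d) y = mact M (ceq (ob_eq e d)) y.
Proof.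
move: (ob_eq e d) => p; subst I0; rewrite ceq_id mact1.
exact: (mcastE e' y erefl).
Qed.

(** Take W = V/S and the projection. *)
Lemma functional_separation (V : zmodType) (S : subgroup V) (x : V) :
  (forall (W : zmodType) (G : {additive V -> W}), (forall s, S s -> G s = 0) ->
    G x = 0) ->
  S x.
Proof.
move=> /(_ _ (quotient_pi S)) H.
rewrite -[x]subr0; apply/quotient_eq; rewrite raddf0; apply: H => s Ss.
by rewrite -(raddf0 (quotient_pi S)); apply/quotient_eq; rewrite subr0.
Qed.

(** Setting all but one variable to 0 turns vanishing on total boundaries into the four cocycle
    conditions. *)
Lemma split_relation (T U1 U2 V W : zmodType) (al : {additive T -> W})
    (b1 d1 : {additive U1 -> W}) (b2 d2 : {additive U2 -> W})
    (g1 g2 ep : {additive V -> W}) :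
  (forall t u1 u2 v, al t + b1 u1 + b2 u2 + (g1 v - d1 u1) + (- g2 v - d2 u2)
    + ep v = 0) ->
  [/\ forall t, al t = 0, forall u, b1 u = d1 u, forall u, b2 u = d2 u
    & forall v, g1 v - g2 v + ep v = 0].
Proof.
move=> H; split=> [t|u|u|v].
- by have := H t 0 0 0; rewrite !raddf0 ?oppr0 !addr0.
- have /eqP := H 0 u 0 0; rewrite !raddf0 ?oppr0 ?addr0 ?add0r.
  by rewrite subr_eq0 => /eqP.
- have /eqP := H 0 0 u 0; rewrite !raddf0 ?oppr0 ?addr0 ?add0r.
  by rewrite subr_eq0 => /eqP.
- by have := H 0 0 0 v; rewrite !raddf0 ?oppr0 ?addr0 ?add0r.
Qed.

Section PairInjections.
Variables (U V : zmodType).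

Lemma pair_inl_additive : zmod_morphism (fun u : U => (u, 0) : U * V).
Proof. by move=> u u'; congr pair; rewrite subr0. Qed.

Lemma pair_inr_additive : zmod_morphism (fun v : V => (0, v) : U * V).
Proof. by move=> v v'; congr pair; rewrite subr0. Qed.

Definition pair_inl : {additive U -> U * V} :=
  HB.pack (fun u : U => (u, 0) : U * V)
    (GRing.isZmodMorphism.Build _ _ _ pair_inl_additive).

Definition pair_inr : {additive V -> U * V} :=
  HB.pack (fun v : V => (0, v) : U * V)
    (GRing.isZmodMorphism.Build _ _ _ pair_inr_additive).
End PairInjections.

Lemma additive_quad (U1 U2 U3 U4 W : zmodType)
    (G : {additive U1 * U2 * U3 * U4 -> W}) a b c d :
  G (a, b, c, d) = (G \o pair_inl _ _ \o pair_inl _ _ \o pair_inl _ _) a +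
    (G \o pair_inl _ _ \o pair_inl _ _ \o pair_inr _ _) b +
    (G \o pair_inl _ _ \o pair_inr _ _) c + (G \o pair_inr _ _) d.
Proof.
rewrite /= -!raddfD; congr (G _).
by congr (_, _, _, _); rewrite /= ?addr0 ?add0r.
Qed.

(* The differential of X extended by 0 to degree 0, where its target X 0.-1 is
   the junk value X 0. *)
Definition chain_dm (X : chain_complex) n : {additive X n -> X n.-1} :=
  match n return {additive X n -> X n.-1} with
  | 0 => \0
  | m.+1 => chain_d X m
  end.

Lemma cyclesP (X : chain_complex) n x : cycles X n x <-> chain_dm X n x = 0.
Proof. by case: n x. Qed.

(** * The exact sequence for derived colimits *)

Section ColimMayerVietoris.
Variables (C0 C1 C2 C : category) (F1 : functor C0 C1) (F2 : functor C0 C2).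
Variables (I1 : functor C1 C) (I2 : functor C2 C) (I0 : functor C0 C).
Hypotheses (e1 : I0 = fcomp I1 F1) (e2 : I0 = fcomp I2 F2).
Hypothesis po : is_pushout F1 F2 I1 I2.
Hypothesis inj : injective (fob F1) \/ injective (fob F2).
Hypotheses (lc1 : local_covering I1) (lc2 : local_covering I2).
Hypothesis lc0 : local_covering I0.
Variable M : left_module C.

Local Notation XC := (colim_complex M).
Local Notation X1 := (colim_complex (lres I1 M)).
Local Notation X2 := (colim_complex (lres I2 M)).
Local Notation X0 := (colim_complex (lres I0 M)).
Local Notation i1 := (colim_fun (erefl (lres I1 M))).
Local Notation i2 := (colim_fun (erefl (lres I2 M))).
Local Notation f1 := (colim_fun (lres_fcomp M e1)).
Local Notation f2 := (colim_fun (lres_fcomp M e2)).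

Section Functionals.
Variable W : zmodType.
Local Notation L := (dual M W).

Definition fcoch (D : category) (I : functor D C) n
    (G : {additive colim_complex (lres I M) n -> W}) : cochain I L :=
  single (I := I) (L := L) (tcoch (N := lres I M) (n := n) G).
Arguments fcoch {D} I {n} G m s : rename.

Definition fcochC n (G : {additive XC n -> W}) : cochain (fid C) L :=
  single (I := fid C) (L := L) (tcoch (N := M) (n := n) G).
Arguments fcochC {n} G m s : rename.

Lemma eq_tcoch (D : category) (N : left_module D) n
    (G H : {additive tensor (ZN D n) N -> W}) s : G =1 H -> tcoch G s =
      tcoch H s.
Proof. by move=> GH; apply: additive_ext => y; exact: GH. Qed.

Lemma gdco_fcoch (D : category) (I : functor D C) n
    (G : {additive colim_complex (lres I M) n -> W})
    (H : {additive colim_complex (lres I M) n.+1 -> W}) m s :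
  (forall x, H x = G (chain_d (colim_complex (lres I M)) n x)) ->
  gdco (fcoch I G) (n := m) s = fcoch I H m s.
Proof.
move=> HG; rewrite gdco_single; apply: eq_single => s'.
rewrite (@eq_tcoch _ _ _ H
  (G \o tensor_map (ZN_d D n) (ntid (lres I M))) s' HG).
by rewrite [RHS]tcoch_d.
Qed.

Lemma gdco_fcochC n (G : {additive XC n -> W})
  (H : {additive XC n.+1 -> W}) m s :
  (forall x, H x = G (chain_d XC n x)) ->
  gdco (fcochC G) (n := m) s = fcochC H m s.
Proof.
move=> HG; rewrite gdco_single; apply: eq_single => s'.
rewrite (@eq_tcoch _ _ _ H (G \o tensor_map (ZN_d C n) (ntid M)) s' HG).
by rewrite [RHS]tcoch_d.
Qed.

Lemma fcoch_pull (D : category) (I : functor D C) (F : functor C0 D)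
  (e : I0 = fcomp I F)
    n (G : {additive colim_complex (lres I M) n -> W})
      (H : {additive X0 n -> W}) m s :
  (forall x, H x = G (colim_fun (lres_fcomp M e) n x)) ->
  pull e (fcoch I G) (n := m) s = fcoch I0 H m s.
Proof.
move=> HG; rewrite pull_single; apply: eq_single => s'.
rewrite (@eq_tcoch _ _ _ H
  (G \o colim_fun (lres_fcomp M e) n : {additive X0 n -> W}) s' HG).
apply: additive_ext => y.
rewrite -[RHS]/(add_app (tcoch (N := lres I0 M) (n := n)
  (G \o colim_fun (lres_fcomp M e) n : {additive X0 n -> W}) s') y)
    tcoch_colim_fun.
by rewrite (mcast_lres e).
Qed.

Lemma fcoch_restr (D : category) (I : functor D C) n (G : {additive XC n -> W})
    (H : {additive colim_complex (lres I M) n -> W}) m s :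
  (forall x, H x = G (colim_fun (erefl (lres I M)) n x)) ->
  fcochC G m (fcomp I s) = fcoch I H m s.
Proof.
move=> HG; rewrite /fcochC /fcoch; case: (pselect (n = m)) => [p|p];
  last by rewrite !single_neq.
subst m; rewrite !singleE (@eq_tcoch _ _ _ H
  (G \o colim_fun (erefl (lres I M)) n :
    {additive colim_complex (lres I M) n -> W}) s HG).
apply: additive_ext => y.
by rewrite -[RHS]/(add_app
  (tcoch (N := lres I M) (n := n) (G \o colim_fun (erefl (lres I M)) n
   : {additive colim_complex (lres I M) n -> W}) s) y) tcoch_colim_fun.
Qed.

Lemma fcoch0 (D : category) (I : functor D C) n
    (G : {additive colim_complex (lres I M) n -> W}) m s :
  (forall x, G x = 0) -> fcoch I G m s = 0.
Proof. by move=> G0; apply: single0 => s'; apply: additive_ext => y;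
  exact: G0. Qed.

Lemma fcochC0 n (G : {additive XC n -> W}) m s :
  (forall x, G x = 0) -> fcochC G m s = 0.
Proof. by move=> G0; apply: single0 => s'; apply: additive_ext => y;
  exact: G0. Qed.


Lemma fcoch_sum n (H1 H2 H3 : {additive X0 n -> W}) m s :
  (forall x, H1 x - H2 x + H3 x = 0) ->
  fcoch I0 H1 m s - fcoch I0 H2 m s + fcoch I0 H3 m s = 0.
Proof.
move=> H0; case: (pselect (n = m)) => [p|p]; last first.
  by rewrite /fcoch !single_neq // subr0 addr0.
subst m; rewrite /fcoch !singleE; apply: additive_ext => y; exact: H0.
Qed.

(** For n = 0 there are no (n-1)-chains; the group X0 n.-1 is then the junk value X0 0, and a
    functional on it is replaced by 0. *)
Definition ecoch n : {additive X0 n.-1 -> W} -> cochain I0 L :=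
  match n return {additive X0 n.-1 -> W} -> cochain I0 L with
  | 0 => fun _ _ _ => 0
  | m.+1 => fun G => fcoch I0 G
  end.

Lemma gdco_ecoch n (G : {additive X0 n.-1 -> W}) m s :
  gdco (ecoch G) (n := m) s = fcoch I0 (G \o chain_dm X0 n) m s.
Proof.
case: n G => [|n] G; last exact: gdco_fcoch.
by rewrite gdco0 fcoch0 // => x; exact: raddf0.
Qed.

Lemma tcoch_of_d (D : category) (N : left_module D)
  (a : cochain (fid D) (dual N W)) n s :
  tcoch (of_tcoch (a n) \o chain_d (colim_complex N) n :
    {additive colim_complex N n.+1 -> W}) s =
  gdco a (n := n.+1) s.
Proof.
rewrite [LHS]tcoch_d; apply: eq_bigr => i _.
by rewrite /coface_restr of_tcochK.
Qed.

Lemma tcoch_of_dm (D : category) (N : left_module D)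
  (a : cochain (fid D) (dual N W)) n s :
  tcoch (n := n) (of_tcoch (a n.-1) \o chain_dm (colim_complex N) n :
    {additive colim_complex N n -> W}) s =
  gdco a (n := n) s.
Proof.
case: n s => [|n] s; last exact: tcoch_of_d.
by apply: additive_ext => y; exact: raddf0.
Qed.

Lemma tcoch_of_dm_res (D : category) (I : functor D C) (a : cochain I L) n s :
  tcoch (N := lres I M) (n := n) (of_tcoch (N := lres I M) (a n.-1) \o
    chain_dm (colim_complex (lres I M)) n :
      {additive colim_complex (lres I M) n -> W}) s =
  gdco a (n := n) s.
Proof. exact: (@tcoch_of_dm _ (lres I M) a). Qed.

Lemma tcoch_of_pull (D : category) (I : functor D C) (F : functor C0 D)
  (e : I0 = fcomp I F)
    (a : cochain I L) n s :
  tcoch (N := lres I0 M) (n := n) (of_tcoch (N := lres I M) (a n) \o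
    colim_fun (lres_fcomp M e) n : {additive X0 n -> W}) s = pull e a
      (n := n) s.
Proof.
apply: additive_ext => y.
rewrite -[LHS]/(add_app
  (tcoch (N := lres I0 M) (n := n) (of_tcoch (N := lres I M) (a n) \o
    colim_fun (lres_fcomp M e) n : {additive X0 n -> W}) s) y).
by rewrite tcoch_colim_fun (mcast_lres e) of_tcochK.
Qed.

Lemma tcoch_of_restr (D : category) (I : functor D C)
  (a : cochain (fid C) L) n s :
  tcoch (N := lres I M) (n := n) (of_tcoch (N := M) (a n) \o
    colim_fun (erefl (lres I M)) n :
      {additive colim_complex (lres I M) n -> W}) s =
  a n (fcomp I s).
Proof.
apply: additive_ext => y.
rewrite -[LHS]/(add_app
  (tcoch (N := lres I M) (n := n) (of_tcoch (N := M) (a n) \o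
    colim_fun (erefl (lres I M)) n :
      {additive colim_complex (lres I M) n -> W}) s) y).
by rewrite tcoch_colim_fun of_tcochK.
Qed.

(** Acyclicity with coefficients Hom(M, W) in total degree n+1, translated back into functionals.
    For n = 0 the last component carries no information, hence the condition 0 < n. *)
Lemma functional_acyclic n (Gz : {additive XC n.+1 -> W})
  (G1 : {additive X1 n -> W})
    (G2 : {additive X2 n -> W}) (Gx : {additive X0 n.-1 -> W}) :
  (forall z, Gz (chain_d XC n.+1 z) = 0) ->
  (forall y, Gz (i1 n.+1 y) = G1 (chain_d X1 n y)) ->
  (forall y, Gz (i2 n.+1 y) = G2 (chain_d X2 n y)) ->
  (forall x, G1 (f1 n x) - G2 (f2 n x) + Gx (chain_dm X0 n x) = 0) ->
  exists (A : {additive XC n -> W}) (B1 : {additive X1 n.-1 -> W})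
      (B2 : {additive X2 n.-1 -> W}) (E : {additive X0 n.-1.-1 -> W}),
    [/\ forall z, Gz z = A (chain_d XC n z),
        forall y, G1 y = A (i1 n y) - B1 (chain_dm X1 n y),
        forall y, G2 y = A (i2 n y) - B2 (chain_dm X2 n y)
      & (0 < n)%N -> forall x, Gx x =
        B1 (f1 n.-1 x) - B2 (f2 n.-1 x) + E (chain_dm X0 n.-1 x)].
Proof.
move=> Gzd Gz1 Gz2 G12.
have [||||a [b1 [b2 [e [aE b1E b2E eE]]]]] :=
  @cochain_acyclic _ _ _ _ _ _ _ _ _ e1 e2
  po inj lc1 lc2 lc0 L (fcochC Gz) (fcoch I1 G1) (fcoch I2 G2) (ecoch Gx) _ _
    _ _ n.+2.
- by move=> m s; rewrite (@gdco_fcochC _ _ \0) ?fcochC0 // => x; rewrite Gzd.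
- move=> m s; rewrite (@gdco_fcoch _ _ _ _ (G1 \o chain_d X1 n)) //.
  by apply: fcoch_restr => x; rewrite Gz1.
- move=> m s; rewrite (@gdco_fcoch _ _ _ _ (G2 \o chain_d X2 n)) //.
  by apply: fcoch_restr => x; rewrite Gz2.
- move=> m s; rewrite (@fcoch_pull _ _ _ e1 _ _ (G1 \o f1 n)) //.
  by rewrite (@fcoch_pull _ _ _ e2 _ _ (G2 \o f2 n)) // gdco_ecoch fcoch_sum.
exists (of_tcoch (N := M) (a n)), (of_tcoch (N := lres I1 M) (b1 n.-1)),
  (of_tcoch (N := lres I2 M) (b2 n.-1)),
    (of_tcoch (N := lres I0 M) (e n.-1.-1)); split.
- apply: (@tcoch_inj _ M W n.+1 Gz
  (of_tcoch (N := M) (a n) \o chain_d XC n)) => s.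
  by rewrite tcoch_of_d -aE // /fcochC singleE.
- apply: (@tcoch_inj _ (lres I1 M) W n G1
    ((of_tcoch (N := M) (a n) \o i1 n) \-
      (of_tcoch (N := lres I1 M) (b1 n.-1) \o chain_dm X1 n))) => s.
  have := b1E n s (ltnW (ltnSn _)); rewrite /fcoch singleE => ->.
  rewrite -(tcoch_of_restr I1) -(tcoch_of_dm_res b1); exact: additive_ext.
- apply: (@tcoch_inj _ (lres I2 M) W n G2
    ((of_tcoch (N := M) (a n) \o i2 n) \-
      (of_tcoch (N := lres I2 M) (b2 n.-1) \o chain_dm X2 n))) => s.
  have := b2E n s (ltnW (ltnSn _)); rewrite /fcoch singleE => ->.
  rewrite -(tcoch_of_restr I2) -(tcoch_of_dm_res b2); exact: additive_ext.
- case: n Gz G1 G2 Gx Gzd Gz1 Gz2 G12 aE b1E b2E eE => [//|n] Gz G1 G2 Gx _ _ _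
  _ _ _ _ eE _.
  apply: (@tcoch_inj _ (lres I0 M) W n Gx
    (((of_tcoch (N := lres I1 M) (b1 n) \o f1 n) \-
      (of_tcoch (N := lres I2 M) (b2 n) \o f2 n))
     \+ (of_tcoch (N := lres I0 M) (e n.-1) \o chain_dm X0 n))) => s.
  have := eE n s; rewrite /ecoch /fcoch singleE => -> //; last by lia.
  rewrite -(tcoch_of_pull e1) -(tcoch_of_pull e2) -(tcoch_of_dm_res e).
  exact: additive_ext.
Qed.
End Functionals.

Local Notation V n := (XC n.+1 * X1 n * X2 n * X0 n.-1)%type.

(** The transpose of [tot_d], from total degree n+2 to n+1, with the same signs. *)
Definition total_boundary n (t : XC n.+2 * X1 n.+1 * X2 n.+1 * X0 n) : V n :=
  (chain_d XC n.+1 t.1.1.1 + i1 n.+1 t.1.1.2 + i2 n.+1 t.1.2,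
   f1 n t.2 - chain_d X1 n t.1.1.2, - f2 n t.2 - chain_d X2 n t.1.2,
   chain_dm X0 n t.2).

Lemma total_boundary_additive n : zmod_morphism (@total_boundary n).
Proof.
move=> t u.
have EC : chain_d XC n.+1 (t - u).1.1.1 + i1 n.+1 (t - u).1.1.2 + i2 n.+1
  (t - u).1.2 =
    chain_d XC n.+1 t.1.1.1 + i1 n.+1 t.1.1.2 + i2 n.+1 t.1.2 -
    (chain_d XC n.+1 u.1.1.1 + i1 n.+1 u.1.1.2 + i2 n.+1 u.1.2).
  rewrite (raddfB (chain_d XC n.+1)) (raddfB (i1 n.+1)) (raddfB (i2 n.+1)).
  by rewrite !opprD [in RHS]addrACA [in RHS](addrACA (chain_d _ _ _)).
have E1 : f1 n (t - u).2 - chain_d X1 n (t - u).1.1.2 =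
    f1 n t.2 - chain_d X1 n t.1.1.2 - (f1 n u.2 - chain_d X1 n u.1.1.2).
  by rewrite (raddfB (f1 n)) (raddfB (chain_d X1 n)) !opprD !opprK addrACA.
have E2 : - f2 n (t - u).2 - chain_d X2 n (t - u).1.2 =
    - f2 n t.2 - chain_d X2 n t.1.2 - (- f2 n u.2 - chain_d X2 n u.1.2).
  by rewrite (raddfB (f2 n)) (raddfB (chain_d X2 n)) !opprD !opprK addrACA.
have E0 : chain_dm X0 n (t - u).2 = chain_dm X0 n t.2 - chain_dm X0 n u.2.
  exact: raddfB.
by rewrite /total_boundary EC E1 E2 E0.
Qed.

Definition total_boundary_hom n :
    {additive XC n.+2 * X1 n.+1 * X2 n.+1 * X0 n -> V n} :=
  HB.pack (@total_boundary n)
    (GRing.isZmodMorphism.Build _ _ _ (@total_boundary_additive n)).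

(* For n = 0 there is no component in degree n - 1, hence the condition on x. *)
Lemma colim_cycle n (z : XC n.+1) (y1 : X1 n) (y2 : X2 n) (x : X0 n.-1) :
  chain_d XC n z + i1 n y1 + i2 n y2 = 0 ->
  chain_dm X1 n y1 = f1 n.-1 x -> chain_dm X2 n y2 = - f2 n.-1 x ->
  chain_dm X0 n.-1 x = 0 -> (n = 0%N -> x = 0) ->
  exists z' y1' y2' x', [/\ z = chain_d XC n.+1 z' + i1 n.+1 y1' + i2 n.+1 y2',
    y1 = f1 n x' - chain_d X1 n y1', y2 = - f2 n x' - chain_d X2 n y2'
    & x = chain_dm X0 n x'].
Proof.
move=> dz dy1 dy2 dx x0.
suff [t] : Defs.image (total_boundary_hom n) (z, y1, y2, x).
  by case=> -> -> -> ->; exists t.1.1.1, t.1.1.2, t.1.2, t.2.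
apply: functional_separation => W G GS.
pose Gz : {additive XC n.+1 -> W} :=
  G \o pair_inl _ _ \o pair_inl _ _ \o pair_inl _ _.
pose G1 : {additive X1 n -> W} :=
  G \o pair_inl _ _ \o pair_inl _ _ \o pair_inr _ _.
pose G2 : {additive X2 n -> W} := G \o pair_inl _ _ \o pair_inr _ _.
pose Gx : {additive X0 n.-1 -> W} := G \o pair_inr _ _.
have GE a b c d : G (a, b, c, d) = Gz a + G1 b + G2 c + Gx d.
  exact: additive_quad.
have GD t u1 u2 v : Gz (chain_d XC n.+1 t + i1 n.+1 u1 + i2 n.+1 u2) +
    G1 (f1 n v - chain_d X1 n u1) + G2 (- f2 n v - chain_d X2 n u2) +
    Gx (chain_dm X0 n v) = 0.
  by rewrite -GE; apply: GS; exists (t, u1, u2, v).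
have [|r0 r1 r2 r3] := @split_relation _ _ _ _ _ (Gz \o chain_d XC n.+1)
  (Gz \o i1 n.+1) (G1 \o chain_d X1 n) (Gz \o i2 n.+1) (G2 \o chain_d X2 n)
  (G1 \o f1 n) (G2 \o f2 n) (Gx \o chain_dm X0 n).
  move=> t u1 u2 v; rewrite -[RHS](GD t u1 u2 v).
  by rewrite !(raddfD Gz) (raddfB G1) (raddfB G2) (raddfN G2).
have [A [B1 [B2 [E [EZ E1 E2 EX]]]]] := functional_acyclic r0 r1 r2 r3.
rewrite GE EZ E1 E2 dy1 dy2 raddfN opprK.
(* For n > 0 the term in E vanishes because x is a cycle; for n = 0 both sides vanish because x =
   0. *)
have -> : Gx x = B1 (f1 n.-1 x) - B2 (f2 n.-1 x).
  case: (posnP n) => [n0|n_gt0]; last by rewrite EX // dx raddf0 addr0.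
  by rewrite x0 // !raddf0 ?subr0 ?addr0.
(* The values of B1 and B2 cancel, leaving A applied to the first cycle relation. *)
have alg (a b c p q : W) : a + (b - p) + (c + q) + (p - q) = a + b + c.
  by rewrite -addrA [_ + (p - q)]addrACA subrr addr0 [a + _]addrA [c + p]addrC
    addrA subrK.
by rewrite alg -!raddfD dz raddf0.
Qed.

(** A functional that kills boundaries and the images of i1 and i2 is a 0-cocycle of C restricting
    to 0 on C1 and C2; by acyclicity in total degree 0 it is 0. *)
Lemma colim_right (z : XC 0) : exists z' y1 y2,
  z = chain_d XC 0 z' + i1 0%N y1 + i2 0%N y2.
Proof.
suff : span_subgroup (fun t : XC 0 => (exists z', t = chain_d XC 0 z') \/
    (exists y1, t = i1 0%N y1) \/ (exists y2, t = i2 0%N y2)) z.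
  elim=> [|x|x y _ [z1 [u1 [v1 ->]]] _ [z2 [u2 [v2 ->]]]].
  - by exists 0, 0, 0; rewrite !raddf0 !addr0.
  - move=> [[z' ->]|[[y1 ->]|[y2 ->]]].
    + by exists z', 0, 0; rewrite (raddf0 (i1 0%N)) (raddf0 (i2 0%N)) !addr0.
    + by exists 0, y1, 0;
      rewrite (raddf0 (chain_d XC 0)) (raddf0 (i2 0%N)) addr0 add0r.
    + by exists 0, 0, y2;
      rewrite (raddf0 (chain_d XC 0)) (raddf0 (i1 0%N)) !add0r.
  - exists (z1 - z2), (u1 - u2), (v1 - v2).
    rewrite (raddfB (chain_d XC 0)) (raddfB (i1 0%N)) (raddfB (i2 0%N)).
    by rewrite !opprD [LHS]addrACA [in LHS](addrACA (chain_d _ _ _)).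
apply: functional_separation => W G GS.
have Gd x : G (chain_d XC 0 x) = 0 by apply: GS; apply: span_gen; left;
  exists x.
have G1 x : G (i1 0%N x) = 0 by apply: GS; apply: span_gen; right; left;
  exists x.
have G2 x : G (i2 0%N x) = 0 by apply: GS; apply: span_gen; right; right;
  exists x.
have [||||a [b1 [b2 [e [aE _ _ _]]]]] :=
  @cochain_acyclic _ _ _ _ _ _ _ _ _ e1 e2
  po inj lc1 lc2 lc0 (dual M W) (fcochC G) (fun _ _ => 0) (fun _ _ => 0)
    (fun _ _ => 0)
  _ _ _ _ 1%N.
- by move=> m s; rewrite (@gdco_fcochC _ _ _ \0) ?fcochC0 // => x; rewrite Gd.
- by move=> m s; rewrite gdco0 (@fcoch_restr _ _ _ _ _ \0) ?fcoch0 // => x;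
  rewrite G1.
- by move=> m s; rewrite gdco0 (@fcoch_restr _ _ _ _ _ \0) ?fcoch0 // => x;
  rewrite G2.
- by move=> m s; rewrite !pull0 gdco0 subrr addr0.
apply: (@tcoch_inj _ M W 0 G \0) => s.
have := aE 0%N s erefl; rewrite /fcochC singleE => ->.
by apply: additive_ext.
Qed.

Theorem colim_mayer_vietoris :
  let f1 := colim_map (lres_fcomp M e1) in
  let f2 := colim_map (lres_fcomp M e2) in
  let i1 := colim_map (erefl (lres I1 M)) in
  let i2 := colim_map (erefl (lres I2 M)) in
  let alpha n (x : colim (lres I0 M) n) := (f1 n x, - f2 n x) in
  let beta n (p : colim (lres I1 M) n * colim (lres I2 M) n) :=
    i1 n p.1 + i2 n p.2 in
  exists d : forall n, {additive colim M n.+1 -> colim (lres I0 M) n},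
    [/\ forall n, exact_at (d n) (alpha n),
        forall n, exact_at (alpha n) (beta n),
        forall n, exact_at (beta n.+1) (d n)
      & forall z, exists p, beta 0%N p = z].
Proof.
move=> mf1 mf2 mi1 mi2 alpha beta.
have alphaE n x Zx Z1 Z2 : alpha n (@cls _ _ _ x Zx) =
    (@cls _ _ _ (f1 n x) Z1, @cls _ _ _ (- f2 n x) Z2).
  rewrite /alpha /mf1 /mf2 (colim_map_cls Zx Z1); congr pair.
  rewrite (colim_map_cls Zx (colim_fun_cycles (lres_fcomp M e2) Zx)).
  exact/esym/clsN.
have betaE n y1 y2 Z1 Z2 Zq : beta n (@cls _ _ _ y1 Z1, @cls _ _ _ y2 Z2) =
    @cls _ _ _ (i1 n y1 + i2 n y2) Zq.
  rewrite /beta /mi1 /mi2.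
  rewrite [X in X + _](colim_map_cls Z1
    (colim_fun_cycles (erefl (lres I1 M)) Z1)).
  rewrite [X in _ + X](colim_map_cls Z2
    (colim_fun_cycles (erefl (lres I2 M)) Z2)).
  exact/esym/clsD.
have f_cycles n x (Zx : cycles X0 n x) := colim_fun_cycles (lres_fcomp M e1) Zx.
have g_cycles n x (Zx : cycles X0 n x) := colim_fun_cycles (lres_fcomp M e2) Zx.
have comp n (x : X0 n) : i1 n (f1 n x) = i2 n (f2 n x).
  pose id_ : {additive XC n -> XC n} := idfun.
  have E (D : category) (I : functor D C) (F : functor C0 D) (J : functor C0 C)
      (j : J = fcomp I F) (t : functor (ordcat n) C0) (y : M (J (t ord0))) :
    add_app (tcoch (N := M) (n := n) id_ (fcomp I (fcomp F t)))
      (mact M (ceq (ob_eq j (t ord0))) y) =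
    add_app (tcoch (N := M) (n := n) id_ (fcomp J t)) y.
    subst J; rewrite ceq_id mact1.
    exact: (congr1 (fun g => add_app g y)
      (JMeq_eq (coch_eq (tcoch (N := M) (n := n) id_) (fcompA I F t)))).
  have E' (D : category) (I : functor D C) (F : functor C0 D)
    (e : I0 = fcomp I F)
      (t : functor (ordcat n) C0) y :
    add_app (tcoch (N := lres I0 M) (n := n)
      (colim_fun (erefl (lres I M)) n \o colim_fun (lres_fcomp M e) n
       : {additive X0 n -> XC n}) t) y =
    add_app (tcoch (N := M) (n := n) id_ (fcomp I0 t)) y.
    rewrite tcoch_colim_fun (mcast_lres e).
    rewrite (@tcoch_colim_fun _ _ _ _ _ (erefl (lres I M)) _ _ id_).
    exact: E.
  apply: (@tcoch_inj _ (lres I0 M) (XC n) n (i1 n \o f1 n) (i2 n \o f2 n)) => s.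
  by apply: additive_ext => y;
    rewrite -[LHS]/(add_app _ y) -[RHS]/(add_app _ y) !E'.
have H n : exists d : {additive colim M n.+1 -> colim (lres I0 M) n},
    exact_at (beta n.+1) d /\ exact_at d (alpha n).
  apply: (@connecting_hom _ _ _ _ _ _ _ _ _ _ _ _ _ _ _ _ _ _
    (i1 n.+1) (i2 n.+1) (f1 n) (\- f2 n) (chain_d X1 n) (chain_d X2 n)).
  - by move=> x Zx Z1 Z2; exact: alphaE.
  - by move=> y1 y2 Z1 Z2 Zq; exact: betaE.
  - by move=> x; exact: f_cycles.
  - by move=> x Zx; apply: in_subN; exact: g_cycles.
  - by [].
  - by [].
  - by [].
  - by [].
  - move=> x y1 y2 _ h1 h2.
    suff E : chain_d XC n (i1 n.+1 y1 + i2 n.+1 y2) = 0 by exact: E.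
    rewrite (raddfD (chain_d XC n)) -!colim_fun_d h1 h2.
    by rewrite -[X in _ + i2 n X]/(- f2 n x) (raddfN (i2 n)) comp subrr.
  - move=> z dz.
    (* Totality: the total cycle (z, 0, 0, 0) bounds, and its primitive contains the zigzag. *)
    have [||||//|z' [y1 [y2 [x [zE E1 E2 E0]]]]] :=
      @colim_cycle n z 0 0 0.
    + by rewrite (dz : chain_d XC n z = 0) (raddf0 (i1 n))
      (raddf0 (i2 n)) !addr0.
    + by rewrite !raddf0.
    + by rewrite !raddf0.
    + by rewrite raddf0.
    exists x; first exact/cyclesP/esym.
    exists y1, y2; split.
    + by rewrite zE -(addrA (chain_d _ _ _)) addrK; exists z'.
    + by apply/eqP; rewrite eq_sym -subr_eq0 -E1.
    + by apply/eqP; rewrite eq_sym -subr_eq0 -[_ - _]E2.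
  - move=> x Zx [y1 [y2 [[w wE] h1 h2]]].
    (* Single-valuedness: the zigzag from 0 to x is itself a total cycle, one degree higher, and its
       C0-component makes x a boundary. *)
    have [||||//|z' [y1' [y2' [x' [_ _ _ E0]]]]] := @colim_cycle n.+1 w y1 y2 x.
    + by rewrite -wE sub0r -addrA addNr.
    + by [].
    + by [].
    + exact/cyclesP.
    by exists x'.
  - move=> x y1 y2 [u ->] h1 h2.
    exists (y1 - f1 n.+1 u), (y2 + f2 n.+1 u); split.
    + by rewrite raddfB -colim_fun_d h1 subrr.
    + by rewrite raddfD -colim_fun_d h2 addNr.
    + rewrite (raddfB (i1 n.+1)) (raddfD (i2 n.+1)) comp.
      by rewrite addrACA addNr addr0.
exists (fun n => projT1 (cid (H n))); split=> [n|n|n|z].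
- by case: (projT2 (cid (H n))).
- move=> [v1 v2]; have [y1 [Z1 ->]] := clsP v1; have [y2 [Z2 ->]] := clsP v2.
  rewrite (betaE _ _ _ _ _ (in_subD (colim_fun_cycles (erefl (lres I1 M)) Z1)
    (colim_fun_cycles (erefl (lres I2 M)) Z2))).
  split=> [/cls_eq0 [w wE]|[u]].
    (* The pair (y1, y2), completed by -w, is a total cycle with C0-component 0; the C0-component of
       a primitive is the required preimage. *)
    have [||||//|z' [y1' [y2' [x [_ E1 E2 E0]]]]] :=
      @colim_cycle n (- w) y1 y2 0.
    + by rewrite (raddfN (chain_d XC n)) -wE -addrA addNr.
    + by rewrite raddf0; exact/cyclesP.
    + by rewrite raddf0 ?oppr0; exact/cyclesP.
    + by rewrite raddf0.
    have Zx : cycles X0 n x by exact/cyclesP/esym.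
    exists (cls _ Zx); rewrite
      (alphaE _ _ _ (f_cycles _ _ Zx) (in_subN (g_cycles _ _ Zx))).
    congr pair; apply/cls_eq.
      by rewrite E1 opprB addrC subrK; exists y1'.
    by rewrite E2 opprD !opprK addrA addNr add0r; exists y2'.
  have [x [Zx ->]] := clsP u.
  rewrite (alphaE _ _ _ (f_cycles _ _ Zx) (in_subN (g_cycles _ _ Zx))).
  move=> [/cls_eq h1 /cls_eq h2]; apply/cls_eq0.
  have -> : i1 n y1 + i2 n y2 = - (i1 n (f1 n x - y1) + i2 n (- f2 n x - y2)).
    rewrite (raddfB (i1 n)) (raddfB (i2 n)) (raddfN (i2 n)) comp.
    by rewrite addrACA subrr add0r opprD !opprK.
  by apply: in_subN; apply: in_subD; apply: colim_fun_boundaries.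
- by case: (projT2 (cid (H n))).
- have [x [Zx ->]] := clsP z; have [z' [y1 [y2 xE]]] := colim_right x.
  have c1 : cycles X1 0 y1 by []; have c2 : cycles X2 0 y2 by [].
  exists (cls _ c1, cls _ c2);
    rewrite (betaE _ _ _ _ _ (in_subD (colim_fun_cycles (erefl (lres I1 M)) c1)
    (colim_fun_cycles (erefl (lres I2 M)) c2))).
  by apply/cls_eq; rewrite xE -(addrA (chain_d _ _ _)) opprD addrCA subrr
    addr0; apply: in_subN; exists z'.
Qed.
End ColimMayerVietoris.

Theorem theorem1 (C0 C1 C2 C : category)
    (F1 : functor C0 C1) (F2 : functor C0 C2)
    (I1 : functor C1 C) (I2 : functor C2 C) (I0 : functor C0 C)
    (e1 : I0 = fcomp I1 F1) (e2 : I0 = fcomp I2 F2) :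
  is_pushout F1 F2 I1 I2 ->
  injective (fob F1) \/ injective (fob F2) ->
  local_covering I1 -> local_covering I2 -> local_covering I0 ->
  (forall M : left_module C,
    let f1 := colim_map (lres_fcomp M e1) in
    let f2 := colim_map (lres_fcomp M e2) in
    let i1 := colim_map (erefl (lres I1 M)) in
    let i2 := colim_map (erefl (lres I2 M)) in
    let alpha n (x : colim (lres I0 M) n) := (f1 n x, - f2 n x) in
    let beta n (p : colim (lres I1 M) n * colim (lres I2 M) n) :=
      i1 n p.1 + i2 n p.2 in
    exists d : forall n, {additive colim M n.+1 -> colim (lres I0 M) n},
      [/\ forall n, exact_at (d n) (alpha n),
          forall n, exact_at (alpha n) (beta n),
          forall n, exact_at (beta n.+1) (d n)
        & forall z, exists p, beta 0%N p = z]) /\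
  (forall L : right_module C,
    let f1 := lim_map (rres_fcomp L e1) in
    let f2 := lim_map (rres_fcomp L e2) in
    let i1 := lim_map (erefl (rres I1 L)) in
    let i2 := lim_map (erefl (rres I2 L)) in
    let alpha n (z : lim L n) := (i1 n z, i2 n z) in
    let beta n (p : lim (rres I1 L) n * lim (rres I2 L) n) :=
      f1 n p.1 - f2 n p.2 in
    exists d : forall n, {additive lim (rres I0 L) n -> lim L n.+1},
      [/\ forall z, alpha 0%N z = 0 -> z = 0,
          forall n, exact_at (alpha n) (beta n),
          forall n, exact_at (beta n) (d n)
        & forall n, exact_at (d n) (alpha n.+1)]).
Proof.
move=> po inj lc1 lc2 lc0; split=> [M|L].
  exact: (colim_mayer_vietoris e1 e2 po inj lc1 lc2 lc0 M).
exact: (lim_mayer_vietoris e1 e2 po inj lc1 lc2 lc0 L).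
Qed.
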